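(* Let $q=2$, $a_k=\exp(\alpha k)$ and $\sigma_k=k^{\beta}$, $k\in\mathbb N$, with $\alpha>0$, $\beta>0$. All limits are as $\varepsilon\to0$. (a) The sharp asymptotics $$\beta_\varepsilon(r_\varepsilon,\vartheta)=\Phi(H^{(\vartheta)}-u_\varepsilon)+o(1)\quad(\vartheta\in(0,1)),\qquad \gamma_\varepsilon(r_\varepsilon)=2\Phi(-u_\varepsilon/2)+o(1)$$ hold, where $u_\varepsilon=u_\varepsilon(r_\varepsilon)$ is the value of the extreme problem $$u_\varepsilon^2=\frac{1}{2\varepsilon^4}\inf_{\eta\in\Theta_2(r_\varepsilon)}\sum_{k\in\mathbb N}\eta_k^4 ,$$ which satisfies $$u_\varepsilon\sim c_2\,\varepsilon^{-2}\,r_\varepsilon^{2}\,(\log r_\varepsilon^{-1})^{-2\beta-1/2}$$ for a constant $c_2=c_2(\alpha,\beta)>0$. (b) The asymptotically minimax family of tests $\psi_{\varepsilon,H}=\mathbf 1_{\{t_\varepsilon>H\}}$ are determined by the test statistics $$t_\varepsilon=\sum_{k\in\mathbb N}w_k\big((y_k/\varepsilon)^2-1\big),\qquad w_k=\frac{\tilde\eta_k^2}{\sqrt{2\sum_{j\in\mathbb N}\tilde\eta_j^4}},\qquad w_0=\sup_{k\in\mathbb N}w_k,$$ where $\{\tilde\eta_k\}_{k\in\mathbb N}$ is the extreme sequence of the extreme problem in (a), given by $$\tilde\eta_k^2=z_0^2\,k^{2\beta}\big(1-e^{2\alpha(k-m)}\big)_+,\qquad k\in\mathbb N,$$ with $z_0=z_{0,\varepsilon}$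 and the efficient dimension $m=m_\varepsilon$ determined by $$\sum_{k\in\mathbb N}k^{2\beta}\tilde\eta_k^2=r_\varepsilon^2,\qquad \sum_{k\in\mathbb N}e^{2\alpha k}k^{2\beta}\tilde\eta_k^2=1 .$$ (c) The separation rates are of the form $$r_\varepsilon^*=\varepsilon\,(\log\varepsilon^{-1})^{\beta+1/4}.$$
   Context: Model: one observes $y=\{y_k\}_{k\in\mathbb N}$, $y_k=\eta_k+\varepsilon\xi_k$, with $\xi_k$ i.i.d. $N(0,1)$, $\varepsilon>0$ small, $\eta\in\ell^2$ unknown; $E_{\varepsilon,\eta}$ is the corresponding expectation. Sets: $\Theta_2=\{\eta\in\ell^2:\sum_k|a_k\sigma_k\eta_k|^2\le1\}$, $\Theta_2(r)=\{\eta\in\Theta_2:\sum_k\sigma_k^2\eta_k^2\ge r^2\}$. $r_\varepsilon>0$ is a given family with $r_\varepsilon\to0$ as $\varepsilon\to0$. One tests $H_0:\eta=0$ against $H_1:\eta\in\Theta_2(r_\varepsilon)$. Tests and errors: a (randomized) test $\psi$ is a measurable function of $y$ with values in $[0,1]$. $\alpha_\varepsilon(\psi)=E_{\varepsilon,0}\psi$, $\beta_\varepsilon(\Theta,\psi)=\sup_{\eta\in\Theta}E_{\varepsilon,\eta}(1-\psi)$, $\gamma_\varepsilon(\Theta,\psi)=\alpha_\varepsilon(\psi)+\beta_\varepsilon(\Theta,\psi)$. For a level $\vartheta\in(0,1)$, $\beta_\varepsilon(r,\vartheta)=\inf_{\psi:\alpha_\varepsilon(\psi)\le\vartheta}\beta_\varepsilon(\Theta_2(r),\psi)$,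 and $\gamma_\varepsilon(r)=\inf_\psi\gamma_\varepsilon(\Theta_2(r),\psi)$. Asymptotically minimax: a family $\psi_{\varepsilon,\vartheta}$ is asymptotically minimax (first criterion) if $\alpha_\varepsilon(\psi_{\varepsilon,\vartheta})\le\vartheta+o(1)$ and $\beta_\varepsilon(\Theta_2(r_\varepsilon),\psi_{\varepsilon,\vartheta})=\beta_\varepsilon(r_\varepsilon,\vartheta)+o(1)$; a family $\psi_\varepsilon$ is asymptotically minimax (second criterion) if $\gamma_\varepsilon(\Theta_2(r_\varepsilon),\psi_\varepsilon)=\gamma_\varepsilon(r_\varepsilon)+o(1)$. Separation rate: a positive family $r_\varepsilon^*\to0$ such that $\gamma_\varepsilon(r_\varepsilon)\to1$ and $\beta_\varepsilon(r_\varepsilon,\vartheta)\to1-\vartheta$ for any $\vartheta\in(0,1)$ as $r_\varepsilon/r_\varepsilon^*\to0$, while $\gamma_\varepsilon(r_\varepsilon)\to0$ and $\beta_\varepsilon(r_\varepsilon,\vartheta)\to0$ for any $\vartheta\in(0,1)$ as $r_\varepsilon/r_\varepsilon^*\to\infty$. Notation: $(x)_+=\max\{0,x\}$; $\mathbf 1_{\{\cdot\}}$ is the indicator function; $\Phi$ is the standard normal distribution function and $\Phi(H^{(\vartheta)})=1-\vartheta$; $c_\varepsilon\sim d_\varepsilon$ means $c_\varepsilon/d_\varepsilon\to1$. For $r_\varepsilon$ small enough the two equations determining $z_0$ and $m$ (equivalently $z_0$ and $A=e^{-2\alpha m}$) have a unique solution. *)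

(* Defs.v *)
From HB Require Import structures.
From mathcomp Require Export all_boot all_order all_algebra.
From mathcomp Require Export all_classical all_reals all_analysis.
Export Order.TTheory GRing.Theory Num.Theory numFieldNormedType.Exports.

Set Implicit Arguments.
Unset Strict Implicit.
Unset Printing Implicit Defensive.

Local Open Scope classical_set_scope.
Local Open Scope ring_scope.

(* Throughout, sequences indexed by {1, 2, ...} are functions of k : nat whose
   value at k is the term of index k.+1. *)

Definition iid_std_normal (d : measure_display) (Omega : measurableType d)
    (R : realType) (P : probability Omega R) (xi : nat -> {RV P >-> R}) : Prop :=
  (forall k (A : set R), measurable A ->
     distribution P (xi k) A = normal_prob 0 1 A) /\
  (forall (J : seq nat) (A : nat -> set R),
     uniq J -> (forall k, measurable (A k)) ->
     P (\bigcap_(k in [set` J]) (xi k @^-1` A k)) =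
     (\prod_(k <- J) P (xi k @^-1` A k))%E).

(* E_{eps,eta} psi; it depends on (P, xi) only through the law of xi. *)
Definition model_expectation (d : measure_display) (Omega : measurableType d)
    (R : realType) (P : probability Omega R) (xi : nat -> {RV P >-> R})
    (eps : R) (eta : nat -> R) (psi : (nat -> R) -> R) : R :=
  fine 'E_P[(fun w => psi (fun k => eta k + eps * xi k w))%R]%E.

Definition cylinders (R : realType) : set (set (nat -> R)) :=
  [set C | exists k (A : set R), measurable A /\ C = [set y | A (y k)]].

(* The sigma-algebra on sequences is the product one. *)
Definition is_test (R : realType) (psi : (nat -> R) -> R) : Prop :=
  measurable_fun setT (psi : g_sigma_algebraType (@cylinders R) -> R) /\
  forall y, 0 <= psi y <= 1.

Definition err1 (d : measure_display) (Omega : measurableType d)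
    (R : realType) (P : probability Omega R) (xi : nat -> {RV P >-> R})
    (eps : R) (psi : (nat -> R) -> R) : R :=
  model_expectation xi eps (fun=> 0) psi.

Definition err2 (d : measure_display) (Omega : measurableType d)
    (R : realType) (P : probability Omega R) (xi : nat -> {RV P >-> R})
    (eps : R) (Theta : set (nat -> R)) (psi : (nat -> R) -> R) : R :=
  sup [set model_expectation xi eps eta (fun y => 1 - psi y) | eta in Theta].

Definition total_err (d : measure_display) (Omega : measurableType d)
    (R : realType) (P : probability Omega R) (xi : nat -> {RV P >-> R})
    (eps : R) (Theta : set (nat -> R)) (psi : (nat -> R) -> R) : R :=
  err1 xi eps psi + err2 xi eps Theta psi.

Definition minimax_err2 (d : measure_display) (Omega : measurableType d)
    (R : realType) (P : probability Omega R) (xi : nat -> {RV P >-> R})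
    (eps : R) (Theta : set (nat -> R)) (theta : R) : R :=
  inf [set err2 xi eps Theta psi | psi in
        [set psi | is_test psi /\ err1 xi eps psi <= theta]].

Definition minimax_total_err (d : measure_display) (Omega : measurableType d)
    (R : realType) (P : probability Omega R) (xi : nat -> {RV P >-> R})
    (eps : R) (Theta : set (nat -> R)) : R :=
  inf [set total_err xi eps Theta psi | psi in
        [set psi | @is_test R psi]].

Definition ell2 (R : realType) : set (nat -> R) :=
  [set eta | (\sum_(k <oo) ((eta k) ^+ 2)%:E < +oo)%E].

Definition Theta2 (R : realType) (a sigma : nat -> R) : set (nat -> R) :=
  [set eta | ell2 eta /\
     (\sum_(k <oo) (`|a k * sigma k * eta k| ^+ 2)%:E <= 1)%E].

Definition Theta2r (R : realType) (a sigma : nat -> R) (r : R) :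
    set (nat -> R) :=
  [set eta | Theta2 a sigma eta /\
     ((r ^+ 2)%:E <= \sum_(k <oo) ((sigma k) ^+ 2 * (eta k) ^+ 2)%:E)%E].

Definition quartic_sum (R : realType) (eta : nat -> R) : \bar R :=
  (\sum_(k <oo) ((eta k) ^+ 4)%:E)%E.

(* If [Theta2r a sigma r] is empty (which only happens for large r, since a and
   sigma are positive), the infimum is +oo and the value defaults to 0. *)
Definition extreme_value (R : realType) (a sigma : nat -> R) (eps r : R) : R :=
  Num.sqrt ((2 * eps ^+ 4)^-1 *
    fine (ereal_inf [set quartic_sum eta | eta in Theta2r a sigma r])).

Definition extreme_sequence (R : realType) (a sigma : nat -> R) (r : R)
    (eta : nat -> R) : Prop :=
  Theta2r a sigma r eta /\
  quartic_sum eta =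
    ereal_inf [set quartic_sum eta' | eta' in Theta2r a sigma r].

(* [v] stands for the squared sequence eta_k^2. *)

Definition weights (R : realType) (v : nat -> R) (k : nat) : R :=
  v k / Num.sqrt (2 * fine (\sum_(j <oo) ((v j) ^+ 2)%:E)%E).

Definition quad_stat (R : realType) (v : nat -> R) (eps : R) (y : nat -> R) :
    R :=
  limn (series (fun k => weights v k * ((y k / eps) ^+ 2 - 1))).

Definition quad_test (R : realType) (v : nat -> R) (eps H : R) (y : nat -> R) :
    R :=
  (H < quad_stat v eps y)%R%:R.

(* Families indexed by eps > 0 are functions R -> R considered along 0^'+. *)
Definition vanishing_family (R : realType) (r : R -> R) : Prop :=
  (\forall eps \near 0^'+, 0 < r eps) /\ r eps @[eps --> 0^'+] --> 0.

Definition asymp_equiv (R : realType) (c d : R -> R) : Prop :=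
  (c eps / d eps) @[eps --> 0^'+] --> (1 : R).

Definition asymp_minimax_level (d : measure_display) (Omega : measurableType d)
    (R : realType) (P : probability Omega R) (xi : nat -> {RV P >-> R})
    (Theta : R -> set (nat -> R)) (theta : R)
    (psi : R -> (nat -> R) -> R) : Prop :=
  [/\ \forall eps \near 0^'+, is_test (psi eps),
      exists rho : R -> R, rho eps @[eps --> 0^'+] --> 0 /\
        \forall eps \near 0^'+, err1 xi eps (psi eps) <= theta + rho eps
    & (err2 xi eps (Theta eps) (psi eps) -
       minimax_err2 xi eps (Theta eps) theta) @[eps --> 0^'+] --> 0].

Definition asymp_minimax_total (d : measure_display) (Omega : measurableType d)
    (R : realType) (P : probability Omega R) (xi : nat -> {RV P >-> R})
    (Theta : R -> set (nat -> R)) (psi : R -> (nat -> R) -> R) : Prop :=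
  (\forall eps \near 0^'+, is_test (psi eps)) /\
  (total_err xi eps (Theta eps) (psi eps) -
   minimax_total_err xi eps (Theta eps)) @[eps --> 0^'+] --> 0.

Definition separation_rate (d : measure_display) (Omega : measurableType d)
    (R : realType) (P : probability Omega R) (xi : nat -> {RV P >-> R})
    (Theta : R -> set (nat -> R)) (rstar : R -> R) : Prop :=
  vanishing_family rstar /\
  forall r : R -> R, vanishing_family r ->
    ((r eps / rstar eps) @[eps --> 0^'+] --> 0 ->
      minimax_total_err xi eps (Theta (r eps)) @[eps --> 0^'+] --> (1 : R) /\
      forall theta : R, 0 < theta < 1 ->
        minimax_err2 xi eps (Theta (r eps)) theta @[eps --> 0^'+]
          --> 1 - theta) /\
    ((r eps / rstar eps) @[eps --> 0^'+] --> +oo ->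
      minimax_total_err xi eps (Theta (r eps)) @[eps --> 0^'+] --> 0 /\
      forall theta : R, 0 < theta < 1 ->
        minimax_err2 xi eps (Theta (r eps)) theta @[eps --> 0^'+] --> 0).

Definition Phi (R : realType) (x : R) : R :=
  fine (normal_prob 0 1 `]-oo, x]).

Definition exp_coef (R : realType) (alpha : R) (k : nat) : R :=
  expR (alpha * k.+1%:R).

Definition pow_coef (R : realType) (beta : R) (k : nat) : R :=
  k.+1%:R `^ beta.

Definition extreme_sq (R : realType) (alpha beta z0 m : R) (k : nat) : R :=
  z0 ^+ 2 * k.+1%:R `^ (2 * beta) *
    Num.max 0 (1 - expR (2 * alpha * (k.+1%:R - m))).

(* Only z0 ^+ 2 enters the equations; z0 > 0 fixes the sign. *)
Definition extreme_params (R : realType) (alpha beta r z0 m : R) : Prop :=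
  [/\ 0 < z0,
      (\sum_(k <oo) (k.+1%:R `^ (2 * beta) *
         extreme_sq alpha beta z0 m k)%:E = (r ^+ 2)%:E)%E
    & (\sum_(k <oo) (expR (2 * alpha * k.+1%:R) * k.+1%:R `^ (2 * beta) *
         extreme_sq alpha beta z0 m k)%:E = 1)%E].

(* Main.v *)
(* Write u for the value of the extreme problem and v for the squares of its
   extreme sequence. By the Kuhn-Tucker conditions, sum v eta^2 >= sum v^2 on the
   alternative, so the quadratic statistic with weights proportional to v has mean
   at least u under every alternative; when the weights are uniformly small it is
   asymptotically N(0, 1) under the null hypothesis (Lindeberg), which bounds its
   two errors. Conversely, put independent random signs on the extreme sequence:
   since cosh x >= exp (x^2/2 - x^4/12), the likelihood ratio of this prior is
   nearly exp (u t - u^2/2) with t the same statistic, and the Bayes risk is that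
   of testing N(0, 1) against N(u, 1). Finally the equations for z0 and m are
   reduced to one equation solved by the intermediate value theorem, uniqueness
   follows from that of the extreme sequence, and with sum k^(4 beta)
   ~ m^(4 beta + 1) / (4 beta + 1) and alpha m ~ log (1/r) one gets the rate. *)

Require Import Defs.
From mathcomp Require Import ring lra measurable_realfun.

Set Implicit Arguments.
Unset Strict Implicit.
Unset Printing Implicit Defensive.

Local Open Scope classical_set_scope.
Local Open Scope ring_scope.

(** * Gaussian integrals *)

(** Separation rates quantify over all families [r], so no estimate may prescribe how [r] depends on
    [eps]. The extreme sequence depends on [r] alone and [eps] enters only through [u]. Hence the
    estimates have the form: for each error [e] there is a bound [kap] on the weights, or a radius
    [rho], valid for all [eps > 0]; limits in [eps] appear only at the end. The price is uniformity
    in an unbounded [u]: for large [u] the normal limits are themselves below [e]. Both criteria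
    reduce to the weighted risk [c * err1 + err2], with [c = exp (u H - u^2 / 2)] the likelihood
    ratio of [N(u, 1)] to [N(0, 1)] at the threshold [H]; [H = u / 2] gives [c = 1]. Against a prior
    with likelihood ratio [L], the least such risk is the null expectation of [min (c, L)]. This is
    bounded and increasing in [L], so convergence in law of the statistic suffices and a lower bound
    on [L] is enough. On the space of sequences, the law of the noise enters as invariance under
    resampling one coordinate; variances, the Lindeberg swap and the averaging over signs are
    inductions on it. *)

Lemma ge0_integral_image d1 d2 (T1 : measurableType d1) (T2 : measurableType d2)
    (R : realType) (m1 : {measure set T1 -> \bar R})
    (m2 : {measure set T2 -> \bar R}) (g : T1 -> T2) (f : T2 -> \bar R) :
  measurable_fun setT g ->
  (forall A, measurable A -> m2 A = m1 (g @^-1` A)) ->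
  measurable_fun setT f -> (forall x, 0 <= f x)%E ->
  (\int[m2]_x f x = \int[m1]_x f (g x))%E.
Proof.
move=> mg m12 mf f0.
transitivity (\int[measure_function_pushforward__canonical__measure_function_Measure m1 mg]_x f x)%E.
  by apply: eq_measure_integral => A mA _; exact: m12.
by rewrite ge0_integral_pushforward.
Qed.

Section gauss1.
Context {R : realType}.
Local Notation leb := (@lebesgue_measure R).
Local Notation N := (@normal_prob R 0 1).
Local Notation phi := (@normal_pdf R 0 1).

(** The Radon-Nikodym derivative of [normal_prob] and the density [phi] have the same integral over
    every measurable set, so they agree almost everywhere. *)
Lemma ge0_integral_normal (f : R -> \bar R) : measurable_fun setT f ->
  (forall x, 0 <= f x)%E ->
  (\int[N]_x f x = \int[leb]_x (f x * (phi x)%:E))%E.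
Proof.
move=> mf f0.
have dom := @normal_prob_dominates R 0 1.
rewrite -(Radon_Nikodym_SigmaFinite.change_of_variables dom)//.
apply: ae_eq_integral => //.
- apply: emeasurable_funM => //; apply: (measurable_int leb).
  exact: Radon_Nikodym_SigmaFinite.f_integrable.
- apply: emeasurable_funM => //=; apply/measurableT_comp => //=.
  exact: measurable_normal_pdf.
- apply: ae_eqe_mul2l => /=.
  apply: integral_ae_eq => //=.
  + exact: Radon_Nikodym_SigmaFinite.f_integrable.
  + by apply/measurableT_comp =>//; exact: measurable_normal_pdf.
  + by move=> E E01 mE; rewrite -Radon_Nikodym_SigmaFinite.f_integral.
Qed.

Let aff (s m : R) (x : measurableTypeR R) : measurableTypeR R := s * x + m.

Lemma measurable_affine (s m : R) : measurable_fun setT (aff s m).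
Proof.
have : measurable_fun setT (fun x : R => s * x + m).
  by apply: measurable_funD => //; apply: measurable_funM.
by [].
Qed.

(** The pushforward scaled by [s] gives []a, b]] the mass [b - a], which characterises Lebesgue
    measure. *)
Lemma lebesgue_affine (s m : R) (s0 : 0 < s) (A : set R) : measurable A ->
  leb A = (s%:E * leb (aff s m @^-1` A))%E.
Proof.
move=> mA.
have ms := measurable_affine s m.
pose mu := mscale (NngNum (ltW s0)) (measure_function_pushforward__canonical__measure_function_Measure leb ms).
apply: (@lebesgue_measure_unique R mu _ A mA).
move=> X [[a b] _ <-] /=.
rewrite /mu /mscale /= /pushforward.
have -> : aff s m @^-1` `]a, b] = `](a - m) / s, (b - m) / s]%classic.
  apply/seteqP; split => x; rewrite /= !in_itv/= /aff ltr_pdivrMr// ler_pdivlMr// mulrC.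
    by move=> /andP[? ?]; apply/andP; split; lra.
  by move=> /andP[? ?]; apply/andP; split; lra.
rewrite !lebesgue_measure_itv /= !lte_fin ltr_pM2r ?invr_gt0// ltrD2r.
case: ifP => ab; last by rewrite mule0.
by rewrite -!EFinD -EFinM; congr (_%:E); field; lra.
Qed.

Lemma ge0_integral_affine (s m : R) (f : R -> \bar R) : 0 < s ->
  measurable_fun setT f -> (forall x, 0 <= f x)%E ->
  (\int[leb]_x f x = s%:E * \int[leb]_x f (s * x + m)%R)%E.
Proof.
move=> s0 mf f0.
have ms := measurable_affine s m.
have mf' : measurable_fun setT (f : measurableTypeR R -> \bar R) by [].
pose im := measure_function_pushforward__canonical__measure_function_Measure leb ms.
transitivity (\int[mscale (NngNum (ltW s0)) im]_x f x)%E.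
  apply: eq_measure_integral => A mA _.
  by rewrite /mscale/= /pushforward; exact: lebesgue_affine.
by rewrite ge0_integral_mscale//= ge0_integral_pushforward.
Qed.

Lemma phiE x : phi x = normal_peak 1 * expR (- (x ^+ 2 / 2)).
Proof.
rewrite normal_pdfE ?oner_eq0// /normal_fun subr0 expr1n; congr (_ * expR _).
by rewrite mulNr.
Qed.

Lemma phi_ge0 x : 0 <= phi x. Proof. exact: normal_pdf_ge0. Qed.

Lemma measurable_phi : measurable_fun setT phi.
Proof. exact: measurable_normal_pdf. Qed.

(** After the translation [t = x + a], the factor [exp (a (x + a) - a^2 / 2)] turns [phi (x + a)]
    into [phi x]. *)
Lemma cameron_martin (a : R) (f : R -> \bar R) : measurable_fun setT f ->
  (forall x, 0 <= f x)%E ->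
  (\int[N]_t f (t + a)%R = \int[N]_t (f t * (expR (a * t - a ^+ 2 / 2))%:E))%E.
Proof.
move=> mf f0.
have ma (b : R) : measurable_fun setT (fun t : R => t + b) by exact: measurable_funD.
have mexp : measurable_fun setT (fun t : R => expR (a * t - a ^+ 2 / 2)).
  apply: measurableT_comp => //.
  by apply: measurable_funB => //; exact: measurable_funM.
have mfa : measurable_fun setT (fun t : R => f (t + a)%R).
  by apply: measurableT_comp mf _; exact: ma.
have mfe : measurable_fun setT (fun t : R => f t * (expR (a * t - a ^+ 2 / 2))%:E)%E.
  by apply: emeasurable_funM => //; exact: measurableT_comp.
have fe0 (t : R) : (0 <= f t * (expR (a * t - a ^+ 2 / 2))%:E)%E.
  by rewrite mule_ge0// lee_fin expR_ge0.
rewrite ge0_integral_normal// [RHS]ge0_integral_normal//.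
have mfep : measurable_fun setT (fun t : R => f t * (expR (a * t - a ^+ 2 / 2))%:E * (phi t)%:E)%E.
  by apply: emeasurable_funM => //; apply/measurable_EFinP; exact: measurable_phi.
rewrite [RHS](@ge0_integral_affine 1 a (fun t => f t * (expR (a * t - a ^+ 2 / 2))%:E * (phi t)%:E)%E)//; last first.
  by move=> x; rewrite !mule_ge0// lee_fin ?expR_ge0 ?phi_ge0.
rewrite mul1e; apply: eq_integral => x _; rewrite mul1r -muleA -EFinM; congr (_ * _%:E)%E.
by rewrite !phiE mulrCA -expRD; congr (_ * expR _); field.
Qed.

Lemma integral_normal1 : (\int[N]_t 1 = 1)%E.
Proof.
by rewrite integral_cst//= mul1e -[RHS](@probability_setT _ _ _ N).
Qed.

Lemma mgf_normal (a : R) : (\int[N]_t (expR (a * t))%:E = (expR (a ^+ 2 / 2))%:E)%E.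
Proof.
have := @cameron_martin a (fun=> 1%E) (measurable_cst _) (fun=> lee01).
rewrite integral_normal1 => H.
have mexp (b : R) : measurable_fun setT (fun t : R => expR (a * t - b)).
  apply: measurableT_comp => //.
  by apply: measurable_funB => //; exact: measurable_funM.
transitivity (\int[N]_t ((expR (a ^+ 2 / 2))%:E * (1 * (expR (a * t - a ^+ 2 / 2))%:E)))%E.
  by apply: eq_integral => x _; rewrite mul1e -EFinM -expRD; congr (expR _)%:E; ring.
rewrite ge0_integralZl//.
- by rewrite -H mule1.
- by under eq_fun do rewrite mul1e; apply/measurable_EFinP; exact: mexp.
Qed.

(* For [a^2 + b^2 = 1], [phi t * phi ((y - b t) / a) = phi y * phi ((t - b y) / a)]. *)
Lemma normal_rotation (a b : R) (f : R -> \bar R) : 0 < a -> a ^+ 2 + b ^+ 2 = 1 ->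
  measurable_fun setT f -> (forall x, 0 <= f x)%E ->
  (\int[N]_t \int[N]_s f (a * s + b * t)%R = \int[N]_t f t)%E.
Proof.
move=> a0 ab mf f0.
have a0' : a != 0 by rewrite gt_eqF.
have maff (c e : R) : measurable_fun setT (fun t : R => c * t + e) by exact: measurable_affine.
have mphi : measurable_fun setT (EFin \o phi) by apply/measurable_EFinP; exact: measurable_phi.
have step (t : R) : (\int[N]_s f (a * s + b * t)%R =
    \int[leb]_y (f y * (phi ((y - b * t) / a) / a)%:E))%E.
  rewrite ge0_integral_normal//; last first.
    by apply: measurableT_comp => //.
  rewrite [RHS](@ge0_integral_affine a (b * t))//; last 2 first.
  - apply: emeasurable_funM => //; apply/measurable_EFinP.
    apply: measurable_funM => //.
    apply: measurableT_comp; first exact: measurable_phi.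
    by apply: measurable_funM => //; exact: measurable_funB.
  - by move=> x; rewrite mule_ge0// lee_fin divr_ge0// ?phi_ge0// ltW.
  rewrite -ge0_integralZl//; last 3 first.
  - have : measurable_fun setT (fun x : R => (f (a * x + b * t)%R * (phi ((a * x + b * t - b * t) / a) / a)%:E)%E); last by [].
    apply: emeasurable_funM; first by apply: measurableT_comp mf _; exact: maff.
    apply/measurable_EFinP.
    apply: measurable_funM => //.
    apply: measurableT_comp; first exact: measurable_phi.
    by apply: measurable_funM => //; apply: measurable_funB => //; exact: maff.
  - by move=> x; rewrite mule_ge0// lee_fin divr_ge0// ?phi_ge0// ltW.
  - by rewrite lee_fin ltW.
  apply: eq_integral => x _; rewrite muleCA; congr (_ * _)%E.
  rewrite -EFinM; congr _%:E; rewrite addrK (mulrC a x) mulfK//.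
  by rewrite mulrC divfK.
have m2 : measurable_fun setT (fun z : R * R => (z.2 - b * z.1) / a).
  apply: measurable_funM => //; apply: measurable_funB => //.
  by apply: measurable_funM.
have m2' : measurable_fun setT (fun z : R * R => ((f z.2) * (phi ((z.2 - b * z.1) / a) / a)%:E)%E).
  apply: emeasurable_funM => //; first exact: measurableT_comp.
  apply/measurable_EFinP; apply: measurable_funM => //.
  by apply: measurableT_comp => //; exact: measurable_phi.
have g0 (t y : R) : (0 <= f y * (phi ((y - b * t) / a) / a)%:E)%E.
  by rewrite mule_ge0// lee_fin divr_ge0// ?phi_ge0// ltW.
under eq_integral do rewrite step.
have mF := @measurable_fun_fubini_tonelli_F _ _ _ _ _ leb _ m2' (fun z => g0 z.1 z.2).
rewrite [LHS]ge0_integral_normal//; last by move=> x; apply: integral_ge0.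
transitivity (\int[leb]_t \int[leb]_y (f y * (phi ((y - b * t) / a) / a)%:E * (phi t)%:E))%E.
  apply: eq_integral => t _; rewrite ge0_integralZr//.
  - exact: (measurableT_comp m2' (pair1_measurable t)).
  - by rewrite lee_fin phi_ge0.
rewrite (@fubini_tonelli _ _ _ _ _ leb leb (fun z : R * R => (f z.2 * (phi ((z.2 - b * z.1) / a) / a)%:E * (phi z.1)%:E))%E)//=; last 2 first.
- by apply: emeasurable_funM => //; apply: (measurableT_comp mphi).
- by move=> x; rewrite mule_ge0// lee_fin phi_ge0.
rewrite [RHS]ge0_integral_normal//.
apply: eq_integral => y _.
transitivity (\int[leb]_t ((f y * (phi y)%:E) * (phi ((t - b * y) / a) / a)%:E))%E.
  apply: eq_integral => t _; rewrite -!muleA -!EFinM; congr (_ * _%:E)%E.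
  rewrite !phiE [LHS](_ : _ = normal_peak 1 ^+ 2 / a * (expR (- (((y - b * t) / a) ^+ 2 / 2)) * expR (- (t ^+ 2 / 2)))); last by ring.
  rewrite [RHS](_ : _ = normal_peak 1 ^+ 2 / a * (expR (- (y ^+ 2 / 2)) * expR (- (((t - b * y) / a) ^+ 2 / 2)))); last by ring.
  rewrite -!expRD; congr (_ * expR _).
  have b2 : b ^+ 2 = 1 - a ^+ 2 by rewrite -ab; ring.
  rewrite !exprMn !exprVn !sqrrB !exprMn b2; field.
  by rewrite a0'.
have mh : measurable_fun setT (fun t : R => ((phi ((t - b * y) / a) / a)%:E)).
  apply/measurable_EFinP; apply: measurable_funM => //.
  apply: measurableT_comp; first exact: measurable_phi.
  by apply: measurable_funM => //; exact: measurable_funB.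
have h0 (t : R) : (0 <= (phi ((t - b * y) / a) / a)%:E)%E.
  by rewrite lee_fin divr_ge0 ?phi_ge0// ltW.
rewrite ge0_integralZl//; last by rewrite mule_ge0// lee_fin phi_ge0.
(* What is left in [t] is the total mass of the normal density with mean [b * y] and deviation
   [a]. *)
rewrite [X in (_ * X)%E](_ : _ = 1%E) ?mule1//.
rewrite (@ge0_integral_affine a (b * y))//.
rewrite -ge0_integralZl//; last 2 first.
- have : measurable_fun setT (fun x : R => (phi ((a * x + b * y - b * y) / a) / a)%:E); last by [].
  by apply: measurableT_comp mh _; exact: maff.
- by rewrite lee_fin ltW.
rewrite -[RHS](integral_normal_pdf 0 1); apply: eq_integral => x _.
rewrite -EFinM addrK (mulrC a x) mulfK//.
by rewrite mulrC divfK.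
Qed.
End gauss1.

(** Since [(n + i)! >= i!], the tail of the series from [n] on is at most [|x|^n] times the
    exponential series of [|x|]. *)
Lemma expR_taylor (R : realType) (x : R) (n : nat) :
  `|expR x - \sum_(j < n) x ^+ j / j`!%:R| <= `|x| ^+ n * expR `|x|.
Proof.
have cx := is_cvg_series_exp_coeff x.
have cu : (fun k => `|series (exp_coeff x) k - \sum_(j < n) x ^+ j / j`!%:R|) @ \oo -->
    `|expR x - \sum_(j < n) x ^+ j / j`!%:R|.
  by apply: cvg_norm; apply: cvgB; [exact: cx|exact: cvg_cst].
apply: (cvgr_to_le cu); exists n => // k /= nk.
rewrite -(subnKC nk); set p := (k - n)%N.
rewrite /series /= big_mkord big_split_ord /= addrAC subrr add0r.
apply: (le_trans (ler_norm_sum _ _ _)).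
apply: (@le_trans _ _ (\sum_(i < p) `|x| ^+ n * exp_coeff `|x| i)).
  apply: ler_sum => i _; rewrite /exp_coeff/= normrM normrX exprD.
  rewrite -mulrA ler_wpM2l ?exprn_ge0// ler_wpM2l ?exprn_ge0//.
  rewrite ger0_norm ?invr_ge0// lef_pV2 ?posrE ?ltr0n ?fact_gt0// ler_nat.
  by apply: leq_fact; exact: leq_addl.
rewrite -mulr_sumr ler_wpM2l ?exprn_ge0//.
have := @nondecreasing_cvgn_le _ (series (exp_coeff `|x|)) _ (is_cvg_series_exp_coeff `|x|) p.
rewrite /series /= big_mkord; apply.
by apply: nondecreasing_series => i _ _; exact: (exp_coeff_ge0 i (normr_ge0 x)).
Qed.

Lemma exp_coeff_le (R : realType) (x : R) (n : nat) : 0 <= x ->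
  x ^+ n <= n`!%:R * expR x.
Proof.
move=> x0.
have := @nondecreasing_cvgn_le _ (series (exp_coeff x)) _ (is_cvg_series_exp_coeff x) n.+1.
have nd : {homo series (exp_coeff x) : k m / (k <= m)%N >-> k <= m}.
  by apply: nondecreasing_series => i _ _; exact: (exp_coeff_ge0 i x0).
move=> /(_ nd) H; rewrite mulrC -ler_pdivrMr ?ltr0n ?fact_gt0//.
apply: le_trans H; rewrite /series/= big_nat_recr//= lerDr.
by apply: sumr_ge0 => i _; exact: (exp_coeff_ge0 i x0).
Qed.

(** * Real-valued integrals against a probability measure *)

Section integrable_misc.
Context d (T : measurableType d) (R : realType) (m : probability T R).
Implicit Types f g h : T -> R.
Local Notation intg f := (m.-integrable setT (EFin \o f)).

Lemma integrable_leR f g : measurable_fun setT f -> (forall x, `|f x| <= g x) ->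
  intg g -> intg f.
Proof.
move=> mf fg ig; apply: (le_integrable _ _ _ ig) => //.
  exact/measurable_EFinP.
by move=> x _; rewrite /= lee_fin (le_trans (fg x))// ler_norm.
Qed.

Lemma integrable_cstR (c : R) : intg (fun=> c).
Proof.
exact: finite_measure_integrable_cst.
Qed.

Lemma integrable_bnd f (B : R) : measurable_fun setT f -> (forall x, `|f x| <= B) ->
  intg f.
Proof. by move=> mf fB; apply: (integrable_leR mf fB); exact: integrable_cstR. Qed.

Lemma integrableDR f g : intg f -> intg g -> intg (fun x => f x + g x).
Proof. by move=> mf mg; exact: (integrableD measurableT mf mg). Qed.

Lemma integrableBR f g : intg f -> intg g -> intg (fun x => f x - g x).
Proof. by move=> mf mg; exact: (integrableB measurableT mf mg). Qed.

Lemma integrableZR (c : R) f : intg f -> intg (fun x => c * f x).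
Proof. by move=> mf; exact: (integrableZl measurableT c mf). Qed.

Lemma integrable_sumR (n : nat) (F : nat -> T -> R) :
  (forall i, intg (F i)) -> intg (fun x => \sum_(i < n) F i x).
Proof.
move=> iF; elim: n => [|n IH].
  by under eq_fun do rewrite big_ord0; exact: integrable_cstR.
by under eq_fun do rewrite big_ord_recr/=; exact: integrableDR.
Qed.

Lemma Rintegral_sumR (n : nat) (F : nat -> T -> R) :
  (forall i, intg (F i)) ->
  \int[m]_x (\sum_(i < n) F i x) = \sum_(i < n) \int[m]_x F i x.
Proof.
move=> iF; elim: n => [|n IH].
  by under eq_Rintegral do rewrite big_ord0; rewrite Rintegral_cst// mul0r big_ord0.
under eq_Rintegral do rewrite big_ord_recr/=.
by rewrite RintegralD// ?IH ?big_ord_recr//; exact: integrable_sumR.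
Qed.

Lemma Rintegral_cstR (c : R) : \int[m]_x c = c.
Proof. by rewrite Rintegral_cst//= probability_setT/= mulr1. Qed.

Lemma RintegralE f : intg f -> (\int[m]_x (f x)%:E)%E = (\int[m]_x f x)%:E.
Proof. by move=> i; rewrite /Rintegral fineK//; exact: integrable_fin_num. Qed.

Lemma RintegralZ (c : R) f : intg f -> \int[m]_x (c * f x) = c * \int[m]_x f x.
Proof. by move=> i; rewrite RintegralZl. Qed.

Lemma RintegralBR f g : intg f -> intg g ->
  \int[m]_x (f x - g x) = \int[m]_x f x - \int[m]_x g x.
Proof. by move=> i j; rewrite RintegralB. Qed.

Lemma Rintegral_le f g : intg f -> intg g -> (forall x, f x <= g x) ->
  \int[m]_x f x <= \int[m]_x g x.
Proof. by move=> i j fg; apply: le_Rintegral. Qed.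

Lemma Rintegral_leD f g (K : R) : intg f -> intg g -> (forall x, f x <= g x + K) ->
  \int[m]_x f x <= \int[m]_x g x + K.
Proof.
move=> i j fg; rewrite -[X in _ <= _ + X]Rintegral_cstR -RintegralD//; last exact: integrable_cstR.
by apply: Rintegral_le => //; apply: integrableDR => //; exact: integrable_cstR.
Qed.

Lemma Rintegral_near f g (K : R) : intg f -> intg g ->
  (forall x, `|f x - g x| <= K) -> `|\int[m]_x f x - \int[m]_x g x| <= K.
Proof.
move=> i j fg; rewrite ler_distlC; apply/andP; split.
  rewrite lerBlDr; apply: Rintegral_leD => // x.
  by have := fg x; rewrite ler_distlC => /andP[]; lra.
apply: Rintegral_leD => // x.
by have := fg x; rewrite ler_distlC => /andP[]; lra.
Qed.

Lemma integrable_01 h : measurable_fun setT h -> (forall x, 0 <= h x <= 1) -> intg h.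
Proof.
move=> mh h01; apply: (@integrable_bnd _ 1) => // x.
by have /andP[? ?] := h01 x; rewrite ger0_norm.
Qed.

Lemma Rintegral_01 h : measurable_fun setT h -> (forall x, 0 <= h x <= 1) ->
  0 <= \int[m]_x h x <= 1.
Proof.
move=> mh h01; apply/andP; split.
  by apply: Rintegral_ge0 => x _; have /andP[] := h01 x.
rewrite -[leRHS]Rintegral_cstR; apply: Rintegral_le.
- exact: integrable_01.
- exact: integrable_cstR.
- by move=> x; have /andP[] := h01 x.
Qed.

End integrable_misc.

(** * Moments of the standard normal law *)

Section moments.
Context {R : realType}.
Local Notation N := (@normal_prob R 0 1).
Local Notation intg f := (N.-integrable setT (EFin \o f)).

Lemma integrable_expR_normal (a : R) : intg (fun t => expR (a * t)).
Proof.
apply/integrableP; split.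
  apply/measurable_EFinP; apply: measurableT_comp => //; exact: measurable_funM.
under eq_integral do rewrite /= ger0_norm ?expR_ge0//.
by rewrite mgf_normal ltry.
Qed.

Lemma Rmgf_normal (a : R) : \int[N]_t expR (a * t) = expR (a ^+ 2 / 2).
Proof. by rewrite /Rintegral mgf_normal. Qed.

Lemma expR_abs_le (a x : R) : 0 <= a -> expR (a * `|x|) <= expR (a * x) + expR (- a * x).
Proof.
move=> a0; have [x0|x0] := leP 0 x.
  by rewrite ger0_norm// lerDl expR_ge0.
by rewrite ltr0_norm// mulNr -mulrN lerDr expR_ge0.
Qed.

Lemma integrable_expRabs_normal (a : R) : 0 <= a -> intg (fun t => expR (a * `|t|)).
Proof.
move=> a0.
apply: (@integrable_leR _ _ _ N _ (fun t => expR (a * t) + expR (- a * t))).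
- apply: measurableT_comp => //; apply: measurable_funM => //; exact: measurableT_comp.
- by move=> x; rewrite ger0_norm ?expR_ge0//; exact: expR_abs_le.
- by apply: integrableDR; exact: integrable_expR_normal.
Qed.

Lemma integrable_absX_expR_normal (n : nat) (a : R) : 0 <= a ->
  intg (fun t => `|t| ^+ n * expR (a * `|t|)).
Proof.
move=> a0.
apply: (@integrable_leR _ _ _ N _ (fun t => n`!%:R * expR ((1 + a) * `|t|))).
- have : measurable_fun setT (fun t : R => `|t| ^+ n * expR (a * `|t|)); last by [].
  apply: measurable_funM; first exact: measurable_funX.
  by apply: measurableT_comp => //; apply: measurable_funM.
- move=> x; rewrite ger0_norm ?mulr_ge0 ?exprn_ge0 ?expR_ge0//.
  rewrite mulrDl mul1r expRD mulrA ler_wpM2r ?expR_ge0//.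
  exact: exp_coeff_le.
- by apply: integrableZR; apply: integrable_expRabs_normal; rewrite addr_ge0.
Qed.

Lemma integrable_absX_normal (n : nat) : intg (fun t => `|t| ^+ n).
Proof.
have := @integrable_absX_expR_normal n 0 (lexx 0).
by under eq_fun do rewrite mul0r expR0 mulr1.
Qed.

Lemma integrableX_normal (n : nat) : intg (fun t => t ^+ n).
Proof.
apply: (@integrable_leR _ _ _ N _ (fun t => `|t| ^+ n)).
- exact: measurable_funX.
- by move=> x; rewrite normrX.
- exact: integrable_absX_normal.
Qed.

(** Letting [x] tend to 0 kills the constant coefficient; dividing by [x] then gives the same
    situation in one degree less. *)
Lemma small_poly4 (c : R ^nat) (K : R) : (forall x : R, 0 < x <= 1 ->
  `|c 0%N + c 1%N * x + c 2%N * x ^+ 2 + c 3%N * x ^+ 3 + c 4%N * x ^+ 4| <= K * x ^+ 5) ->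
  forall i, (i < 5)%N -> c i = 0.
Proof.
have base (b : R) (L : R) : 0 <= L -> (forall x : R, 0 < x <= 1 -> `|b| <= L * x) -> b = 0.
  move=> L0 H; apply/eqP/negPn/negP => b0.
  have bp : 0 < `|b| by rewrite normr_gt0.
  have q : 0 < 2 * L + `|b| by lra.
  (* This [x] lies in []0, 1]] and satisfies [L * x < |b|]. *)
  have := H (`|b| / (2 * L + `|b|)).
  rewrite divr_gt0// ler_pdivrMr// mul1r lerDr mulr_ge0//= => /(_ isT).
  rewrite mulrA ler_pdivlMr//; nra.
have red (n : nat) (b : R ^nat) (L : R) : 0 <= L ->
   (forall x : R, 0 < x <= 1 -> `|\sum_(i < n.+1) b i * x ^+ i| <= L * x ^+ n.+1) ->
   b 0%N = 0 /\ forall x : R, 0 < x <= 1 -> `|\sum_(i < n) b i.+1 * x ^+ i| <= L * x ^+ n.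
  move=> L0 H.
  have b0 : b 0%N = 0.
    apply: (@base _ (L + \sum_(i < n) `|b i.+1|)); first by rewrite addr_ge0// sumr_ge0.
    move=> x /[dup] x01 /andP[x0 x1]; have := H x x01.
    rewrite big_ord_recl expr0 mulr1 => Hx.
    have : `|\sum_(i < n) b (bump 0 i) * x ^+ bump 0 i| <= (\sum_(i < n) `|b i.+1|) * x.
      apply: (le_trans (ler_norm_sum _ _ _)); rewrite mulr_suml; apply: ler_sum => i _.
      rewrite /bump/= add1n normrM ler_wpM2l// normrX ger0_norm ?(ltW x0)//.
      by rewrite exprS ger_pMr// exprn_ile1// ltW.
    have : L * x ^+ n.+1 <= L * x.
      by rewrite ler_wpM2l// exprS ger_pMr// exprn_ile1// ltW.
    move: Hx; set S := \sum_(i < n) _; set B := (\sum_(i < n) _) => Hx h1 h2.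
    have -> : b 0%N = (b 0%N + S) - S by ring.
    apply: (le_trans (ler_normB _ _)); rewrite mulrDl; lra.
  split=> // x /[dup] x01 /andP[x0 x1]; have := H x x01.
  rewrite big_ord_recl b0 mul0r add0r.
  under eq_bigr do rewrite exprS mulrCA.
  rewrite -mulr_sumr normrM gtr0_norm// exprS mulrCA ler_pM2l//.
move=> H.
have K0 : 0 <= K.
  have := le_trans (normr_ge0 _) (H 1 _).
  by rewrite ltr01 lexx !expr1n !mulr1; apply.
have H5 (x : R) : 0 < x <= 1 -> `|\sum_(i < 5) c i * x ^+ i| <= K * x ^+ 5.
  by move=> /H; rewrite !big_ord_recl big_ord0/= /bump/= !add1n expr0 expr1 mulr1 addr0 !addrA.
have [c0 H4] := red _ _ _ K0 H5.
have [c1 H3] := red _ (fun i => c i.+1) _ K0 H4.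
have [c2 H2] := red _ (fun i => c i.+2) _ K0 H3.
have [c3 H1] := red _ (fun i => c i.+3) _ K0 H2.
have [c4 _] := red _ (fun i => c i.+4) _ K0 H1.
by move=> [|[|[|[|[|]]]]].
Qed.

(* Compare the expansions of [E exp (x t)] and [exp (x^2 / 2)] at [x = 0]. *)
Lemma normal_moments : [/\ \int[N]_t t = 0, \int[N]_t (t ^+ 2) = 1,
  \int[N]_t (t ^+ 3) = 0 & \int[N]_t (t ^+ 4) = 3].
Proof.
pose M i := \int[N]_t (t ^+ i).
pose K := \int[N]_t (`|t| ^+ 5 * expR (1 * `|t|)).
have K0 : 0 <= K by apply: Rintegral_ge0 => x _; rewrite mulr_ge0 ?exprn_ge0 ?expR_ge0.
have M0 : M 0%N = 1.
  by rewrite /M; under eq_Rintegral do rewrite expr0; rewrite Rintegral_cstR.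
have E1 (x : R) : 0 < x <= 1 -> `|expR (x ^+ 2 / 2) - \sum_(j < 5) (M j / j`!%:R) * x ^+ j| <= K * x ^+ 5.
  move=> /andP[x0 x1].
  have i1 := integrable_expR_normal x.
  have i2 (j : nat) : intg (fun t => (x * t) ^+ j / j`!%:R).
    under eq_fun do rewrite exprMn mulrAC; apply: integrableZR; exact: integrableX_normal.
  have i3 := integrable_sumR 5 i2.
  have -> : \sum_(j < 5) M j / j`!%:R * x ^+ j = \int[N]_t (\sum_(j < 5) (x * t) ^+ j / j`!%:R).
    rewrite (Rintegral_sumR 5 i2); apply: eq_bigr => j _.
    under eq_Rintegral do rewrite exprMn mulrAC.
    rewrite (RintegralZ (x ^+ j / j`!%:R) (integrableX_normal j)).
    by rewrite [LHS]mulrC mulrA mulrAC.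
  rewrite -Rmgf_normal -RintegralBR//.
  apply: (le_trans (le_normr_Rintegral _ _)) => //; first exact: integrableBR.
  rewrite mulrC -RintegralZ; last exact: integrable_absX_expR_normal.
  apply: Rintegral_le.
  - apply/(integrable_norm)/integrableBR => //.
  - by apply: integrableZR; exact: integrable_absX_expR_normal.
  - move=> t; apply: (le_trans (expR_taylor _ _)).
    rewrite normrM exprMn gtr0_norm// -mulrA ler_wpM2l ?exprn_ge0 ?(ltW x0)//.
    by rewrite ler_wpM2l ?exprn_ge0// ler_expR ler_wpM2r.
have E2 (x : R) : 0 < x <= 1 -> `|expR (x ^+ 2 / 2) - (1 + x ^+ 2 / 2 + x ^+ 4 / 8)| <= expR 1 * x ^+ 5.
  move=> /andP[x0 x1]; have := expR_taylor (x ^+ 2 / 2) 3.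
  rewrite !big_ord_recl big_ord0/= /bump/= !add1n expr0 expr1 addr0 !factS fact0 !muln1.
  have x2 : 0 <= x ^+ 2 / 2 <= 1 by nra.
  rewrite (ger0_norm (proj1 (andP x2))).
  have -> : 1 / 1%:R + (x ^+ 2 / 2 / 1%:R + (x ^+ 2 / 2) ^+ 2 / 2%:R) = 1 + x ^+ 2 / 2 + x ^+ 4 / 8 by field.
  case/andP: x2 => x2 x2'; move/le_trans; apply; rewrite mulrC.
  apply: ler_pM; rewrite ?expR_ge0 ?ler_expR// ?exprn_ge0//.
  have -> : (x ^+ 2 / 2) ^+ 3 = x ^+ 5 * (x / 8) by field.
  by rewrite ger_pMr ?exprn_gt0//; lra.
(* Difference of the Taylor coefficients of [E exp (x t)] and [exp (x^2 / 2)]; the entry [1 / 8]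
   makes the fourth moment [24 / 8 = 3]. *)
pose c (i : nat) : R := M i / i`!%:R - [:: 1; 0; 1 / 2; 0; 1 / 8]`_i.
have := @small_poly4 c (K + expR 1).
have H (x : R) : 0 < x <= 1 -> `|c 0%N + c 1%N * x + c 2%N * x ^+ 2 + c 3%N * x ^+ 3 + c 4%N * x ^+ 4| <=
    (K + expR 1) * x ^+ 5.
  move=> x01; have := E1 x x01; have := E2 x x01.
  rewrite !big_ord_recl big_ord0/= /bump/= !add1n M0 expr0 expr1 addr0 !factS fact0 !muln1 => e2 e1.
  move: e1 e2; set e := expR (x ^+ 2 / 2); set p := _ + _; set q := _ + x ^+ 4 / 8 => e1 e2.
  have -> : c 0%N + c 1%N * x + c 2%N * x ^+ 2 + c 3%N * x ^+ 3 + c 4%N * x ^+ 4 = (e - q) - p.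
    by rewrite /c/= M0 !factS fact0 !muln1 /p /q; field.
  by apply: (le_trans (ler_normB _ _)); rewrite mulrDl; lra.
move=> /(_ H) cz.
have := cz 1%N isT; have := cz 2%N isT; have := cz 3%N isT; have := cz 4%N isT.
rewrite /c/= !factS fact0 !muln1 divr1 !subr0 => c4 c3 c2 c1.
change ([/\ M 1%N = 0, M 2%N = 1, M 3%N = 0 & M 4%N = 3]).
move: c4 c3 c2 c1; rewrite !natrM => c4 c3 c2 c1.
by split; lra.
Qed.

End moments.

(** * The standard normal distribution function *)

Section Phi_theory.
Context {R : realType}.
Local Notation N := (@normal_prob R 0 1).
Local Notation leb := (@lebesgue_measure R).
Local Notation phi := (@normal_pdf R 0 1).
Local Notation Phi := (@Phi R).

Lemma PhiE (x : R) : (Phi x)%:E = N `]-oo, x].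
Proof. by rewrite /Phi fineK// fin_num_measure. Qed.

Lemma Phi_ge0 (x : R) : 0 <= Phi x.
Proof. by rewrite -lee_fin PhiE. Qed.

Lemma Phi_nd (x y : R) : x <= y -> Phi x <= Phi y.
Proof.
move=> xy; rewrite -lee_fin !PhiE le_measure ?inE//.
by move=> z; rewrite /= !in_itv/= => /le_trans; apply.
Qed.

Lemma PhiB (x y : R) : x <= y -> (Phi y - Phi x)%:E = N `]x, y].
Proof.
move=> xy; apply/eqP; rewrite EFinB sube_eq//; last by rewrite fin_num_adde_defl.
rewrite !PhiE -measureU//; first last.
- apply/seteqP; split => // z []; rewrite /= !in_itv/= => /andP[h _]; rewrite leNgt h//.
- apply/eqP; congr (N _); apply/seteqP; split => z; rewrite /= !in_itv/=.
    by case: (ltP x z) => h zy; [left|right].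
  by move=> [/andP[_]//|/le_trans]; apply.
Qed.

Lemma normal_peak1_le1 : normal_peak (1 : R) <= 1.
Proof.
have h : 1 <= 1 ^+ 2 * pi *+ 2 :> R.
  by rewrite expr1n mul1r mulr2n; have := @pi_ge2 R; lra.
rewrite /normal_peak invf_le1 ?sqrtr_gt0; last by rewrite (lt_le_trans ltr01).
by rewrite -[leLHS]sqrtr1 ler_wsqrtr.
Qed.

(** The density is at most [normal_peak 1 = 1 / sqrt (2 pi) <= 1]. *)
Lemma Phi_lipschitz (x y : R) : x <= y -> Phi y - Phi x <= y - x.
Proof.
move=> xy; rewrite -lee_fin PhiB// /normal_prob.
apply: (@le_trans _ _ (\int[leb]_(t in `]x, y]) (cst 1%E t))%E).
  apply: ge0_le_integral => //=.
  - by move=> t _; rewrite lee_fin normal_pdf_ge0.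
  - by apply/measurable_EFinP/measurable_funTS; exact: measurable_normal_pdf.
  - move=> t _; rewrite lee_fin (le_trans (normal_pdf_ub _ _ _))//.
    exact: normal_peak1_le1.
rewrite integral_cst//= mul1e lebesgue_measure_itv/= lte_fin.
by case: ifP => //; rewrite lee_fin subr_ge0.
Qed.

Lemma Phi_dist (x y : R) : `|Phi x - Phi y| <= `|x - y|.
Proof.
wlog xy : x y / x <= y => [H|].
  have [/H//|/ltW/H] := leP x y; by rewrite distrC (distrC y).
rewrite distrC (distrC x) ger0_norm ?subr_ge0 ?Phi_nd// ger0_norm ?subr_ge0//.
exact: Phi_lipschitz.
Qed.

Lemma Phi_continuous : continuous Phi.
Proof.
move=> x; apply/(@cvgrPdist_le _ R^o) => e e0.
apply/nbhs_ballP; exists e => //= y xy.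
exact: le_trans (Phi_dist _ _) (ltW xy).
Qed.

(** On []x, y]] the density is at least its value at the larger of [|x|] and [|y|]. Strictness is
    what lets a slightly raised threshold restore an exact level in [level_bounds]. *)
Lemma Phi_lt (x y : R) : x < y -> Phi x < Phi y.
Proof.
move=> xy; rewrite -subr_gt0 -lte_fin PhiB ?ltW//.
pose M := Num.max `|x| `|y|.
pose c := normal_peak 1 * expR (- (M ^+ 2 / 2)) : R.
have c0 : 0 < c by rewrite mulr_gt0 ?expR_gt0// normal_peak_gt0// oner_eq0.
apply: (@lt_le_trans _ _ (\int[leb]_(t in `]x, y]) (cst c%:E t))%E).
  rewrite integral_cst//= lebesgue_measure_itv/= lte_fin xy -EFinD -EFinM lte_fin.
  by rewrite mulr_gt0// subr_gt0.
apply: ge0_le_integral => //=.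
- by move=> t _; rewrite lee_fin ltW.
- by apply/measurable_EFinP/measurable_funTS; exact: measurable_normal_pdf.
- move=> t; rewrite in_itv/= => /andP[xt ty]; rewrite lee_fin phiE /c.
  rewrite ler_wpM2l ?normal_peak_ge0// ler_expR lerN2 ler_pM2r//.
  rewrite -(real_normK (num_real t)) ler_pXn2r ?nnegrE//; last by rewrite le_max normr_ge0.
  rewrite ler_norml; apply/andP; split.
    have : `|x| <= M by rewrite le_max lexx.
    have := ler_norm (- x); rewrite normrN; lra.
  by rewrite le_max (le_trans ty (ler_norm y)) orbT.
Qed.

(** Chebyshev's inequality with second moment 1. *)
Lemma normal_tail (x : R) : 0 < x -> Phi (- x) <= x ^- 2.
Proof.
move=> x0; rewrite -lee_fin PhiE.
have -> : N `]-oo, - x] = (\int[N]_t (\1_(`]-oo, - x]%classic) t)%:E)%E.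
  by rewrite integral_indic// setIT.
have [_ m2 _ _] := @normal_moments R.
have i2 := @integrableX_normal R 2.
have <- : (\int[N]_t (x ^- 2 * t ^+ 2)%:E)%E = (x ^- 2)%:E.
  by rewrite RintegralE ?RintegralZ//; [rewrite m2 mulr1|exact: integrableZR].
apply: ge0_le_integral => //=.
- by apply/measurable_EFinP; exact: measurable_indic.
- by apply/measurable_EFinP/measurable_funM => //; exact: measurable_funX.
- move=> t _; rewrite lee_fin indicE; case: (boolP (t \in _)) => [|_]; last first.
    by rewrite mulr_ge0 ?sqr_ge0// invr_ge0 sqr_ge0.
  rewrite inE/= in_itv/= => tx; rewrite mulrC ler_pdivlMr ?exprn_gt0// mul1r.
  by rewrite -[leRHS]sqrrN ler_pXn2r ?nnegrE//; lra.
Qed.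

(** Supplies the cut-off beyond which a large signal-to-noise ratio makes the limiting error
    negligible; the witness works because [(1 + 1 / e)^-2 <= e]. *)
Lemma Phi_small (e : R) : 0 < e -> exists X : R, forall x, x <= - X -> Phi x <= e.
Proof.
move=> e0; exists (1 + e^-1) => x xX.
have e1 : 0 < 1 + e^-1 by rewrite addr_gt0// invr_gt0.
apply: (le_trans (Phi_nd xX)); apply: (le_trans (normal_tail e1)).
rewrite -[leRHS]invrK lef_pV2 ?posrE ?exprn_gt0 ?invr_gt0//.
have : 0 < e^-1 by rewrite invr_gt0.
nra.
Qed.

Lemma normal_probN (A : set R) : measurable A -> N (-%R @^-1` A) = N A.
Proof.
move=> mA.
have mN : measurable_fun setT (-%R : R -> R) by exact: measurable_funN.
have mA' : measurable (-%R @^-1` A) by rewrite -[X in measurable X]setTI; exact: mN.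
have mI (B : set R) : measurable B -> measurable_fun setT (fun t : R => (\1_B t)%:E : \bar R).
  by move=> mB; apply/measurable_EFinP; exact: measurable_indic.
have mf : measurable_fun setT (fun t : R => (\1_A t)%:E * (phi t)%:E)%E.
  by apply: emeasurable_funM; [exact: mI|apply/measurable_EFinP; exact: measurable_normal_pdf].
have E (B : set R) : measurable B -> N B = (\int[leb]_t ((\1_B t)%:E * (phi t)%:E))%E.
  move=> mB; rewrite -ge0_integral_normal//; first by rewrite integral_indic// setIT.
    exact: mI.
rewrite !E//; apply/esym.
have step := @ge0_integral_image _ _ _ _ R leb leb (-%R : measurableTypeR R -> measurableTypeR R) (fun t : R => (\1_A t)%:E * (phi t)%:E)%E.
rewrite (step mN _ mf _).
- by apply: eq_integral => t _; rewrite !indicE !phiE sqrrN.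
- by move=> B mB; exact: esym (lebesgue_measureN mB).
- by move=> t; rewrite mule_ge0// lee_fin normal_pdf_ge0.
Qed.

Lemma Phi_opp (x : R) : Phi (- x) = 1 - Phi x.
Proof.
apply/eqP; rewrite -eqe EFinB !PhiE; apply/eqP.
have -> : N `]-oo, - x] = N `[x, +oo[.
  rewrite -normal_probN//; congr (N _); apply/seteqP; split => t; rewrite /= !in_itv/= andbT.
    by rewrite lerN2.
  by rewrite lerN2.
have -> : N `[x, +oo[ = N `]x, +oo[.
  rewrite -(@setU1itv _ _ +oo%O x false) ?bnd_simp// measureU//; last first.
    by apply/seteqP; split => // z [->]; rewrite /= in_itv/= ltxx.
  rewrite [X in (X + _)%E](_ : _ = 0%E) ?add0e//.
  have /null_content_dominatesP h := @normal_prob_dominates R 0 1.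
  exact: (h [set x] _ (lebesgue_measure_set1 x)).
by rewrite -setCitvl -probability_setC.
Qed.

Lemma Phi_quantile (p : R) : 0 < p < 1 -> exists H : R, Phi H = p.
Proof.
move=> /andP[p0 p1].
have [X hX] := Phi_small p0.
have [Y hY] : exists Y : R, forall x, x <= - Y -> Phi x <= 1 - p by apply: Phi_small; lra.
pose a := Num.min (- X) Y.
have ha : Phi a <= p by apply: hX; rewrite ge_min lexx.
have hb : p <= Phi Y by have := hY (- Y) (lexx _); rewrite Phi_opp; lra.
have ab : a <= Y by rewrite ge_min lexx orbT.
have [| |c _ hc] := @IVT R Phi a Y p ab.
- by apply: continuous_subspaceT => z; exact: Phi_continuous.
- by rewrite minEle maxEle (le_trans ha hb) ha hb.
by exists c.
Qed.
End Phi_theory.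

(** * The law of the noise sequence *)

Definition upd (R : realType) (y : nat -> R) (k : nat) (t : R) : nat -> R :=
  fun j => if j == k then t else y j.

Section seq_space.
Context {R : realType}.
Local Notation T := (g_sigma_algebraType (@cylinders R)).
Local Notation N := (@normal_prob R 0 1).

Lemma measurable_coord (k : nat) : measurable_fun setT (fun y : T => (y : nat -> R) k).
Proof.
move=> _ A mA; rewrite setTI; apply: sub_sigma_algebra.
by exists k, A.
Qed.

Lemma measurable_to_seq d (X : measurableType d) (f : X -> T) :
  (forall k, measurable_fun setT (fun x => (f x : nat -> R) k)) -> measurable_fun setT f.
Proof.
move=> mf; apply: (@measurability _ _ X T setT f (@cylinders R)) => //.
move=> _ [_ [k [A [mA ->]]] <-]; exact: mf.
Qed.

Lemma measurable_upd (k : nat) :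
  measurable_fun setT (fun z : R * T => upd z.2 k z.1 : T).
Proof.
apply: measurable_to_seq => j; rewrite /upd; case: eqP => _.
  exact: measurable_fst.
exact: (measurableT_comp (measurable_coord j) measurable_snd).
Qed.

Definition rect (n : nat) (A : nat -> set R) : set T :=
  [set y | forall j, (j < n)%N -> A j ((y : nat -> R) j)].

Definition rects : set (set T) :=
  [set C | exists n A, (forall k, measurable (A k)) /\ C = rect n A].

Lemma measurable_rect n (A : nat -> set R) : (forall k, measurable (A k)) ->
  measurable (rect n A).
Proof.
move=> mA.
have -> : rect n A = \bigcap_(j in `I_n) [set y : T | A j ((y : nat -> R) j)].
  by apply/seteqP; split => y h j; exact: h.
apply: fin_bigcap_measurable => [|j _]; first exact: finite_II.
by have := measurable_coord j measurableT (mA j); rewrite setTI.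
Qed.

Lemma rects_gen : @measurable _ T = <<s rects >>.
Proof.
apply/seteqP; split.
  apply: smallest_sub; first exact: smallest_sigma_algebra.
  move=> _ [k [A [mA ->]]]; apply: sub_sigma_algebra.
  exists k.+1, (fun j => if j == k then A else setT); split.
    by move=> j; case: ifP.
  apply/seteqP; split => y /=; last by move/(_ k); rewrite eqxx; apply.
  by move=> h j jk; case: eqP => // ->.
apply: smallest_sub; first exact: sigma_algebra_measurable.
by move=> _ [n [A [mA ->]]]; exact: measurable_rect.
Qed.

Lemma rects_setI : setI_closed rects.
Proof.
move=> _ _ [n [A [mA ->]]] [m [B [mB ->]]].
exists (maxn n m), (fun j => (if (j < n)%N then A j else setT) `&` (if (j < m)%N then B j else setT)).
split; first by move=> j; apply: measurableI; case: ifP.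
apply/seteqP; split => y /=.
  move=> [hA hB] j _; split; case: ifP => // h; [exact: hA|exact: hB].
move=> h; split => j jn.
  by have [] := h j (leq_trans jn (leq_maxl _ _)); rewrite jn.
by have [_] := h j (leq_trans jn (leq_maxr _ _)); rewrite jn.
Qed.

Variable mu : probability T R.
Hypothesis mu_rect : forall n A, (forall k, measurable (A k)) ->
  mu (rect n A) = (\prod_(j < n) N (A j))%E.

(** Both measures agree on rectangles, which are stable under intersection and generate the product
    sigma-algebra. *)
Lemma resample (k : nat) (F : T -> \bar R) : measurable_fun setT F ->
  (forall y, 0 <= F y)%E ->
  (\int[mu]_y F y = \int[mu]_y \int[N]_t F (upd y k t : T))%E.
Proof.
move=> mF F0.
have mu' : measurable_fun setT (fun z : R * T => upd z.2 k z.1 : T) := @measurable_upd k.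
rewrite -(@fubini_tonelli2 _ _ _ _ _ N mu (fun z => F (upd z.2 k z.1 : T)))//; last first.
  exact: (measurableT_comp mF mu').
apply: ge0_integral_image => // C mC.
pose m2 := measure_function_pushforward__canonical__measure_function_Measure (N \x mu)%E mu'.
apply: (@measure_unique _ R T rects (fun=> setT) rects_gen rects_setI _ _ mu m2) => //.
- by move=> _; exists 0%N, (fun=> setT); split => //; apply/seteqP; split.
- by rewrite bigcup_const.
- move=> _ [n [A [mA ->]]]; transitivity (\prod_(j < n) N (A j))%E.
    exact: mu_rect.
  rewrite /m2/= /pushforward.
  (* The constraint on coordinate [k] passes to the fresh value as [B], which is the whole line when
     [k >= n]; the other coordinates keep their constraints in [A']. *)
  pose A' j := if j == k then setT else A j.
  have mA' j : measurable (A' j) by rewrite /A'; case: ifP.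
  pose B := if (k < n)%N then A k else setT.
  have mB : measurable B by rewrite /B; case: ifP.
  rewrite (_ : _ @^-1` _ = B `*` rect n A'); last first.
    apply/seteqP; split => -[t y] /=.
      move=> h; split.
        by rewrite /B; case: ifP => // kn; have := h k kn; rewrite /upd eqxx.
      by move=> j jn; rewrite /A'; case: ifP => // jk; have := h j jn; rewrite /upd jk.
    move=> [hB hr] j jn; rewrite /upd; case: ifP => [/eqP jk|jk].
      by move: hB; rewrite /B -jk jn.
    by have := hr j jn; rewrite /A' jk.
  rewrite product_measure1E//; last exact: measurable_rect.
  transitivity (N B * \prod_(j < n) N (A' j))%E; last first.
    by congr (_ * _)%E; exact/esym/mu_rect.
  have NT : N setT = 1%E by exact: probability_setT.
  rewrite /B /A'.
  case: (ltnP k n) => kn.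
    rewrite (bigD1 (Ordinal kn))//= [in RHS](bigD1 (Ordinal kn))//= eqxx.
    rewrite NT mul1e; congr (_ * _)%E; apply: eq_bigr => i.
    by rewrite -val_eqE/= => /negbTE ->.
  rewrite NT mul1e; apply: eq_bigr => i _.
  by rewrite ltn_eqF// (leq_trans (ltn_ord i)).
- have muT : (mu setT < +oo)%E by rewrite probability_setT ltry.
  by move=> _.
Qed.

End seq_space.

Section iid_law.
Context {R : realType} (d : measure_display) (Omega : measurableType d)
  (P : probability Omega R) (xi : nat -> {RV P >-> R}).
Local Notation T := (g_sigma_algebraType (@cylinders R)).
Local Notation N := (@normal_prob R 0 1).

(** Independence and normality are used in this single form: a coordinate may be replaced by a fresh
    normal value. It suits inductions that peel off one coordinate at a time. *)
Definition standard_gaussian (mu : probability T R) : Prop :=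
  forall k (F : T -> \bar R), measurable_fun setT F -> (forall y, 0 <= F y)%E ->
  (\int[mu]_y F y = \int[mu]_y \int[N]_t F (upd y k t : T))%E.

(** Moves the problem to the space of sequences. Independence over the index lists [iota 0 n] gives
    the probabilities of rectangles, hence resampling. *)
Lemma iid_std_normal_law : iid_std_normal xi ->
  exists mu : probability T R, standard_gaussian mu /\
    forall F : T -> \bar R, measurable_fun setT F -> (forall y, 0 <= F y)%E ->
      (\int[mu]_y F y = \int[P]_w F (fun k => xi k w))%E.
Proof.
move=> [xiN xiI].
pose X w : T := fun k => xi k w.
have mX : measurable_fun setT X.
  by apply: measurable_to_seq => k; exact: measurable_funPT.
pose Xm : {mfun Omega >-> T} := mfun_Sub (mem_set mX).
exists (distribution P Xm); split; last first.
  by move=> F mF F0; rewrite ge0_integral_distribution.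
move=> k F; apply: resample => n A mA.
rewrite /distribution/= /pushforward /=.
have := xiI (iota 0 n) A (iota_uniq 0 n) mA.
rewrite -(big_mkord xpredT (fun j => N (A j)))/index_iota subn0.
rewrite [X in _ = X -> _ = _](_ : _ = (\prod_(j <- iota 0 n) N (A j))%E); last first.
  by apply: eq_bigr => j _; rewrite -(xiN j _ (mA j)).
move=> <-; congr (P _); apply/seteqP; split => w /=.
  by move=> h j /=; rewrite mem_iota/= add0n => /h.
by move=> h j jn; apply: h; rewrite /= mem_iota add0n.
Qed.

End iid_law.

(** * Central limit theorem for weighted chi-square sums *)

Section taylor.
Context {R : realType}.
Implicit Types f g : R -> R.

Lemma mvt_bound g g' (K h : R) : (forall x : R, is_derive x 1 g (g' x)) ->
  (forall x : R, `|x| <= `|h| -> `|g' x| <= K) -> g 0 = 0 -> `|g h| <= K * `|h|.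
Proof.
move=> dg gK g0.
have cg : continuous g.
  by move=> x; apply/differentiable_continuous/derivable1_diffP; have [] := dg x.
have [h0|h0] := leP 0 h.
  have [|c] := @MVT_segment _ g g' 0 h h0; first exact: continuous_subspaceT.
  rewrite in_itv/= => /andP[c0 ch]; rewrite g0 !subr0 => ->.
  by rewrite normrM ler_wpM2r// gK// !ger0_norm.
have [|c] := @MVT_segment _ g g' h 0 (ltW h0); first exact: continuous_subspaceT.
rewrite in_itv/= => /andP[c0 ch]; rewrite g0 !sub0r => /(congr1 Num.norm).
rewrite normrN => ->; rewrite normrM normrN ler_wpM2r// gK// !ler0_norm ?lerN2// ltW//.
Qed.

(** The mean value bound is applied in turn to the remainders of [f2], [f1] and [f], each time
    gaining a factor [|h|]; this gives [M] where integration would give [M / 6]. *)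
Lemma taylor3 f f1 f2 f3 (M : R) :
  (forall x : R, is_derive x 1 f (f1 x)) -> (forall x : R, is_derive x 1 f1 (f2 x)) ->
  (forall x : R, is_derive x 1 f2 (f3 x)) -> (forall x, `|f3 x| <= M) ->
  forall x h, `|f (x + h) - f x - f1 x * h - f2 x * (h ^+ 2 / 2)| <= M * `|h| ^+ 3.
Proof.
move=> d0 d1 d2 f3M x h.
have dsh (g g' : R -> R) (t : R) : (forall z : R, is_derive z 1 g (g' z)) ->
    is_derive t 1 (fun z => g (x + z)) (g' (x + t)).
  move=> dg; have := @is_derive1_comp _ g (fun z => x + z) t (g' (x + t)) 1 (dg _).
  rewrite mulr1; apply.
  rewrite -[X in is_derive _ _ _ X]add0r; apply: is_deriveD.
have e0 (t : R) := dsh f f1 t d0.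
have e1 (t : R) := dsh f1 f2 t d1.
have e2 (t : R) := dsh f2 f3 t d2.
have s2 (t : R) : `|f2 (x + t) - f2 x| <= M * `|t|.
  apply: (@mvt_bound (fun t => f2 (x + t) - f2 x) (fun t => f3 (x + t))) => //.
  - by move=> z; apply: is_derive_eq; rewrite oppr0 addr0.
  - by rewrite addr0 subrr.
have M0 : 0 <= M by exact: le_trans (f3M 0).
have s1 (t : R) : `|f1 (x + t) - f1 x - f2 x * t| <= (M * `|t|) * `|t|.
  apply: (@mvt_bound (fun t => f1 (x + t) - f1 x - f2 x * t) (fun t => f2 (x + t) - f2 x)).
  - move=> z; apply: is_derive_eq.
    by rewrite /GRing.scale/=; ring.
  - by move=> z zt; apply: (le_trans (s2 z)); rewrite ler_wpM2l.
  - by rewrite addr0 subrr mulr0 subr0.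
have := @mvt_bound (fun t => f (x + t) - f x - f1 x * t - f2 x * (t ^+ 2 / 2))
   (fun t => f1 (x + t) - f1 x - f2 x * t) (M * `|h| * `|h|) h.
have -> : M * `|h| ^+ 3 = M * `|h| * `|h| * `|h| by ring.
apply.
- move=> z; apply: is_derive_eq.
  by rewrite /GRing.scale/=; field.
- move=> z zh; apply: (le_trans (s1 z)).
  by rewrite -!mulrA ler_wpM2l// -!expr2 ler_pXn2r// nnegrE.
- by rewrite addr0 subrr expr0n/= mulr0 mul0r mulr0 !subr0.
Qed.

(** The decreasing logistic function, a smooth step from 1 to 0 whose derivatives are polynomials in
    its own value. *)
Definition sigm (x : R) : R := (1 + expR x)^-1.

Lemma sigm_den (x : R) : 0 < 1 + expR x.
Proof. by rewrite addr_gt0// expR_gt0. Qed.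

Lemma sigm_gt0 x : 0 < sigm x.
Proof. by rewrite invr_gt0 sigm_den. Qed.

Lemma sigm_le1 x : sigm x <= 1.
Proof. by rewrite invf_le1 ?sigm_den// lerDl expR_ge0. Qed.

Lemma sigm_le x : sigm x <= expR (- x).
Proof.
by rewrite expRN lef_pV2 ?posrE ?sigm_den ?expR_gt0// lerDr.
Qed.

Lemma sigm_ge x : 1 - expR x <= sigm x.
Proof.
have e := expR_gt0 x.
rewrite -[leRHS]mul1r ler_pdivlMr ?sigm_den//; nra.
Qed.

Lemma is_derive_sigm (x : R) : is_derive x 1 sigm (- (sigm x * (1 - sigm x))).
Proof.
have n0 : 1 + expR x != 0 by rewrite gt_eqF// sigm_den.
have : is_derive x 1 (fun z => 1 + expR z) (expR x).
  rewrite -[X in is_derive _ _ _ X]add0r; apply: is_deriveD; exact: is_derive_expR.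
move=> D; have := @is_deriveV R (fun z => 1 + expR z) x (expR x) 1 n0 D.
move=> /is_derive_eq; apply.
by rewrite /GRing.scale/= /sigm; field.
Qed.

Definition sm (a d z : R) : R := sigm ((z - a) / d).

(** From [sigm' = - sigm (1 - sigm)], the first three derivatives are polynomials in the value [s];
    as [s (1 - s)] lies between 0 and 1/4, the third is at most [d^-3]. *)
Lemma sm_taylor (a d : R) : 0 < d -> exists f1 f2 : R -> R,
  forall x h, `|sm a d (x + h) - sm a d x - f1 x * h - f2 x * (h ^+ 2 / 2)| <= d ^- 3 * `|h| ^+ 3.
Proof.
move=> d0.
pose s := sm a d; pose q := d^-1.
have q0 : 0 < q by rewrite invr_gt0.
pose f1 x := - q * (s x * (1 - s x)).
pose f2 x := q ^+ 2 * (s x * (1 - s x) * (1 - 2 * s x)).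
pose f3 x := q ^+ 3 * (2 * (s x * (1 - s x)) ^+ 2 - s x * (1 - s x) * (1 - 2 * s x) ^+ 2).
have ds (x : R) : is_derive x 1 s (f1 x).
  have := @is_derive1_comp _ sigm (fun z => (z - a) / d) x (- (s x * (1 - s x))) q (is_derive_sigm _).
  have -> : f1 x = - (s x * (1 - s x)) * q by rewrite /f1; ring.
  apply; apply: is_derive_eq.
  by rewrite scaler0 add0r subr0 /GRing.scale/= mulr1.
have dp (x : R) : is_derive x 1 (fun z => s z * (1 - s z)) (f1 x * (1 - 2 * s x)).
  by apply: is_derive_eq; rewrite /GRing.scale/=; ring.
have df1 (x : R) : is_derive x 1 f1 (f2 x).
  rewrite /f1; apply: is_derive_eq; rewrite /GRing.scale/= /f1 /f2; ring.
have df2 (x : R) : is_derive x 1 f2 (f3 x).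
  rewrite /f2; apply: is_derive_eq; rewrite /GRing.scale/= /f1 /f3; ring.
exists f1, f2; rewrite -exprVn -/q.
refine (@taylor3 s f1 f2 f3 _ ds df1 df2 _).
- move=> x; have q3 : 0 <= q ^+ 3 by rewrite exprn_ge0// ltW.
  rewrite /f3 normrM (ger0_norm q3) -[leRHS]mulr1 ler_wpM2l//.
  have s0 : 0 <= s x by apply/ltW/sigm_gt0.
  have s1 : s x <= 1 by exact: sigm_le1.
  move: (s x) s0 s1 => u u0 u1.
  have -> : (1 - 2 * u) ^+ 2 = 1 - 4 * (u * (1 - u)) by ring.
  have : 0 <= u * (1 - u) by rewrite mulr_ge0// subr_ge0.
  have : u * (1 - u) <= 1 / 4 by have := sqr_ge0 (1 - 2 * u); nra.
  move: (u * (1 - u)) => p p1 p0; rewrite ler_norml; nra.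
Qed.

Lemma measurable_sm (a d : R) : measurable_fun setT (sm a d).
Proof.
apply: continuous_measurable_fun => x.
apply: (@continuous_comp _ _ _ (fun z => (z - a) / d) sigm).
  apply: cvgM; last exact: cvg_cst.
  by apply: cvgB => //; exact: cvg_cst.
apply/differentiable_continuous/derivable1_diffP.
by have [] := is_derive_sigm ((x - a) / d).
Qed.

Lemma sm_ge0 a d z : 0 <= sm a d z. Proof. exact/ltW/sigm_gt0. Qed.
Lemma sm_le1 a d z : sm a d z <= 1. Proof. exact: sigm_le1. Qed.

Lemma expR_inv_le (k : R) : 0 < k -> expR (- k^-1) <= k.
Proof.
move=> k0; rewrite expRN -[leRHS]invrK lef_pV2 ?posrE ?invr_gt0 ?expR_gt0//.
by have := expR_ge1Dx k^-1; lra.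
Qed.

(** The shift [k] divided by the width [k^2] is [1 / k], so the smoothing error is
    [exp (- 1 / k) <= k]. The same choice serves in [sm_upper]. *)
Lemma sm_lower (k x z : R) : 0 < k -> (z <= x)%R%:R <= sm (x + k) (k ^+ 2) z + k.
Proof.
move=> k0; case: (leP z x) => zx /=; last by rewrite addr_ge0 ?sm_ge0// ltW.
rewrite -lerBlDr; apply: le_trans (sigm_ge _); rewrite lerB//.
apply: le_trans (expR_inv_le k0); rewrite ler_expR ler_pdivrMr ?exprn_gt0//.
by rewrite mulNr expr2 mulKf ?gt_eqF//; lra.
Qed.

Lemma sm_upper (k x z : R) : 0 < k -> sm (x - k) (k ^+ 2) z <= (z <= x)%R%:R + k.
Proof.
move=> k0; case: (leP z x) => zx /=.
  by rewrite (le_trans (sm_le1 _ _ _))// lerDl ltW.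
rewrite add0r; apply: (le_trans (sigm_le _)).
apply: le_trans (expR_inv_le k0); rewrite ler_expR lerN2 ler_pdivlMr ?exprn_gt0//.
by rewrite expr2 mulKf ?gt_eqF//; lra.
Qed.
End taylor.

(** * Variances and the Lindeberg swap *)

Section gauss_sums.
Context {R : realType}.
Local Notation T := (g_sigma_algebraType (@cylinders R)).
Local Notation N := (@normal_prob R 0 1).
Local Notation intgN f := (N.-integrable setT (EFin \o f)).
Variable mu : probability T R.
Hypothesis mu_gauss : standard_gaussian mu.

Lemma measurable_coord_sum (n : nat) (g : nat -> R -> R) (s : nat -> nat) :
  (forall k, measurable_fun setT (g k)) ->
  measurable_fun setT (fun y : T => \sum_(j < n) g j (y (s j))).
Proof.
move=> mg; elim: n => [|n IH].
  rewrite (_ : (fun y : T => _) = cst 0) ?funeqE// => y.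
  by rewrite big_ord0.
rewrite (_ : (fun y : T => _) = fun y : T => \sum_(j < n) g j (y (s j)) + g n (y (s n))).
  apply: measurable_funD => //.
  exact: (measurableT_comp (mg n) (measurable_coord (s n))).
by apply/funext => y; rewrite big_ord_recr.
Qed.

Lemma upd_lt (n : nat) (y : nat -> R) (t : R) (j : nat) : (j < n)%N -> upd y n t j = y j.
Proof. by move=> jn; rewrite /upd ltn_eqF. Qed.

Lemma upd_eq (n : nat) (y : nat -> R) (t : R) : upd y n t n = t.
Proof. by rewrite /upd eqxx. Qed.

(** Resampling the last coordinate makes the cross term integrate to 0. *)
Lemma variance_sum (n : nat) (c : nat -> R) (g : R -> R) (v : R) :
  measurable_fun setT g -> intgN g -> intgN (fun t => g t ^+ 2) ->
  \int[N]_t g t = 0 -> \int[N]_t (g t ^+ 2) = v ->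
  (\int[mu]_y ((\sum_(j < n) c j * g (y j)) ^+ 2)%:E = (v * \sum_(j < n) c j ^+ 2)%:E)%E.
Proof.
move=> mg ig ig2 g0 g2.
have v0 : 0 <= v by rewrite -g2; apply: Rintegral_ge0 => t _; exact: sqr_ge0.
elim: n => [|n IH].
  under eq_integral do rewrite big_ord0 expr0n/=.
  by rewrite integral0 big_ord0 mulr0.
have mS m : measurable_fun setT (fun y : T => \sum_(j < m) c j * g (y j)).
  apply: (@measurable_coord_sum m (fun j t => c j * g t) id) => k.
  exact: measurable_funM.
have mS2 m : measurable_fun setT (fun y : T => ((\sum_(j < m) c j * g (y j)) ^+ 2)%:E).
  by apply/measurable_EFinP; apply: measurable_funX; exact: mS.
rewrite (mu_gauss n)//; last by move=> y; rewrite lee_fin sqr_ge0.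
transitivity (\int[mu]_y (((\sum_(j < n) c j * g (y j)) ^+ 2)%:E + (c n ^+ 2 * v)%:E))%E.
  apply: eq_integral => y _.
  pose S := \sum_(j < n) c j * g (y j).
  have i2 : intgN (fun t => 2 * S * c n * g t) by exact: integrableZR.
  have i3 : intgN (fun t => c n ^+ 2 * g t ^+ 2) by exact: integrableZR.
  have i1 : intgN (fun=> S ^+ 2) by exact: integrable_cstR.
  transitivity (\int[N]_t (S ^+ 2 + 2 * S * c n * g t + c n ^+ 2 * g t ^+ 2)%:E)%E.
    apply: eq_integral => t _; congr (_%:E).
    rewrite big_ord_recr/= upd_eq.
    under eq_bigr do rewrite upd_lt//.
    by rewrite -/S; ring.
  rewrite RintegralE; last by apply: integrableDR => //; exact: integrableDR.
  rewrite RintegralD//; last exact: integrableDR.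
  rewrite RintegralD// Rintegral_cstR !RintegralZ// g0 g2 mulr0 addr0.
  by rewrite EFinD.
rewrite ge0_integralD//; last 2 first.
- by move=> y _; rewrite lee_fin sqr_ge0.
- by move=> y _; rewrite lee_fin mulr_ge0// sqr_ge0.
rewrite IH (RintegralE (integrable_cstR mu _)) Rintegral_cstR -EFinD; congr (_%:E).
by rewrite big_ord_recr/= mulrDr (mulrC v (c n ^+ 2)).
Qed.

(* Replacing one summand, depending on a fresh coordinate, by its second-order expansion. *)
Lemma lindeberg_step (f f1 f2 : R -> R) (M m3 s : R) (zeta : R -> R) (c : R) :
  measurable_fun setT f -> (forall x, 0 <= f x <= 1) ->
  (forall x h, `|f (x + h) - f x - f1 x * h - f2 x * (h ^+ 2 / 2)| <= M * `|h| ^+ 3) ->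
  measurable_fun setT zeta ->
  intgN zeta -> intgN (fun t => zeta t ^+ 2) -> intgN (fun t => `|zeta t| ^+ 3) ->
  \int[N]_t zeta t = 0 -> \int[N]_t (zeta t ^+ 2) = s -> \int[N]_t (`|zeta t| ^+ 3) = m3 ->
  `|\int[N]_t f (c + zeta t) - (f c + f2 c * (s / 2))| <= M * m3.
Proof.
move=> mf f01 ft mz iz iz2 iz3 z0 z2 z3.
have mfz : measurable_fun setT (fun t => f (c + zeta t)).
  by apply: measurableT_comp => //; exact: measurable_funD.
have i0 : intgN (fun t => f (c + zeta t)).
  apply: (@integrable_bnd _ _ _ N _ 1) => // t; have /andP[? ?] := f01 (c + zeta t).
  by rewrite ger0_norm.
have i1 : intgN (fun=> f c) by exact: integrable_cstR.
have i2 : intgN (fun t => f1 c * zeta t) by exact: integrableZR.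
have i3 : intgN (fun t => f2 c / 2 * zeta t ^+ 2) by exact: integrableZR.
have i4 := integrableDR (integrableDR i1 i2) i3.
have -> : f c + f2 c * (s / 2) = \int[N]_t (f c + f1 c * zeta t + f2 c / 2 * zeta t ^+ 2).
  rewrite RintegralD//; last exact: integrableDR.
  rewrite RintegralD// Rintegral_cstR !RintegralZ// z0 z2 mulr0 addr0.
  by rewrite mulrAC mulrA.
rewrite -RintegralBR//; apply: (le_trans (le_normr_Rintegral _ _)) => //.
  exact: integrableBR.
rewrite -z3 -RintegralZ//; apply: Rintegral_le.
- by apply: integrable_norm; exact: integrableBR.
- exact: integrableZR.
move=> t; apply: le_trans (ft c (zeta t)).
by rewrite le_eqVlt; apply/orP; left; apply/eqP; congr (`|_|); ring.
Qed.

Lemma measurable_Rintegral_upd (k : nat) (h : T -> R) : measurable_fun setT h ->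
  (forall y, 0 <= h y <= 1) -> measurable_fun setT (fun y : T => \int[N]_t h (upd y k t : T)).
Proof.
move=> mh h01; rewrite /Rintegral; apply: measurableT_comp; first exact: fine_measurable.
have mF : measurable_fun setT (fun z : R * T => (h (upd z.2 k z.1 : T))%:E).
  by apply/measurable_EFinP; exact: (measurableT_comp mh (measurable_upd k)).
apply: (@measurable_fun_fubini_tonelli_G _ _ _ _ _ N _ mF).
by move=> z; rewrite lee_fin; have /andP[] := h01 (upd z.2 k z.1).
Qed.

Lemma Rresample (k : nat) (h : T -> R) : measurable_fun setT h ->
  (forall y, 0 <= h y <= 1) ->
  \int[mu]_y h y = \int[mu]_y \int[N]_t h (upd y k t : T).
Proof.
move=> mh h01; rewrite /Rintegral; congr fine.
rewrite (mu_gauss k)//; last 2 first.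
- exact/measurable_EFinP.
- by move=> y; rewrite lee_fin; have /andP[] := h01 y.
apply: eq_integral => y _; rewrite fineK//.
apply: integrable_fin_num => //.
apply: (@integrable_bnd _ _ _ N _ 1) => //.
  apply: (measurableT_comp mh).
  exact: (measurableT_comp (measurable_upd k) (pair2_measurable y)).
by move=> t; have /andP[? ?] := h01 (upd y k t); rewrite ger0_norm.
Qed.

(** [za] and [zb] have the same mean and variance, so both expectations share the expansion
    [f C + f2 C * (s / 2)]; only third-order terms remain. [C] ignores both coordinates, so each can
    be resampled with [C] fixed. *)
Lemma lindeberg_swap (f f1 f2 : R -> R) (M s a3 b3 : R) (za zb : R -> R)
   (C : T -> R) (k l : nat) :
  measurable_fun setT f -> (forall x, 0 <= f x <= 1) ->
  (forall x h, `|f (x + h) - f x - f1 x * h - f2 x * (h ^+ 2 / 2)| <= M * `|h| ^+ 3) ->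
  measurable_fun setT za ->
  intgN za -> intgN (fun t => za t ^+ 2) -> intgN (fun t => `|za t| ^+ 3) ->
  \int[N]_t za t = 0 -> \int[N]_t (za t ^+ 2) = s -> \int[N]_t (`|za t| ^+ 3) = a3 ->
  measurable_fun setT zb ->
  intgN zb -> intgN (fun t => zb t ^+ 2) -> intgN (fun t => `|zb t| ^+ 3) ->
  \int[N]_t zb t = 0 -> \int[N]_t (zb t ^+ 2) = s -> \int[N]_t (`|zb t| ^+ 3) = b3 ->
  measurable_fun setT C -> (forall y t, C (upd y k t : T) = C y) ->
  (forall y t, C (upd y l t : T) = C y) ->
  `|\int[mu]_y f (C y + za (y k)) - \int[mu]_y f (C y + zb (y l))| <= M * (a3 + b3).
Proof.
move=> mf f01 ft ma a1 a2 a3i a0 as2 a3E mb b1 b2 b3i b0 bs2 b3E mC Ck Cl.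
have mh (z : R -> R) j : measurable_fun setT z -> measurable_fun setT (fun y : T => f (C y + z (y j))).
  move=> mz; apply: (measurableT_comp mf); apply: measurable_funD => //.
  exact: (measurableT_comp mz (measurable_coord j)).
rewrite (Rresample k (mh _ _ ma)) ?(Rresample l (mh _ _ mb))//.
apply: Rintegral_near.
- apply: integrable_01; first exact: measurable_Rintegral_upd (mh _ _ ma) _.
  move=> y; apply: Rintegral_01 => //.
  exact: (measurableT_comp (mh _ _ ma) (measurableT_comp (measurable_upd k) (pair2_measurable y))).
- apply: integrable_01; first exact: measurable_Rintegral_upd (mh _ _ mb) _.
  move=> y; apply: Rintegral_01 => //.
  exact: (measurableT_comp (mh _ _ mb) (measurableT_comp (measurable_upd l) (pair2_measurable y))).
- move=> y.
  under eq_Rintegral do rewrite Ck upd_eq.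
  under [X in _ - X]eq_Rintegral do rewrite Cl upd_eq.
  have h1 := lindeberg_step (C y) mf f01 ft ma a1 a2 a3i a0 as2 a3E.
  have h2 := lindeberg_step (C y) mf f01 ft mb b1 b2 b3i b0 bs2 b3E.
  rewrite mulrDr; apply: (le_trans _ (lerD h1 h2)).
  rewrite [X in _ <= _ + X]distrC; apply: le_trans (ler_normD _ _).
  by rewrite le_eqVlt; apply/orP; left; apply/eqP; congr (`|_|); ring.
Qed.

End gauss_sums.

Section clt.
Context {R : realType}.
Local Notation T := (g_sigma_algebraType (@cylinders R)).
Local Notation N := (@normal_prob R 0 1).
Local Notation intgN f := (N.-integrable setT (EFin \o f)).

Lemma integral_prob_cst d (X : measurableType d) (m : probability X R) (c : \bar R) :
  (\int[m]_x c = c)%E.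
Proof.
by rewrite integral_cst//= -[RHS]mule1; congr (_ * _)%E; exact: probability_setT.
Qed.

Lemma gauss_sum (mu : probability T R) (mu_gauss : standard_gaussian mu)
    (a : nat -> R) (m n : nat) (F : R -> \bar R) :
  (forall j, 0 <= a j) -> measurable_fun setT F -> (forall x, 0 <= F x)%E ->
  (\int[mu]_y F (\sum_(j < n) a j * y (m + j)%N)%R =
   \int[N]_t F (Num.sqrt (\sum_(j < n) a j ^+ 2) * t)%R)%E.
Proof.
move=> a0; elim: n F => [|n IH] F mF F0.
  rewrite big_ord0 sqrtr0; under eq_integral do rewrite big_ord0.
  under [RHS]eq_integral do rewrite mul0r.
  by rewrite (integral_prob_cst mu) (integral_prob_cst N).
have mS k : measurable_fun setT (fun y : T => \sum_(j < k) a j * y (m + j)%N).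
  apply: (@measurable_coord_sum R k (fun j t => a j * t) (fun j => m + j)%N) => j.
  exact: measurable_funM.
rewrite (mu_gauss (m + n)%N (fun y => F (\sum_(j < n.+1) a j * y (m + j)%N)))//; last first.
  exact: (measurableT_comp mF (mS n.+1)).
pose F2 (x : R) : \bar R := (\int[N]_t F (x + a n * t)%R)%E.
have mxt : measurable_fun setT (fun z : R * R => z.1 + a n * z.2).
  by apply: measurable_funD => //; apply: measurable_funM.
have mF2 : measurable_fun setT F2.
  have mFz : measurable_fun setT (fun z : R * R => F (z.1 + a n * z.2)%R).
    exact: (measurableT_comp mF mxt).
  have mF' := @measurable_fun_fubini_tonelli_F _ _ _ _ _ N _ mFz (fun z => F0 (z.1 + a n * z.2)).
  exact: mF'.
transitivity (\int[mu]_y F2 (\sum_(j < n) a j * y (m + j)%N)%R)%E.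
  apply: eq_integral => y _; apply: eq_integral => t _; congr F.
  rewrite big_ord_recr/= upd_eq; congr (_ + _); apply: eq_bigr => j _.
  by rewrite upd_lt// ltn_add2l.
rewrite IH//; last by move=> x; exact: integral_ge0.
rewrite big_ord_recr/=; set V := \sum_(j < n) a j ^+ 2.
have V0 : 0 <= V by apply: sumr_ge0 => j _; exact: sqr_ge0.
(* [normal_rotation] requires a positive first coefficient, so [a n = 0] is treated apart. *)
have := a0 n; rewrite le_eqVlt => /predU1P[a0n|an0].
  apply: eq_integral => s _; rewrite /F2 -a0n expr0n/= addr0.
  under eq_integral do rewrite mul0r addr0.
  exact: (integral_prob_cst N _).
have W0 : 0 < V + a n ^+ 2 by rewrite ltr_wpDl// exprn_gt0.
pose w := Num.sqrt (V + a n ^+ 2).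
have w0 : 0 < w by rewrite sqrtr_gt0.
have w2 : w ^+ 2 = V + a n ^+ 2 by rewrite sqr_sqrtr// ltW.
rewrite /F2 -/w.
have mw : measurable_fun setT (fun t : R => F (w * t)%R).
  by apply: (measurableT_comp mF); exact: measurable_funM.
rewrite -(@normal_rotation R (a n / w) (Num.sqrt V / w) (fun t => F (w * t)%R))//.
- apply: eq_integral => s _; apply: eq_integral => t _; congr F.
  by field; rewrite gt_eqF.
- by rewrite divr_gt0.
- have sV : Num.sqrt V ^+ 2 = V by rewrite sqr_sqrtr.
  by rewrite !exprMn !exprVn sV w2 -mulrDl addrC divff// gt_eqF.
Qed.

(** The null form of the quadratic statistic. Since [t^2 - 1] has variance 2, it has variance 1 when
    the squared weights sum to 1/2. *)
Definition chi2_stat (n : nat) (w : nat -> R) (y : nat -> R) : R :=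
  \sum_(k < n) w k * (y k ^+ 2 - 1).

Lemma measurable_chi2_stat n w : measurable_fun setT (fun y : T => chi2_stat n w y).
Proof.
apply: (@measurable_coord_sum R n (fun j t => w j * (t ^+ 2 - 1)) id) => j.
apply: measurable_funM => //; apply: measurable_funB => //; exact: measurable_funX.
Qed.

Lemma integrable_sqB1_cube : intgN (fun t => `|t ^+ 2 - 1| ^+ 3).
Proof.
apply: (@integrable_leR _ _ _ N _ (fun t => (`|t| ^+ 6 + 3 * `|t| ^+ 4) + (3 * `|t| ^+ 2 + 1))).
- apply: measurable_funX; apply: (@measurableT_comp _ _ _ _ _ _ (@Num.norm R R)) => //.
  by apply: measurable_funB => //; exact: measurable_funX.
- move=> t; rewrite ger0_norm ?exprn_ge0//.
  have -> : (`|t| ^+ 6 + 3 * `|t| ^+ 4) + (3 * `|t| ^+ 2 + 1) = (`|t| ^+ 2 + 1) ^+ 3 by ring.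
  rewrite ler_pXn2r ?nnegrE ?addr_ge0 ?exprn_ge0//.
  by rewrite (le_trans (ler_normB _ _))// normr1 normrX.
- apply: integrableDR; apply: integrableDR.
  + exact: integrable_absX_normal.
  + by apply: integrableZR; exact: integrable_absX_normal.
  + by apply: integrableZR; exact: integrable_absX_normal.
  + exact: integrable_cstR.
Qed.

Lemma integrable_sqB1 : intgN (fun t => t ^+ 2 - 1).
Proof. by apply: integrableBR; [exact: integrableX_normal|exact: integrable_cstR]. Qed.

Lemma integrable_sqB1_sq : intgN (fun t => (t ^+ 2 - 1) ^+ 2).
Proof.
have -> : (fun t : R => (t ^+ 2 - 1) ^+ 2) = fun t => t ^+ 4 - (2 * t ^+ 2 - 1).
  by apply/funext => t; ring.
apply: integrableBR; first exact: integrableX_normal.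
by apply: integrableBR; [apply: integrableZR; exact: integrableX_normal|exact: integrable_cstR].
Qed.

Lemma mean_sqB1 : \int[N]_t (t ^+ 2 - 1) = 0.
Proof.
have [_ m2 _ _] := @normal_moments R.
rewrite RintegralBR ?Rintegral_cstR ?m2 ?subrr//; first exact: integrableX_normal.
exact: integrable_cstR.
Qed.

Lemma var_sqB1 : \int[N]_t ((t ^+ 2 - 1) ^+ 2) = 2.
Proof.
have [_ m2 _ m4] := @normal_moments R.
have i2 : intgN (fun t => 2 * t ^+ 2) by apply: integrableZR; exact: integrableX_normal.
have i1 : intgN (fun=> 1) by exact: integrable_cstR.
have i4 := @integrableX_normal R 4.
transitivity (\int[N]_t (t ^+ 4 - (2 * t ^+ 2 - 1))).
  by apply: eq_Rintegral => t _; ring.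
rewrite (RintegralBR i4 (integrableBR i2 i1)) (RintegralBR i2 i1) Rintegral_cstR.
rewrite (RintegralZ 2 (@integrableX_normal R 2)) m2 m4; ring.
Qed.

(** [cube1] and [cube2] are the third absolute moments of [t^2 - 1] and of its Gaussian replacement
    of equal variance: the constants of the Lindeberg error. *)
Definition cube1 := \int[N]_t (`|t ^+ 2 - 1| ^+ 3).
Definition cube2 := \int[N]_t (`|Num.sqrt 2 * t| ^+ 3).

Lemma integrable_cube2 : intgN (fun t => `|Num.sqrt 2 * t| ^+ 3).
Proof.
under eq_fun do rewrite normrM exprMn.
by apply: integrableZR; exact: integrable_absX_normal.
Qed.

Lemma clt_smooth (mu : probability T R) (mu_gauss : standard_gaussian mu)
    (n : nat) (w : nat -> R) (f f1 f2 : R -> R) (M kap : R) :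
  measurable_fun setT f -> (forall x, 0 <= f x <= 1) -> 0 <= M ->
  (forall x h, `|f (x + h) - f x - f1 x * h - f2 x * (h ^+ 2 / 2)| <= M * `|h| ^+ 3) ->
  (forall k, 0 <= w k) -> (forall k, (k < n)%N -> w k <= kap) ->
  \sum_(k < n) w k ^+ 2 = 1 / 2 ->
  `|\int[mu]_y f (chi2_stat n w y) - \int[N]_t f t| <= M * (cube1 + cube2) * (kap / 2).
Proof.
move=> mf f01 M0 ft w0 wk w2.
(* In the hybrid [hyb k] the first [k] summands are Gaussian, carried by the fresh
   coordinates [n + j], so that the Lindeberg swap applies to each step. *)
pose hyb (k : nat) (y : nat -> R) := \sum_(j < k) (Num.sqrt 2 * w j) * y (n + j)%N
   + \sum_(j < n) (k <= j)%N%:R * (w j * (y j ^+ 2 - 1)).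
have mhyb k : measurable_fun setT (fun y : T => hyb k y).
  apply: measurable_funD.
    apply: (@measurable_coord_sum R k (fun j t => Num.sqrt 2 * w j * t) (fun j => n + j)%N) => j.
    exact: measurable_funM.
  apply: (@measurable_coord_sum R n (fun j t => (k <= j)%N%:R * (w j * (t ^+ 2 - 1))) id) => j.
  apply: measurable_funM => //; apply: measurable_funM => //.
  by apply: measurable_funB => //; exact: measurable_funX.
have E0 : \int[mu]_y f (chi2_stat n w y) = \int[mu]_y f (hyb 0%N y).
  apply: eq_Rintegral => y _; congr f; rewrite /hyb big_ord0 add0r.
  by apply: eq_bigr => j _; rewrite mul1r.
have En : \int[mu]_y f (hyb n y) = \int[N]_t f t.
  rewrite /Rintegral; congr fine.
  have h := @gauss_sum mu mu_gauss (fun j => Num.sqrt 2 * w j) n n (EFin \o f).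
  rewrite (_ : \sum_(j < n) (Num.sqrt 2 * w j) ^+ 2 = 1) in h; last first.
    under eq_bigr do rewrite exprMn sqr_sqrtr//.
    by rewrite -mulr_sumr w2; field.
  rewrite sqrtr1 in h.
  under [RHS]eq_integral do rewrite -[X in f X]mul1r.
  rewrite -h//.
  - apply: eq_integral => y _; congr (f _)%:E; rewrite /hyb [X in _ + X]big1 ?addr0// => j _.
    by rewrite leqNgt ltn_ord mul0r.
  - by move=> j; rewrite mulr_ge0// sqrtr_ge0.
  - exact/measurable_EFinP.
  - by move=> x; rewrite lee_fin; have /andP[] := f01 x.
(* A swap costs a multiple of [w k ^+ 3 <= kap * w k ^+ 2], and the squares sum to 1/2. *)
have step k : (k < n)%N -> `|\int[mu]_y f (hyb k y) - \int[mu]_y f (hyb k.+1 y)| <=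
    M * (cube1 + cube2) * (kap * w k ^+ 2).
  move=> kn.
  pose C (y : nat -> R) := \sum_(j < k) (Num.sqrt 2 * w j) * y (n + j)%N
   + \sum_(j < n) (k < j)%N%:R * (w j * (y j ^+ 2 - 1)).
  have mC : measurable_fun setT (fun y : T => C y).
    apply: measurable_funD.
      apply: (@measurable_coord_sum R k (fun j t => Num.sqrt 2 * w j * t) (fun j => n + j)%N) => j.
      exact: measurable_funM.
    apply: (@measurable_coord_sum R n (fun j t => (k < j)%N%:R * (w j * (t ^+ 2 - 1))) id) => j.
    apply: measurable_funM => //; apply: measurable_funM => //.
    by apply: measurable_funB => //; exact: measurable_funX.
  pose za t := w k * (t ^+ 2 - 1).
  pose zb t := w k * (Num.sqrt 2 * t).
  have hk : forall y : T, hyb k y = C y + za (y k).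
    move=> y; rewrite /hyb /C -addrA; congr (_ + _).
    rewrite (bigD1 (Ordinal kn))//= leqnn mul1r [in RHS](bigD1 (Ordinal kn))//= ltnn mul0r add0r addrC.
    congr (_ + _); apply: eq_bigr => j; rewrite -val_eqE/= => jk.
    by rewrite leq_eqVlt eq_sym (negbTE jk).
  have hk1 : forall y : T, hyb k.+1 y = C y + zb (y (n + k)%N).
    move=> y; rewrite /hyb /C big_ord_recr/= /zb addrAC; congr (_ + _); ring.
  under eq_Rintegral do rewrite hk.
  under [X in _ - X]eq_Rintegral do rewrite hk1.
  apply: (@le_trans _ _ (M * (w k ^+ 3 * cube1 + w k ^+ 3 * cube2))); last first.
    rewrite -mulrDr mulrCA mulrC ler_wpM2l//.
      by rewrite mulr_ge0// addr_ge0// Rintegral_ge0// => t _; exact: exprn_ge0.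
    by rewrite exprS ler_wpM2r ?exprn_ge0// wk.
  have iX := @integrableX_normal R.
  have iA := @integrable_absX_normal R.
  have [m1 m2 _ _] := @normal_moments R.
  have i1 : intgN (fun t => t) by exact: (iX 1%N).
  have isq : intgN (fun t => (Num.sqrt 2 * t) ^+ 2).
    by under eq_fun do rewrite exprMn; exact: integrableZR.
  apply: (@lindeberg_swap R mu mu_gauss f f1 f2 M (w k ^+ 2 * 2)) => //.
  - apply: measurable_funM => //; apply: measurable_funB => //; exact: measurable_funX.
  - by apply: integrableZR; exact: integrable_sqB1.
  - rewrite /za; under eq_fun do rewrite exprMn.
    by apply: integrableZR; exact: integrable_sqB1_sq.
  - rewrite /za; under eq_fun do rewrite normrM exprMn ger0_norm//.
    by apply: integrableZR; exact: integrable_sqB1_cube.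
  - by rewrite /za (RintegralZ _ integrable_sqB1) mean_sqB1 mulr0.
  - rewrite /za; under eq_Rintegral do rewrite exprMn.
    by rewrite (RintegralZ _ integrable_sqB1_sq) var_sqB1.
  - rewrite /za; under eq_Rintegral do rewrite normrM exprMn ger0_norm//.
    by rewrite (RintegralZ _ integrable_sqB1_cube).
  - by apply: measurable_funM => //; exact: measurable_funM.
  - by apply: integrableZR; apply: integrableZR.
  - rewrite /zb; under eq_fun do rewrite exprMn.
    by apply: integrableZR.
  - rewrite /zb; under eq_fun do rewrite normrM exprMn ger0_norm//.
    by apply: integrableZR; exact: integrable_cube2.
  - by rewrite /zb (RintegralZ _ (integrableZR _ i1)) (RintegralZ _ i1) m1 !mulr0.
  - rewrite /zb; under eq_Rintegral do rewrite exprMn.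
    rewrite (RintegralZ _ isq); under eq_Rintegral do rewrite exprMn.
    by rewrite (RintegralZ _ (iX 2%N)) m2 mulr1 sqr_sqrtr.
  - rewrite /zb; under eq_Rintegral do rewrite normrM exprMn ger0_norm//.
    by rewrite (RintegralZ _ integrable_cube2).
  - move=> y t; rewrite /C; congr (_ + _); apply: eq_bigr => j _.
      by rewrite /upd gtn_eqF// ltn_addr.
    by rewrite /upd; case: eqP => [->|//]; rewrite ltnn !mul0r.
  - move=> y t; rewrite /C; congr (_ + _); apply: eq_bigr => j _.
      by rewrite /upd eqn_add2l ltn_eqF.
    by rewrite /upd ltn_eqF// ltn_addr.
have tele m : (m <= n)%N -> `|\int[mu]_y f (hyb 0%N y) - \int[mu]_y f (hyb m y)| <=
    \sum_(k < m) M * (cube1 + cube2) * (kap * w k ^+ 2).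
  elim: m => [|m IH] mn; first by rewrite big_ord0 subrr normr0.
  rewrite big_ord_recr/=; apply: le_trans (lerD (IH (ltnW mn)) (step m mn)).
  apply: le_trans (ler_normD _ _); rewrite le_eqVlt; apply/orP; left; apply/eqP.
  by congr (`|_|); ring.
rewrite E0 -En; apply: (le_trans (tele n (leqnn n))).
by rewrite -!mulr_sumr w2 le_eqVlt; apply/orP; left; apply/eqP; ring.
Qed.

End clt.

(** * Distance to the normal law and truncated likelihood ratios *)

Section kolmogorov.
Context {R : realType}.
Local Notation T := (g_sigma_algebraType (@cylinders R)).
Local Notation N := (@normal_prob R 0 1).
Local Notation intgN f := (N.-integrable setT (EFin \o f)).

Lemma leind (x t : R) : (t <= x)%R%:R = \1_(`]-oo, x]%classic) t :> R.
Proof.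
rewrite indicE; case: (leP t x) => h.
  by rewrite mem_set//= in_itv.
by rewrite memNset//= in_itv/= leNgt h.
Qed.

Lemma measurable_leind (x : R) : measurable_fun setT (fun t : R => (t <= x)%R%:R : R).
Proof.
rewrite (_ : (fun t : R => _) = \1_(`]-oo, x]%classic)); last by apply/funext => t; rewrite leind.
exact: measurable_indic.
Qed.

Lemma leind01 (x t : R) : (0 : R) <= (t <= x)%R%:R <= (1 : R).
Proof. by case: (t <= x) => /=; rewrite ?lexx ler01. Qed.

Lemma Phi_Rintegral (x : R) : \int[N]_t ((t <= x)%R%:R) = Phi x.
Proof.
rewrite /Phi /Rintegral; congr fine.
under eq_integral do rewrite leind.
by rewrite integral_indic// setIT.
Qed.

(** The indicator is squeezed between logistic steps. On each side the two comparisons cost [k]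
    each, the shift of the argument costs [2 k] by the Lipschitz bound, and the smooth central limit
    theorem costs [e / 4]. The resulting [kap] depends on [e] alone. *)
Lemma chi2_clt (e : R) : 0 < e -> exists kap : R, 0 < kap /\
  forall mu : probability T R, standard_gaussian mu ->
  forall (n : nat) (w : nat -> R), (forall k, 0 <= w k) ->
  (forall k, (k < n)%N -> w k <= kap) -> \sum_(k < n) w k ^+ 2 = 1 / 2 ->
  forall x, `|\int[mu]_y ((chi2_stat n w y <= x)%R%:R) - Phi x| <= e.
Proof.
move=> e0.
have [k [k0 ek]] : exists k : R, 0 < k /\ e = 8 * k by exists (e / 8); split; [lra|field].
have ar1 (x P EF EN p2 p : R) : P <= EF + k -> EF - e / 4 <= EN -> EN <= p2 + k ->
  p2 - p <= (x + 2 * k) - x -> P - e <= p by lra.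
have ar2 (x P EF EN p2 p : R) : EF <= P + k -> EN <= EF + e / 4 -> p2 <= EN + k ->
  p - p2 <= x - (x - 2 * k) -> p <= P + e by lra.
pose M : R := (k ^+ 2) ^- 3.
have M0 : 0 <= M by rewrite invr_ge0 !exprn_ge0// ltW.
pose c : R := cube1 + cube2.
have c0 : 0 <= c by rewrite addr_ge0// Rintegral_ge0// => t _; exact: exprn_ge0.
(* Chosen so that [M * c * (kap / 2) <= e / 4], with a denominator that stays positive if
   [M * c = 0]. *)
pose kap := e / (2 * (M * c) + 1).
have Mc : 0 <= M * c by exact: mulr_ge0.
have den : 0 < 2 * (M * c) + 1 by lra.
exists kap; split; first by rewrite divr_gt0.
move=> mu mug n w w0 wk w2 x.
have small : M * c * (kap / 2) <= e / 4.
  have -> : M * c * (kap / 2) = (e / 2) * ((M * c) / (2 * (M * c) + 1)).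
    by rewrite /kap; field; lra.
  have : (M * c) / (2 * (M * c) + 1) <= 1 / 2 by rewrite ler_pdivrMr//; lra.
  nra.
have sm01 a z : 0 <= sm a (k ^+ 2) z <= 1 by rewrite sm_ge0 sm_le1.
have msm a := @measurable_sm R a (k ^+ 2).
have mchi := @measurable_chi2_stat R n w.
have clt a : `|\int[mu]_y sm a (k ^+ 2) (chi2_stat n w y) - \int[N]_t sm a (k ^+ 2) t| <= e / 4.
  have [f1 [f2 tay]] := @sm_taylor R a (k ^+ 2) (exprn_gt0 _ k0).
  apply: le_trans small.
  exact: (clt_smooth mug (msm a) (sm01 a) M0 tay w0 wk w2).
have imsm a : mu.-integrable setT (EFin \o (fun y : T => sm a (k ^+ 2) (chi2_stat n w y))).
  by apply: integrable_01 => //; exact: (measurableT_comp (msm a) mchi).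
have iNsm a : intgN (fun t => sm a (k ^+ 2) t).
  exact: (integrable_01 N (msm a) (sm01 a)).
have imle a : mu.-integrable setT (EFin \o (fun y : T => (chi2_stat n w y <= a)%R%:R)).
  apply: integrable_01; first exact: (measurableT_comp (measurable_leind a) mchi).
  by move=> y; exact: leind01.
have iNle a : intgN (fun t => (t <= a)%R%:R).
  exact: (integrable_01 N (measurable_leind a) (leind01 a)).
rewrite ler_distlC; apply/andP; split.
- have h1 : \int[mu]_y ((chi2_stat n w y <= x)%R%:R) <=
     \int[mu]_y sm (x + k) (k ^+ 2) (chi2_stat n w y) + k.
    by apply: Rintegral_leD => // y; exact: sm_lower.
  have h2 := clt (x + k).
  have h3 : \int[N]_t sm (x + k) (k ^+ 2) t <= \int[N]_t ((t <= x + 2 * k)%R%:R) + k.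
    apply: Rintegral_leD => // t; have -> : x + k = x + 2 * k - k by ring.
    exact: sm_upper.
  have h4 : Phi (x + 2 * k) - Phi x <= (x + 2 * k) - x by apply: Phi_lipschitz; lra.
  rewrite Phi_Rintegral in h3; move: h2; rewrite ler_distlC => /andP[h2 h2'].
  exact: ar1 h1 h2 h3 h4.
- have h1 : \int[mu]_y sm (x - k) (k ^+ 2) (chi2_stat n w y) <=
      \int[mu]_y ((chi2_stat n w y <= x)%R%:R) + k.
    by apply: Rintegral_leD => // y; exact: sm_upper.
  have h2 := clt (x - k).
  have h3 : \int[N]_t ((t <= x - 2 * k)%R%:R) <= \int[N]_t sm (x - k) (k ^+ 2) t + k.
    apply: Rintegral_leD => // t; have -> : x - k = x - 2 * k + k by ring.
    exact: sm_lower.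
  have h4 : Phi x - Phi (x - 2 * k) <= x - (x - 2 * k) by apply: Phi_lipschitz; lra.
  rewrite Phi_Rintegral in h3; move: h2; rewrite ler_distlC => /andP[h2 h2'].
  exact: ar2 h1 h2' h3 h4.
Qed.

(** The minimum of [c psi + (1 - psi) L] over [psi] between 0 and 1, for [L] the likelihood ratio of
    [N(u, 1)] to [N(0, 1)] at [z]. *)
Definition trunc_lr (c u z : R) : R := Num.min c (expR (u * z - u ^+ 2 / 2)).

(** With this [c] the minimum switches at [t = H]; the part below [H] is evaluated by
    Cameron-Martin. *)
Lemma trunc_lr_normal (u H : R) : 0 < u ->
  \int[N]_t trunc_lr (expR (u * H - u ^+ 2 / 2)) u t =
  expR (u * H - u ^+ 2 / 2) * (1 - Phi H) + Phi (H - u).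
Proof.
move=> u0; set c := expR _.
have c0 : 0 < c by exact: expR_gt0.
have mexp : measurable_fun setT (fun t : R => expR (u * t - u ^+ 2 / 2)).
  apply: measurableT_comp => //.
  by apply: measurable_funB => //; exact: measurable_funM.
have ml := @measurable_leind H.
have E t : trunc_lr c u t = c * (1 - (t <= H)%R%:R) + (t <= H)%R%:R * expR (u * t - u ^+ 2 / 2).
  rewrite /trunc_lr /c; case: (leP t H) => tH /=.
    by rewrite subrr mulr0 add0r mul1r; apply/min_idPr; rewrite ler_expR; nra.
  rewrite subr0 mulr1 mul0r addr0; apply/min_idPl; rewrite ler_expR; nra.
have i1 : intgN (fun t => (t <= H)%R%:R).
  exact: (integrable_01 N ml (leind01 H)).
have i2 : intgN (fun t => c * (1 - (t <= H)%R%:R)).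
  by apply: integrableZR; apply: integrableBR => //; exact: integrable_cstR.
have i3 : intgN (fun t => (t <= H)%R%:R * expR (u * t - u ^+ 2 / 2)).
  apply: (@integrable_bnd _ _ _ N _ c); first exact: measurable_funM.
  move=> t; case: (leP t H) => tH /=; last by rewrite mul0r normr0 ltW.
  by rewrite mul1r ger0_norm ?expR_ge0// ler_expR; nra.
under eq_Rintegral do rewrite E.
rewrite RintegralD// RintegralZ//; last by apply: integrableBR => //; exact: integrable_cstR.
rewrite RintegralBR//; last exact: integrable_cstR.
rewrite Rintegral_cstR Phi_Rintegral; congr (_ + _).
rewrite -Phi_Rintegral /Rintegral; congr fine.
have cm := @cameron_martin R u (fun t => (t <= H)%R%:R%:E).
under eq_integral do rewrite EFinM.
rewrite -cm.
- by apply: eq_integral => t _; rewrite lerBrDr.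
- exact/measurable_EFinP.
- by move=> t; rewrite lee_fin; have /andP[] := leind01 H t.
Qed.

Lemma measurable_trunc_lr c u : measurable_fun setT (trunc_lr c u).
Proof.
apply: measurable_minr => //; apply: measurableT_comp => //.
by apply: measurable_funB => //; exact: measurable_funM.
Qed.

Lemma layer_cake d (X : measurableType d) (m : probability X R) (g : X -> R) :
  measurable_fun setT g -> (forall x, 0 <= g x) ->
  (\int[m]_x (g x)%:E =
   \int[@lebesgue_measure R]_(r in `[0%R, +oo[) m [set x | (r < g x)%R])%E.
Proof.
move=> mg g0.
pose G : {RV m >-> R} := mfun_Sub (mem_set mg).
have := @ge0_expectation_ccdf _ _ _ m G g0; rewrite expectation_def/= => ->.
apply: eq_integral => r _; congr (m _).
by apply/seteqP; split => x; rewrite /= in_itv/= andbT.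
Qed.

Lemma measurable_tail d (X : measurableType d) (m : probability X R) (g : X -> R) :
  measurable_fun setT g -> measurable_fun setT (fun r : R => m [set x | (r < g x)%R]).
Proof.
move=> mg; pose G : {RV m >-> R} := mfun_Sub (mem_set mg).
have := @ccdf_measurable _ _ _ m G; congr (measurable_fun _ _).
apply/funext => r; congr (m _).
by apply/seteqP; split => x; rewrite /= in_itv/= andbT.
Qed.

Lemma measurable_gt d (X : measurableType d) (g : X -> R) (r : R) :
  measurable_fun setT g -> measurable [set x | (r < g x)%R].
Proof.
move=> mg; have := mg measurableT `]r, +oo[%classic (measurable_itv _); rewrite setTI.
by congr measurable; apply/seteqP; split => x; rewrite /= in_itv/= andbT.
Qed.

Lemma prob_gt d (X : measurableType d) (m : probability X R) (g : X -> R) (r : R) :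
  measurable_fun setT g ->
  m [set x | (r < g x)%R] = (1 - \int[m]_x ((g x <= r)%R%:R))%:E.
Proof.
move=> mg.
have mle : measurable_fun setT (fun x => (g x <= r)%R%:R : R).
  exact: (measurableT_comp (measurable_leind r) mg).
have i1 := integrable_01 m mle (fun x => leind01 r (g x)).
have mS := measurable_gt r mg.
rewrite -[X in (X - _)%:E](Rintegral_cstR m) -RintegralBR//; last exact: integrable_cstR.
rewrite -RintegralE; last by apply: integrableBR => //; exact: integrable_cstR.
transitivity (\int[m]_x (\1_[set x | (r < g x)%R] x)%:E)%E.
  by rewrite integral_indic// setIT.
apply: eq_integral => x _; rewrite indicE; case: (leP (g x) r) => h /=.
  by rewrite subrr memNset//= => /lt_geF; rewrite h.
by rewrite subr0 mem_set.
Qed.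

(* Layer cake: both expectations are integrals over [0, c] of tail probabilities. *)
Lemma trunc_lr_close (mu : probability T R) (X : T -> R) (c u e : R) :
  measurable_fun setT X -> 0 < u -> 0 < c -> 0 <= e ->
  (forall x, `|\int[mu]_y ((X y <= x)%R%:R) - Phi x| <= e) ->
  \int[N]_t trunc_lr c u t <= \int[mu]_y trunc_lr c u (X y) + c * e.
Proof.
move=> mX u0 c0 e0 XPhi.
have mg := @measurable_trunc_lr c u.
have mgX : measurable_fun setT (fun y => trunc_lr c u (X y)) by exact: (measurableT_comp mg mX).
have g0 z : 0 < trunc_lr c u z by rewrite lt_min c0 expR_gt0.
have gc z : trunc_lr c u z <= c by rewrite ge_min lexx.
have gB z : `|trunc_lr c u z| <= c by rewrite gtr0_norm.
have iN : intgN (trunc_lr c u) by exact: (integrable_bnd N mg gB).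
have iX : mu.-integrable setT (EFin \o (fun y => trunc_lr c u (X y))).
  exact: (integrable_bnd mu mgX (fun y => gB (X y))).
rewrite -lee_fin EFinD -RintegralE// -RintegralE//.
rewrite (layer_cake N mg (fun x => ltW (g0 x))) (layer_cake mu mgX (fun y => ltW (g0 (X y)))).
have tail (r : R) : 0 <= r -> r < c ->
    (N [set z | (r < trunc_lr c u z)%R] <= mu [set y | (r < trunc_lr c u (X y))%R] + e%:E)%E.
  move=> r0 rc.
  (* At [r = 0] both tails are the whole space. For [r > 0] a logarithm turns the event into a
     half-line, to which the bound on the distance to [Phi] applies. *)
  have [->|rnz] := eqVneq r 0.
    have setE (Y : Type) (h : Y -> R) : [set y | 0 < trunc_lr c u (h y)] = setT.
      by apply/seteqP; split => // y _ /=; exact: g0.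
    have := setE _ id => /= ->; rewrite setE (_ : N _ = 1%E); last exact: probability_setT.
    by rewrite probability_setT leeDl.
  have rp : 0 < r by rewrite lt_neqAle eq_sym rnz.
  pose x := (ln r + u ^+ 2 / 2) / u.
  have gr z : (r < trunc_lr c u z) = (x < z).
    rewrite lt_min rc/= /x ltr_pdivrMr// -ltrBrDr mulrC.
    by rewrite -[in LHS](lnK rp) ltr_expR.
  have -> : [set z | r < trunc_lr c u z] = [set z : R | x < z].
    by apply/seteqP; split => z /=; rewrite gr.
  have -> : [set y | r < trunc_lr c u (X y)] = [set y | x < X y].
    by apply/seteqP; split => z /=; rewrite gr.
  have -> := @prob_gt _ _ mu X x mX.
  have mid : measurable_fun setT (fun z : R => z) by exact: measurable_id.
  have hN := @prob_gt _ _ N (fun z => z) x mid.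
  apply: (@le_trans _ _ (1 - \int[N]_z ((z <= x)%R%:R))%:E); first by rewrite -hN.
  rewrite Phi_Rintegral -EFinD lee_fin.
  by have := XPhi x; rewrite ler_distlC => /andP[]; lra.
pose D : set R := `[0%R, +oo[%classic.
have mD : measurable D by exact: measurable_itv.
have mI : measurable_fun D (fun r : R => (e * \1_(`[0%R, c]%classic) r)%:E).
  by apply/measurable_EFinP/measurable_funM => //; exact/measurable_funTS/measurable_indic.
apply: (@le_trans _ _ (\int[@lebesgue_measure R]_(r in D)
    (mu [set y | (r < trunc_lr c u (X y))%R] + (e * \1_(`[0%R, c]%classic) r)%:E))%E).
  apply: ge0_le_integral => //.
  - by apply: measurable_funTS; exact: (measurable_tail N mg).
  - apply: emeasurable_funD => //.
    by apply: measurable_funTS; exact: (measurable_tail mu mgX).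
  - move=> r; rewrite /D/= in_itv/= andbT => r0.
    have [rc|rc] := ltP r c.
      rewrite indicE mem_set ?mulr1; last by rewrite /= in_itv/= r0 ltW.
      exact: tail.
    apply: (@le_trans _ _ 0%E); last by rewrite adde_ge0// lee_fin mulr_ge0.
    rewrite (_ : [set z | _] = set0); first by rewrite le_eqVlt; apply/orP; left; apply/eqP; exact: measure0.
    by apply/seteqP; split => // z /= /lt_le_trans /(_ (gc z)); rewrite ltNge rc.
rewrite ge0_integralD//; last 2 first.
- by apply: measurable_funTS; exact: (measurable_tail mu mgX).
- by move=> r _; rewrite lee_fin mulr_ge0.
rewrite leeD2l//.
under eq_integral do rewrite EFinM.
rewrite ge0_integralZl//; last first.
  by apply/measurable_EFinP/measurable_funTS/measurable_indic.
rewrite integral_indic//= setIidl; last first.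
  by move=> r; rewrite /D/= !in_itv/= => /andP[->].
by rewrite lebesgue_measure_itv/= lte_fin c0 -EFinD -EFinM lee_fin subr0 mulrC.
Qed.
End kolmogorov.

(** * Bayesian lower bound *)

Section cosh.
Context {R : realType}.

Lemma ge0_of_derive (g g' : R -> R) : (forall x : R, is_derive x 1 g (g' x)) ->
  0 <= g 0 -> (forall x : R, 0 <= x -> 0 <= g' x) -> forall x : R, 0 <= x -> 0 <= g x.
Proof.
move=> dg g0 g'0 x x0.
have cg : continuous g.
  by move=> y; apply/differentiable_continuous/derivable1_diffP; have [] := dg y.
have [|c] := @MVT_segment _ g g' 0 x x0; first exact: continuous_subspaceT.
rewrite in_itv/= => /andP[c0 cx] /eqP; rewrite subr_eq => /eqP ->.
by rewrite addr_ge0// mulr_ge0 ?g'0// subr0.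
Qed.

Definition cosh (x : R) : R := (expR x + expR (- x)) / 2.
Definition sinh (x : R) : R := (expR x - expR (- x)) / 2.

Lemma is_derive_expRN (x : R) : is_derive x 1 (fun t => expR (- t)) (- expR (- x)).
Proof.
have := @is_derive1_comp _ expR -%R x (expR (- x)) (-1) (is_derive_expR _).
by rewrite mulrN1; apply; apply: is_derive_eq.
Qed.

Lemma is_derive_cosh (x : R) : is_derive x 1 cosh (sinh x).
Proof.
have h := is_derive_expRN x.
apply: is_derive_eq; rewrite /sinh /GRing.scale/=; ring.
Qed.

Lemma is_derive_sinh (x : R) : is_derive x 1 sinh (cosh x).
Proof.
have h := is_derive_expRN x.
apply: is_derive_eq; rewrite /cosh /GRing.scale/=; ring.
Qed.

Lemma cosh_gt0 x : 0 < cosh x.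
Proof. by rewrite divr_gt0// addr_gt0// expR_gt0. Qed.

Lemma sinh_ge0 x : 0 <= x -> 0 <= sinh x.
Proof. by move=> x0; rewrite divr_ge0// subr_ge0 ler_expR; lra. Qed.

(* Second-order comparison of [log cosh] with its Taylor polynomial, in the only
   direction the lower bound needs. *)
Lemma cosh_ge (x : R) : expR (x ^+ 2 / 2 - x ^+ 4 / 12) <= cosh x.
Proof.
have dc := is_derive_cosh; have ds := is_derive_sinh.
(* [s2] says [tanh y <= y]; it gives [s3], which says [tanh y >= y - y^3 / 3] and compares the
   derivative of [log cosh] with that of the polynomial. *)
have s2 : forall y : R, 0 <= y -> 0 <= y * cosh y - sinh y.
  apply: (@ge0_of_derive (fun y => y * cosh y - sinh y) (fun y => y * sinh y)).
  - move=> y; apply: is_derive_eq; rewrite /GRing.scale/=; ring.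
  - by rewrite mul0r sub0r /sinh oppr0 subrr mul0r oppr0.
  - by move=> y y0; rewrite mulr_ge0// sinh_ge0.
have s3 : forall y : R, 0 <= y -> 0 <= sinh y - cosh y * (y - y ^+ 3 / 3).
  apply: (@ge0_of_derive (fun y => sinh y - cosh y * (y - y ^+ 3 / 3))
     (fun y => y * (y * cosh y - sinh y) + sinh y * (y ^+ 3 / 3))).
  - by move=> y; apply: is_derive_eq; rewrite /GRing.scale/=; field.
  - by rewrite expr0n/= mul0r subr0 mulr0 subr0 /sinh oppr0 subrr mul0r.
  - move=> y y0; rewrite addr_ge0// mulr_ge0 ?s2 ?sinh_ge0//.
    by rewrite divr_ge0// exprn_ge0.
(* Written multiplicatively to avoid the logarithm; the derivative is an exponential times the
   quantity of [s3]. *)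
have main : forall y : R, 0 <= y -> 0 <= cosh y * expR (- (y ^+ 2 / 2 - y ^+ 4 / 12)) - 1.
  have de (y : R) : is_derive y 1 (fun t => expR (- (t ^+ 2 / 2 - t ^+ 4 / 12)))
      (expR (- (y ^+ 2 / 2 - y ^+ 4 / 12)) * (- (y - y ^+ 3 / 3))).
    apply: (@is_derive1_comp _ expR (fun t => - (t ^+ 2 / 2 - t ^+ 4 / 12)) y).
    by apply: is_derive_eq; rewrite /GRing.scale/=; field.
  apply: (@ge0_of_derive _ (fun y => expR (- (y ^+ 2 / 2 - y ^+ 4 / 12)) *
      (sinh y - cosh y * (y - y ^+ 3 / 3)))).
  - move=> y; apply: is_derive_eq; rewrite /GRing.scale/=; ring.
  - rewrite !expr0n/= !mul0r subr0 oppr0 expR0 mulr1 /cosh oppr0 expR0.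
    by rewrite -mulr2n -mulr_natr mul1r divff ?subrr.
  - by move=> y y0; rewrite mulr_ge0 ?expR_ge0// s3.
wlog x0 : x / 0 <= x => [H|].
  have [|x0] := leP 0 x; first exact: H.
  have := H (- x); rewrite oppr_ge0 (ltW x0) => /(_ isT).
  rewrite sqrrN (_ : (- x) ^+ 4 = x ^+ 4); last by ring.
  by rewrite (_ : cosh (- x) = cosh x)// /cosh opprK addrC.
have := main x x0; rewrite subr_ge0 expRN ler_pdivlMr ?expR_gt0// mul1r.
done.
Qed.

End cosh.

(** * Random signs as a prior *)

Section bayes.
Context {R : realType}.
Local Notation T := (g_sigma_algebraType (@cylinders R)).
Local Notation N := (@normal_prob R 0 1).

Definition obs (eps : R) (eta y : nat -> R) : nat -> R := fun k => eta k + eps * y k.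

Lemma measurable_obs eps eta : measurable_fun setT (fun y : T => obs eps eta y : T).
Proof.
apply: measurable_to_seq => k; rewrite /obs.
apply: measurable_funD => //; apply: measurable_funM => //.
exact: measurable_coord.
Qed.

(** Likelihood ratio of one normal coordinate whose mean is [z] or [- z] with probability 1/2 each,
    against mean 0. *)
Definition sign_lr (z t : R) : R := expR (- (z ^+ 2 / 2)) * cosh (z * t).

Lemma sign_lrE (z t : R) :
  sign_lr z t = (expR (z * t - z ^+ 2 / 2) + expR (- z * t - (- z) ^+ 2 / 2)) / 2.
Proof.
rewrite /sign_lr /cosh sqrrN mulrA mulrDr -!expRD mulNr.
by congr ((expR _ + expR _) / 2); ring.
Qed.

Lemma sign_lr_ge0 z t : 0 <= sign_lr z t.
Proof. by rewrite mulr_ge0 ?expR_ge0// ltW// cosh_gt0. Qed.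

Lemma measurable_sign_lr z : measurable_fun setT (sign_lr z).
Proof.
rewrite (_ : sign_lr z = fun t => (expR (z * t - z ^+ 2 / 2) + expR (- z * t - (- z) ^+ 2 / 2)) / 2); last first.
  by apply/funext => t; exact: sign_lrE.
have h (a b : R) : measurable_fun setT (fun t : R => expR (a * t - b)).
  apply: measurableT_comp => //.
  by apply: measurable_funB => //; exact: measurable_funM.
by apply: measurable_funM => //; apply: measurable_funD.
Qed.

Lemma sign_lr_shift (z : R) (G : R -> R) : measurable_fun setT G -> (forall t, 0 <= G t) ->
  (\int[N]_t (G t * sign_lr z t)%:E = \int[N]_t ((G (t + z) + G (t - z)) / 2)%:E)%E.
Proof.
move=> mG G0.
have mE (b : R) : measurable_fun setT (fun t : R => (G t * expR (b * t - b ^+ 2 / 2))%:E).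
  apply/measurable_EFinP; apply: measurable_funM => //.
  apply: measurableT_comp => //.
  by apply: measurable_funB => //; exact: measurable_funM.
have mS (b : R) : measurable_fun setT (fun t : R => (G (t + b))%:E).
  by apply/measurable_EFinP; apply: (measurableT_comp mG); exact: measurable_funD.
have half (f1 f2 : R -> R) : measurable_fun setT (fun t : R => (f1 t)%:E) ->
    measurable_fun setT (fun t : R => (f2 t)%:E) -> (forall t, 0 <= f1 t) -> (forall t, 0 <= f2 t) ->
    (\int[N]_t ((f1 t + f2 t) / 2)%:E = 2^-1%:E * (\int[N]_t (f1 t)%:E + \int[N]_t (f2 t)%:E))%E.
  move=> m1 m2 p1 p2; rewrite -ge0_integralD//; last 2 first.
  - by move=> t _; rewrite lee_fin.
  - by move=> t _; rewrite lee_fin.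
  rewrite -ge0_integralZl//.
  - by apply: eq_integral => t _; rewrite -EFinD -EFinM mulrC.
  - exact: emeasurable_funD.
  - by move=> t _; rewrite -EFinD lee_fin addr_ge0.
rewrite half//; under eq_integral do rewrite sign_lrE mulrA mulrDr.
rewrite half//; last 2 first.
- by move=> t; rewrite mulr_ge0// expR_ge0.
- by move=> t; rewrite mulr_ge0// expR_ge0.
have cm b := @cameron_martin R b (EFin \o G).
have mEG : measurable_fun setT (EFin \o G) by exact/measurable_EFinP.
have EG0 t : (0 <= (EFin \o G) t)%E by rewrite lee_fin.
congr (_ * (_ + _))%E.
- by have := cm z mEG EG0 => /= ->; apply: eq_integral => t _; rewrite EFinM.
- by have := cm (- z) mEG EG0 => /= ->; apply: eq_integral => t _; rewrite EFinM.
Qed.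

Definition sign_prior_lr (z : nat -> R) (n : nat) (y : nat -> R) : R :=
  \prod_(k < n) sign_lr (z k) (y k).

Lemma sign_prior_lr_ge0 z n y : 0 <= sign_prior_lr z n y.
Proof. by apply: prodr_ge0 => k _; exact: sign_lr_ge0. Qed.

Lemma measurable_sign_prior_lr z n :
  measurable_fun setT (fun y : T => sign_prior_lr z n y).
Proof.
elim: n => [|n IH].
  rewrite (_ : (fun y : T => _) = cst 1) ?funeqE// => y.
  by rewrite /sign_prior_lr big_ord0.
rewrite (_ : (fun y : T => _) = fun y : T => sign_prior_lr z n y * sign_lr (z n) (y n)).
  apply: measurable_funM => //.
  exact: (measurableT_comp (measurable_sign_lr (z n)) (measurable_coord n)).
by apply/funext => y; rewrite /sign_prior_lr big_ord_recr.
Qed.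

Variable mu : probability T R.
Hypothesis mu_gauss : standard_gaussian mu.

(* One coordinate of the prior is averaged at a time, by Cameron-Martin. *)
Lemma sign_prior_bound (eps : R) (z : nat -> R) (B : R) : 0 < eps ->
  forall (n : nat) (h : T -> R), measurable_fun setT h -> (forall y, 0 <= h y) ->
  (forall eta : nat -> R, (forall k, (k < n)%N -> eta k = eps * z k \/ eta k = - (eps * z k)) ->
     (forall k, (n <= k)%N -> eta k = 0) ->
     (\int[mu]_y (h (obs eps eta y))%:E <= B%:E)%E) ->
  (\int[mu]_y (h (obs eps (fun=> 0) y) * sign_prior_lr z n y)%:E <= B%:E)%E.
Proof.
move=> eps0; elim=> [|n IH] h mh h0 hB.
  under eq_integral do rewrite /sign_prior_lr big_ord0 mulr1.
  by apply: hB.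
pose sh (a : R) (y : nat -> R) : nat -> R := upd y n (y n + a).
have msh a : measurable_fun setT (fun y : T => sh a y : T).
  apply: measurable_to_seq => k; rewrite /sh /upd; case: eqP => [_|_].
    by apply: measurable_funD => //; exact: measurable_coord.
  exact: measurable_coord.
pose a := eps * z n.
(* Average of [h] over the two signs of coordinate [n]; the induction hypothesis is applied to
   it. *)
pose h' (y : T) := (h (sh a y) + h (sh (- a) y)) / 2.
have mhsh b : measurable_fun setT (fun y : T => h (sh b y)) by exact: (measurableT_comp mh (msh b)).
have mh' : measurable_fun setT h'.
  by apply: measurable_funM => //; apply: measurable_funD.
have h'0 y : 0 <= h' y by rewrite divr_ge0// addr_ge0.
have IHh' : (\int[mu]_y (h' (obs eps (fun=> 0) y) * sign_prior_lr z n y)%:E <= B%:E)%E.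
  apply: IH => // eta etan eta0.
  have bnd b : b = a \/ b = - a -> (\int[mu]_y (h (sh b (obs eps eta y)))%:E <= B%:E)%E.
    move=> bE; have -> : (\int[mu]_y (h (sh b (obs eps eta y)))%:E =
       \int[mu]_y (h (obs eps (upd eta n b) y))%:E)%E.
      apply: eq_integral => y _; congr (h _)%:E; apply/funext => k.
      rewrite /sh /obs /upd; case: eqP => // ->.
      by rewrite eta0// add0r addrC.
    apply: hB => k; rewrite /upd.
      rewrite ltnS leq_eqVlt; case: eqP => [-> _|_ /= kn]; first exact: bE.
      exact: etan.
    by move=> nk; rewrite gtn_eqF// eta0// ltnW.
  have mhb b : measurable_fun setT (fun y : T => (h (sh b (obs eps eta y)))%:E).
    apply/measurable_EFinP.
    exact: (measurableT_comp (mhsh b) (measurable_obs eps eta)).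
  rewrite (_ : (\int[mu]_y _)%E = (2^-1%:E * \int[mu]_y ((h (sh a (obs eps eta y)))%:E +
      (h (sh (- a) (obs eps eta y)))%:E))%E); last first.
    rewrite -ge0_integralZl//.
    - by apply: eq_integral => y _; rewrite -EFinD -EFinM mulrC.
    - exact: emeasurable_funD.
    - by move=> y _; rewrite -EFinD lee_fin addr_ge0.
  rewrite ge0_integralD//; last 2 first.
  - by move=> y _; rewrite lee_fin.
  - by move=> y _; rewrite lee_fin.
  have -> : B = 2^-1 * (B + B) by field.
  by rewrite EFinM lee_pmul2l// EFinD; apply: leeD; apply: bnd; [left|right].
move: IHh'; apply: le_trans; rewrite le_eqVlt; apply/orP; left; apply/eqP.
have mprod (g : T -> R) m : measurable_fun setT g ->
    measurable_fun setT (fun y : T => (g (obs eps (fun=> 0) y) * sign_prior_lr z m y)%:E).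
  move=> mg; apply/measurable_EFinP; apply: measurable_funM.
    exact: (measurableT_comp mg (measurable_obs eps _)).
  exact: measurable_sign_prior_lr.
rewrite (mu_gauss n (mprod h n.+1 mh)); last first.
  by move=> y; rewrite lee_fin mulr_ge0// sign_prior_lr_ge0.
rewrite (mu_gauss n (mprod h' n mh')); last first.
  by move=> y; rewrite lee_fin mulr_ge0// sign_prior_lr_ge0.
apply: eq_integral => y _.
have lrn t : sign_prior_lr z n (upd y n t) = sign_prior_lr z n y.
  by apply: eq_bigr => k _; rewrite upd_lt.
pose G t := h (obs eps (fun=> 0) (upd y n t)) * sign_prior_lr z n y.
have mG : measurable_fun setT G.
  apply: measurable_funM => //; apply: (measurableT_comp mh).
  apply: (measurableT_comp (measurable_obs eps _)).
  exact: (measurableT_comp (measurable_upd n) (pair2_measurable (y : T))).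
have G0 t : 0 <= G t by rewrite mulr_ge0// sign_prior_lr_ge0.
transitivity (\int[N]_t (G t * sign_lr (z n) t)%:E)%E.
  apply: eq_integral => t _; congr _%:E; rewrite /G -mulrA; congr (_ * _).
  rewrite /sign_prior_lr big_ord_recr/= upd_eq; congr (_ * _).
  by apply: eq_bigr => k _; rewrite upd_lt.
rewrite sign_lr_shift//; apply: eq_integral => t _; congr _%:E.
rewrite lrn /G /h' mulrAC -mulrDl; congr (_ * _ / 2).
(* A shift [b] of the observation is a shift [b / eps] of the noise; for [b = eps * z n] this is the
   shift [z n] of the likelihood ratio. *)
have shE b : sh b (obs eps (fun=> 0) (upd y n t)) = obs eps (fun=> 0) (upd y n (t + b / eps)).
  apply/funext => k; rewrite /sh /obs /upd eqxx; case: eqP => // _.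
  by rewrite !add0r; field; rewrite gt_eqF.
rewrite !shE /a; congr (h (obs _ _ (upd _ _ _)) + h (obs _ _ (upd _ _ _))); field.
- by rewrite gt_eqF.
- by rewrite gt_eqF.
Qed.
End bayes.

(** * Lower bound on the weighted risk of any test *)

Section lower.
Context {R : realType}.
Local Notation T := (g_sigma_algebraType (@cylinders R)).
Local Notation N := (@normal_prob R 0 1).
Local Notation intgN f := (N.-integrable setT (EFin \o f)).

Definition sumsq (n : nat) (v : nat -> R) : R := \sum_(k < n) v k ^+ 2.
Definition wt (n : nat) (v : nat -> R) (k : nat) : R := v k / Num.sqrt (2 * sumsq n v).
(* The value [u_eps] of the extreme problem, a signal-to-noise ratio. *)
Definition snr (n : nat) (v : nat -> R) (eps : R) : R :=
  Num.sqrt (2 * sumsq n v) / (2 * eps ^+ 2).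

Lemma sum_wt2 n v : 0 < sumsq n v -> \sum_(k < n) wt n v k ^+ 2 = 1 / 2.
Proof.
move=> Q0; rewrite /wt.
under eq_bigr do rewrite exprMn exprVn sqr_sqrtr ?mulr_ge0 ?ltW//.
by rewrite -mulr_suml -/(sumsq n v); field; rewrite gt_eqF.
Qed.

(** With [z^2 = v / eps^2] this reads [z^2 / 2 = u * w]: the quadratic exponents of the sign prior
    are [u] times the weights of the statistic. *)
Lemma snr_wt n v eps k : 0 < sumsq n v -> 0 < eps ->
  snr n v eps * wt n v k = v k / eps ^+ 2 / 2.
Proof.
move=> Q0 e0; rewrite /snr /wt.
have s0 : Num.sqrt (2 * sumsq n v) != 0 by rewrite gt_eqF// sqrtr_gt0 mulr_gt0.
by field; rewrite s0 gt_eqF.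
Qed.

Lemma integrable_quartic_sq : intgN (fun t => (t ^+ 4 - 3) ^+ 2).
Proof.
have -> : (fun t : R => (t ^+ 4 - 3) ^+ 2) = fun t => t ^+ 8 - (6 * t ^+ 4 - 9).
  by apply/funext => t; ring.
apply: integrableBR; first exact: integrableX_normal.
by apply: integrableBR; [apply: integrableZR; exact: integrableX_normal|exact: integrable_cstR].
Qed.

(** The map [x -> min (c, exp x)] is increasing with slope at most [c], and [Z <= d + Z^2 / d]; so
    only the second moment of [Z] will matter. *)
Lemma trunc_lr_shift (c a Z d : R) : 0 < c -> 0 < d ->
  Num.min c (expR a) <= Num.min c (expR (a - Z)) + c * d + c / d * Z ^+ 2.
Proof.
move=> c0 d0.
have m0 : 0 < Num.min c (expR a) by rewrite lt_min c0 expR_gt0.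
have mc : Num.min c (expR a) <= c by rewrite ge_min lexx.
have Zd : Z <= d + Z ^+ 2 / d.
  rewrite -lerBlDl ler_pdivlMr//; have := sqr_ge0 (Z - d / 2); nra.
have [Z0|Z0] := leP Z 0.
  have h : Num.min c (expR a) <= Num.min c (expR (a - Z)).
    by rewrite le_min ge_min lexx/= ge_min ler_expR; apply/orP; right; lra.
  have q1 : 0 <= c * d by rewrite mulr_ge0 ?ltW.
  have q2 : 0 <= c / d * Z ^+ 2 by rewrite mulr_ge0 ?sqr_ge0// divr_ge0 ?ltW.
  lra.
have h : Num.min c (expR a) * (1 - Z) <= Num.min c (expR (a - Z)).
  have e1 : 1 - Z <= expR (- Z) by have := expR_ge1Dx (- Z).
  rewrite le_min; apply/andP; split.
    apply: (@le_trans _ _ (Num.min c (expR a) * 1)); last by rewrite mulr1.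
    by rewrite ler_wpM2l ?(ltW m0)//; lra.
  rewrite expRD; apply: (@le_trans _ _ (Num.min c (expR a) * expR (- Z))).
    by rewrite ler_wpM2l// ltW.
  by rewrite ler_wpM2r ?expR_ge0// ge_min lexx orbT.
have h2 : Num.min c (expR a) * Z <= c * d + c / d * Z ^+ 2.
  have -> : c * d + c / d * Z ^+ 2 = c * (d + Z ^+ 2 / d) by ring.
  by apply: ler_pM => //; exact: ltW.
by move: h; rewrite mulrBr mulr1; lra.
Qed.

Lemma sign_lr_lower (z : nat -> R) n (y : nat -> R) :
  expR (\sum_(k < n) (z k ^+ 2 / 2 * (y k ^+ 2 - 1) - z k ^+ 4 / 12 * y k ^+ 4)) <=
  sign_prior_lr z n y.
Proof.
rewrite expR_sum /sign_prior_lr; apply: ler_prod => k _.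
rewrite expR_ge0/= /sign_lr.
have -> : z k ^+ 2 / 2 * (y k ^+ 2 - 1) - z k ^+ 4 / 12 * y k ^+ 4 =
  - (z k ^+ 2 / 2) + ((z k * y k) ^+ 2 / 2 - (z k * y k) ^+ 4 / 12) by field.
by rewrite expRD ler_wpM2l ?expR_ge0// cosh_ge.
Qed.

(** Pointwise [c psi + (1 - psi) L >= min (c, L)], and the likelihood ratio [L] of the sign prior is
    at least [exp (u X - u^2 / 2 - Z)] with [X] the statistic and [Z] negligible. [B] bounds the
    second error at each point of the prior, hence on average; [U] and [K] keep [c] bounded. *)
Lemma bayes_lower (U K e : R) : 0 < e -> exists kap : R, 0 < kap /\
  forall mu : probability T R, standard_gaussian mu ->
  forall (n : nat) (v : nat -> R) (eps : R), 0 < eps -> (forall k, 0 <= v k) ->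
  0 < sumsq n v -> (forall k, (k < n)%N -> wt n v k <= kap) -> snr n v eps <= U ->
  forall H, H <= K -> forall psi : T -> R, measurable_fun setT psi ->
  (forall y, 0 <= psi y <= 1) -> forall B : R,
  (forall eta : nat -> R, (forall k, (k < n)%N -> eta k ^+ 2 = v k) ->
     (forall k, (n <= k)%N -> eta k = 0) ->
     (\int[mu]_y (1 - psi (obs eps eta y))%:E <= B%:E)%E) ->
  let u := snr n v eps in
  expR (u * H - u ^+ 2 / 2) * (1 - Phi H) + Phi (H - u) <=
  expR (u * H - u ^+ 2 / 2) * \int[mu]_y psi (obs eps (fun=> 0) y) + B + e.
Proof.
move=> e0.
pose C0 := expR (`|U| * `|K|).
have C0p : 0 < C0 by exact: expR_gt0.
pose V := \int[N]_t ((t ^+ 4 - 3) ^+ 2).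
have V0 : 0 <= V by apply: Rintegral_ge0 => t _; exact: sqr_ge0.
(* Used twice, as the error of the central limit theorem and as the trade-off in [trunc_lr_shift];
   each use costs [c * d <= e / 4]. *)
pose d := e / (4 * C0).
have d0 : 0 < d by rewrite divr_gt0// mulr_gt0.
have [kap1 [kap10 clt]] := @chi2_clt R d d0.
pose D := C0 / d * V * U ^+ 4.
have U4 : 0 <= U ^+ 4 by rewrite (_ : U ^+ 4 = (U ^+ 2) ^+ 2) ?sqr_ge0//; ring.
have D0 : 0 <= D by rewrite /D mulr_ge0// mulr_ge0// divr_ge0// ltW.
(* The first bound serves the central limit theorem; the other two give [w^2 <= e / (D + 1)], which
   controls the variance of [Z]. [D] collects the constants in front of that variance. *)
pose kap := Num.min kap1 (Num.min 1 (e / (D + 1))).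
have kap0 : 0 < kap by rewrite !lt_min kap10 ltr01 divr_gt0//; lra.
exists kap; split => // mu mug n v eps eps0 v0 Q0 wkap uU H HK psi mpsi psi01 B hB.
set u := snr n v eps; rewrite /=.
set c := expR _.
have c0 : 0 < c by exact: expR_gt0.
have s0 : 0 < Num.sqrt (2 * sumsq n v) by rewrite sqrtr_gt0 mulr_gt0.
have u0 : 0 < u by rewrite divr_gt0// mulr_gt0// exprn_gt0.
have cC : c <= C0.
  rewrite ler_expR; have h1 := ler_norm K; have h2 := ler_norm U.
  have : u * H <= `|U| * `|K|.
    apply: (@le_trans _ _ (u * `|K|)); first by rewrite ler_wpM2l ?(ltW u0)//; lra.
    by rewrite ler_wpM2r// (le_trans uU).
  by have := sqr_ge0 u; lra.
pose w := wt n v.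
have w0 k : 0 <= w k by rewrite divr_ge0// ltW.
have sw2 : \sum_(k < n) w k ^+ 2 = 1 / 2 by exact: sum_wt2.
have wk1 k : (k < n)%N -> w k <= kap1.
  by move=> kn; apply: (le_trans (wkap k kn)); rewrite ge_min lexx.
have wk2 k : (k < n)%N -> w k <= 1.
  by move=> kn; apply: (le_trans (wkap k kn)); rewrite !ge_min lexx !orbT.
have wk3 k : (k < n)%N -> w k <= e / (D + 1).
  by move=> kn; apply: (le_trans (wkap k kn)); rewrite !ge_min lexx !orbT.
have cltw := clt mu mug n w w0 wk1 sw2.
pose z k := Num.sqrt (v k) / eps.
have epsz k : eps * z k = Num.sqrt (v k) by rewrite /z mulrC divfK// gt_eqF.
have z2 k : z k ^+ 2 = 2 * u * w k.
  rewrite -mulrA snr_wt// /z exprMn exprVn sqr_sqrtr//; field.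
  by rewrite gt_eqF.
pose X (y : T) := chi2_stat n w y.
(* The fourth-order terms of the exponent, centred by [E y^4 = 3]. Their mean [\sum z^4 / 4] is
   exactly the [u^2 / 2] of a Gaussian likelihood ratio. *)
pose Z (y : T) := \sum_(k < n) (z k ^+ 4 / 12) * (y k ^+ 4 - 3).
have mX : measurable_fun setT X by exact: measurable_chi2_stat.
have mg4 : measurable_fun setT (fun t : R => t ^+ 4 - 3).
  by apply: measurable_funB => //; exact: measurable_funX.
have mZ : measurable_fun setT Z.
  by apply: (@measurable_coord_sum R n (fun j t => z j ^+ 4 / 12 * (t ^+ 4 - 3)) id) => j; exact: measurable_funM.
have z4 k : z k ^+ 4 = 4 * u ^+ 2 * w k ^+ 2.
  by rewrite (_ : z k ^+ 4 = (z k ^+ 2) ^+ 2); [rewrite z2; ring|ring].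
have lrX y : expR (u * X y - u ^+ 2 / 2 - Z y) <= sign_prior_lr z n y.
  apply: le_trans (sign_lr_lower z n y); rewrite ler_expR le_eqVlt; apply/orP; left; apply/eqP.
  have -> : u ^+ 2 / 2 = \sum_(k < n) z k ^+ 4 / 4.
    under eq_bigr do rewrite z4.
    transitivity (u ^+ 2 * \sum_(k < n) w k ^+ 2); first by rewrite sw2; field.
    by rewrite mulr_sumr; apply: eq_bigr => k _; field.
  rewrite /X /chi2_stat mulr_sumr -!sumrB; apply: eq_bigr => k _.
  by rewrite z2 z4; field.
have EZ : (\int[mu]_y ((Z y) ^+ 2)%:E = (V * \sum_(j < n) (z j ^+ 4 / 12) ^+ 2)%:E)%E.
  have ig4 : intgN (fun t => t ^+ 4 - 3).
    by apply: integrableBR; [exact: integrableX_normal|exact: integrable_cstR].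
  have mean4 : \int[N]_t (t ^+ 4 - 3) = 0.
    have [_ _ _ m4] := @normal_moments R.
    rewrite (RintegralBR (@integrableX_normal R 4) (integrable_cstR N 3)).
    by rewrite Rintegral_cstR m4 subrr.
  exact: (variance_sum mug n (fun k => z k ^+ 4 / 12) mg4 ig4 integrable_quartic_sq mean4 erefl).
have EZle : V * \sum_(j < n) (z j ^+ 4 / 12) ^+ 2 <= V * (U ^+ 4 * (e / (D + 1)) / 18).
  rewrite ler_wpM2l//.
  apply: (@le_trans _ _ (\sum_(j < n) (U ^+ 4 * (e / (D + 1)) / 9) * w j ^+ 2)).
    apply: ler_sum => j _; rewrite z4.
    have -> : (4 * u ^+ 2 * w j ^+ 2 / 12) ^+ 2 = u ^+ 4 * (w j * w j) / 9 * w j ^+ 2 by field.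
    rewrite ler_wpM2r ?sqr_ge0// ler_wpM2r ?invr_ge0//.
    apply: ler_pM; rewrite ?exprn_ge0 ?(ltW u0)// ?mulr_ge0//.
      by rewrite ler_pXn2r// nnegrE ?(ltW u0)// (le_trans (ltW u0)).
    rewrite -[leRHS]mul1r; apply: ler_pM => //; [exact: wk2|exact: wk3].
  by rewrite -mulr_sumr sw2 le_eqVlt; apply/orP; left; apply/eqP; field; lra.
have mL := @measurable_sign_prior_lr R z n.
have L0 := @sign_prior_lr_ge0 R z n.
have mpo eta : measurable_fun setT (fun y : T => psi (obs eps eta y)).
  exact: (measurableT_comp mpsi (measurable_obs eps eta)).
have lrB : (\int[mu]_y ((1 - psi (obs eps (fun=> 0%R) y)) * sign_prior_lr z n y)%:E <= B%:E)%E.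
  apply: (sign_prior_bound mug eps0 (n := n) (h := fun y => 1 - psi y)).
  - exact: measurable_funB.
  - by move=> y; have /andP[] := psi01 y; lra.
  - move=> eta etan eta0; apply: hB => // k kn.
    by case: (etan k kn) => ->; rewrite ?sqrrN epsz sqr_sqrtr.
set P0 := fun y : T => psi (obs eps (fun=> 0) y).
have mP0 : measurable_fun setT P0 by exact: mpo.
have P001 y : 0 <= P0 y <= 1 by exact: psi01.
have pw y : trunc_lr c u (X y) <= c * P0 y + (1 - P0 y) * sign_prior_lr z n y + (c * d + c / d * Z y ^+ 2).
  have := @trunc_lr_shift c (u * X y - u ^+ 2 / 2) (Z y) d c0 d0.
  move=> /le_trans; apply; rewrite -addrA lerD2r.
  have [h|h] := leP c (expR (u * X y - u ^+ 2 / 2 - Z y)).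
    by have := le_trans h (lrX y); have /andP[] := P001 y; nra.
  by have := lrX y; have /andP[] := P001 y; nra.
have EP0 : (\int[mu]_y (c * P0 y)%:E = (c * \int[mu]_y P0 y)%:E)%E.
  rewrite RintegralE; last by apply: integrableZR; exact: integrable_01.
  by rewrite RintegralZ//; exact: integrable_01.
have mtr : measurable_fun setT (fun y => trunc_lr c u (X y)).
  exact: (measurableT_comp (measurable_trunc_lr c u) mX).
have tr0 y : 0 <= trunc_lr c u y by rewrite le_min (ltW c0) expR_ge0.
have itr : mu.-integrable setT (EFin \o (fun y => trunc_lr c u (X y))).
  by apply: (integrable_bnd mu mtr (B := c)) => y; rewrite ger0_norm// ge_min lexx.
have key : \int[mu]_y trunc_lr c u (X y) <= c * (\int[mu]_y P0 y) + B + (c * d + c / d * (V * \sum_(j < n) (z j ^+ 4 / 12) ^+ 2)).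
  rewrite -lee_fin -RintegralE//.
  have m1 : measurable_fun setT (fun y : T => (c * P0 y)%:E).
    by apply/measurable_EFinP; exact: measurable_funM.
  have m2 : measurable_fun setT (fun y : T => ((1 - P0 y) * sign_prior_lr z n y)%:E).
    by apply/measurable_EFinP; apply: measurable_funM => //; exact: measurable_funB.
  have m3 : measurable_fun setT (fun y : T => (c / d * Z y ^+ 2)%:E).
    by apply/measurable_EFinP; apply: measurable_funM => //; exact: measurable_funX.
  have p1 y : (0 <= (c * P0 y)%:E)%E by rewrite lee_fin mulr_ge0 ?(ltW c0)//; have /andP[] := P001 y.
  have p2 y : (0 <= ((1 - P0 y) * sign_prior_lr z n y)%:E)%E.
    by rewrite lee_fin mulr_ge0// subr_ge0; have /andP[] := P001 y.
  have p3 y : (0 <= (c / d * Z y ^+ 2)%:E)%E by rewrite lee_fin mulr_ge0 ?sqr_ge0// divr_ge0 ?ltW.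
  have p4 : (0 <= (c * d)%:E)%E by rewrite lee_fin mulr_ge0 ?ltW.
  apply: (@le_trans _ _ (\int[mu]_y (((c * P0 y)%:E + ((1 - P0 y) * sign_prior_lr z n y)%:E) + ((c * d)%:E + (c / d * Z y ^+ 2)%:E)))%E).
    apply: ge0_le_integral => //.
    - by move=> y _; rewrite lee_fin.
    - exact/measurable_EFinP.
    - by apply: emeasurable_funD; apply: emeasurable_funD.
    - by move=> y _; rewrite -!EFinD lee_fin.
  rewrite ge0_integralD//; last 4 first.
  - by move=> y _; rewrite adde_ge0.
  - exact: emeasurable_funD.
  - by move=> y _; rewrite adde_ge0.
  - exact: emeasurable_funD.
  rewrite ge0_integralD// ge0_integralD//.
  rewrite EP0 (integral_prob_cst mu).
  have -> : (\int[mu]_y (c / d * Z y ^+ 2)%:E = (c / d * (V * \sum_(j < n) (z j ^+ 4 / 12) ^+ 2))%:E)%E.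
    under eq_integral do rewrite EFinM.
    rewrite ge0_integralZl//; first by rewrite EZ -EFinM.
    - by apply/measurable_EFinP; exact: measurable_funX.
    - by move=> y _; rewrite lee_fin sqr_ge0.
    - by rewrite lee_fin divr_ge0 ?ltW.
  rewrite !EFinD leeD2r// leeD2l//.
have close := trunc_lr_close mX u0 c0 (ltW d0) cltw.
rewrite trunc_lr_normal// in close.
have cd : c * d <= e / 4.
  have -> : e / 4 = C0 * d by rewrite /d; field; rewrite gt_eqF.
  by rewrite ler_wpM2r// ltW.
have cz : c / d * (V * \sum_(j < n) (z j ^+ 4 / 12) ^+ 2) <= e / 4.
  apply: (@le_trans _ _ (C0 / d * (V * (U ^+ 4 * (e / (D + 1)) / 18)))).
    have h1 : 0 <= c / d by rewrite divr_ge0 ?ltW.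
    apply: (le_trans (ler_wpM2l h1 EZle)); apply: ler_wpM2r.
      rewrite mulr_ge0// mulr_ge0// mulr_ge0//.
      by rewrite divr_ge0 ?(ltW e0)// addr_ge0.
    by rewrite ler_wpM2r// invr_ge0 ltW.
  have -> : C0 / d * (V * (U ^+ 4 * (e / (D + 1)) / 18)) = D / (D + 1) * e / 18.
    by move: (D + 1)^-1 => q; rewrite /D; ring.
  have : D / (D + 1) <= 1 by rewrite ler_pdivrMr; lra.
  nra.
move: close key cd cz; rewrite -/c -/P0.
move: (\int[mu]_y trunc_lr c u (X y)) (\int[mu]_y P0 y) => I1 I2.
move: (c / d * _) => I3.
lra.
Qed.
End lower.

(** * Errors of the quadratic test *)

Section upper.
Context {R : realType}.
Local Notation T := (g_sigma_algebraType (@cylinders R)).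

(** Used at [x = H - u]: thresholds [H <= K + u / 2] cover both a fixed [H] and [H = u / 2]. For
    [u <= U] the shift is at most [e]; for larger [u] the shifted point is still below [- X], where
    [Phi] is at most [e]. *)
Lemma Phi_shift (K e : R) : 0 < e -> exists kap : R, 0 < kap <= 1 /\
  forall u x : R, 0 <= u -> x <= K + - (u / 2) -> Phi (x + kap * (1 + u)) <= Phi x + e.
Proof.
move=> e0; have [X hX] := Phi_small e0.
pose U := 4 * (`|K| + 1 + `|X|).
have U0 : 0 <= U by rewrite mulr_ge0// addr_ge0// addr_ge0.
have U1 : 0 < 1 + U by lra.
pose kap := Num.min (1 / 4) (e / (1 + U)).
have k4 : kap <= 1 / 4 by rewrite ge_min lexx.
have kU : kap * (1 + U) <= e by rewrite -ler_pdivlMr// ge_min lexx orbT.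
have k0 : 0 < kap.
  by have h := divr_gt0 e0 U1; rewrite lt_min h andbT; lra.
exists kap; split; first by rewrite k0/=; lra.
move=> u x u0 xK.
have [uU|Uu] := leP u U.
  have xx : x <= x + kap * (1 + u) by rewrite lerDl mulr_ge0 ?ltW//; lra.
  have := Phi_lipschitz xx; have : kap * (1 + u) <= kap * (1 + U) by rewrite ler_wpM2l ?(ltW k0)// lerD2l.
  lra.
have h : x + kap * (1 + u) <= - X.
  have h1 := ler_norm K; have h2 := ler_norm X; have h3 := normr_ge0 X.
  have : kap * (1 + u) <= 1 / 4 * (1 + u) by rewrite ler_wpM2r//; lra.
  by rewrite /U in Uu *; lra.
by have := hX _ h; have := Phi_ge0 x; lra.
Qed.

Definition quad (n : nat) (v : nat -> R) (eps : R) (y : nat -> R) : R :=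
  \sum_(k < n) wt n v k * ((y k / eps) ^+ 2 - 1).

Lemma quad_obs n v eps eta y : 0 < eps -> quad n v eps (obs eps eta y) =
  chi2_stat n (wt n v) y + \sum_(k < n) (2 * wt n v k * eta k / eps) * y k +
  \sum_(k < n) wt n v k * eta k ^+ 2 / eps ^+ 2.
Proof.
move=> e0; rewrite /quad /chi2_stat -!big_split/=; apply: eq_bigr => k _.
by rewrite /obs; field; rewrite gt_eqF.
Qed.

(* Under [eta] the statistic is chi2 + D + h with h >= u; the variance of D is small
   compared to (1 + h)^2, so the excess h - u absorbs D by Chebyshev. *)
Lemma quad_upper (K e : R) : 0 < e -> exists kap : R, 0 < kap /\
  forall mu : probability T R, standard_gaussian mu ->
  forall (n : nat) (v : nat -> R) (eps : R), 0 < eps -> (forall k, 0 <= v k) ->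
  0 < sumsq n v -> (forall k, (k < n)%N -> wt n v k <= kap) ->
  (forall H, `|\int[mu]_y ((quad n v eps (obs eps (fun=> 0) y) <= H)%R%:R) - Phi H| <= e) /\
  forall eta : nat -> R, sumsq n v <= \sum_(k < n) v k * eta k ^+ 2 ->
  forall H, H <= K + snr n v eps / 2 ->
  \int[mu]_y ((quad n v eps (obs eps eta y) <= H)%R%:R) <= Phi (H - snr n v eps) + e.
Proof.
move=> e0.
have e3 : 0 < e / 3 by lra.
have [q [/andP[q0 q1] hq]] := Phi_shift K e3.
have [kap1 [kap10 clt]] := @chi2_clt R (e / 3) e3.
(* The second bound makes four times a weight at most [e q^2 / 3], so that the variance of [D] is at
   most [e q^2 / 3 * h]. *)
pose kap := Num.min kap1 (e * q ^+ 2 / 12).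
have q2 : 0 < q ^+ 2 by rewrite exprn_gt0.
have kap0 : 0 < kap by rewrite lt_min kap10/= divr_gt0// mulr_gt0.
exists kap; split => // mu mug n v eps eps0 v0 Q0 wkap.
have s0 : 0 < Num.sqrt (2 * sumsq n v) by rewrite sqrtr_gt0 mulr_gt0.
have s2 : Num.sqrt (2 * sumsq n v) ^+ 2 = 2 * sumsq n v by rewrite sqr_sqrtr// mulr_ge0// ltW.
set u := snr n v eps.
have u0 : 0 < u by rewrite divr_gt0// mulr_gt0// exprn_gt0.
have w0 k : 0 <= wt n v k by rewrite divr_ge0// ltW.
have wk1 k : (k < n)%N -> wt n v k <= kap1.
  by move=> kn; apply: (le_trans (wkap k kn)); rewrite ge_min lexx.
have wk2 k : (k < n)%N -> wt n v k <= e * q ^+ 2 / 12.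
  by move=> kn; apply: (le_trans (wkap k kn)); rewrite ge_min lexx orbT.
have cltw := clt mu mug n (wt n v) w0 wk1 (sum_wt2 Q0).
have mX := @measurable_chi2_stat R n (wt n v).
split.
  move=> H; rewrite (_ : \int[mu]_y _ = \int[mu]_y ((chi2_stat n (wt n v) y <= H)%R%:R)).
    by apply: (le_trans (cltw H)); lra.
  apply: eq_Rintegral => y _; rewrite quad_obs//.
  rewrite [X in _ + X + _]big1 ?[X in _ + X]big1 ?addr0// => k _.
    by rewrite expr0n/= mulr0 mul0r.
  by rewrite mulr0 mul0r mul0r.
move=> eta heta H HK.
pose h := \sum_(k < n) wt n v k * eta k ^+ 2 / eps ^+ 2.
pose D (y : T) := \sum_(k < n) (2 * wt n v k * eta k / eps) * y k.
have hE : h = (\sum_(k < n) v k * eta k ^+ 2) / (Num.sqrt (2 * sumsq n v) * eps ^+ 2).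
  rewrite /h /wt mulr_suml; apply: eq_bigr => k _; field.
  by rewrite !gt_eqF.
have uh : u <= h.
  rewrite hE /u /snr ler_pdivlMr ?mulr_gt0 ?exprn_gt0//.
  apply: le_trans heta; rewrite le_eqVlt; apply/orP; left; apply/eqP.
  transitivity (Num.sqrt (2 * sumsq n v) ^+ 2 / 2); last by rewrite s2; field.
  by field; rewrite gt_eqF.
have h0 : 0 < h by exact: lt_le_trans uh.
(* As [h <= (1 + h)^2], Chebyshev with this width gives [e / 3] whatever the size of [h]. *)
pose d := q * (1 + h).
have d0 : 0 < d by rewrite mulr_gt0//; lra.
have mD : measurable_fun setT D.
  by apply: (@measurable_coord_sum R n (fun j t => (2 * wt n v j * eta j / eps) * t) id) => j; exact: measurable_funM.
have ED : (\int[mu]_y ((D y) ^+ 2)%:E = (1 * \sum_(k < n) (2 * wt n v k * eta k / eps) ^+ 2)%:E)%E.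
  have [m1 m2 _ _] := @normal_moments R.
  have mid : measurable_fun setT (fun t : R => t) by exact: measurable_id.
  exact: (variance_sum mug n (fun k => 2 * wt n v k * eta k / eps) mid
    (@integrableX_normal R 1) (@integrableX_normal R 2) m1 m2).
have EDle : \sum_(k < n) (2 * wt n v k * eta k / eps) ^+ 2 <= e * q ^+ 2 / 3 * h.
  rewrite /h mulr_sumr; apply: ler_sum => k _.
  have -> : (2 * wt n v k * eta k / eps) ^+ 2 = 4 * wt n v k * (wt n v k * eta k ^+ 2 / eps ^+ 2).
    by field; rewrite gt_eqF.
  have p0 : 0 <= wt n v k * eta k ^+ 2 / eps ^+ 2.
    by apply: divr_ge0; [apply: mulr_ge0 => //; exact: sqr_ge0|exact: sqr_ge0].
  by rewrite ler_wpM2r//; have := wk2 k (ltn_ord k); lra.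
have mq : measurable_fun setT (fun y : T => quad n v eps (obs eps eta y)).
  rewrite (_ : (fun y : T => _) = fun y : T => chi2_stat n (wt n v) y + D y + h).
    by apply: measurable_funD => //; exact: measurable_funD.
  by apply/funext => y; rewrite quad_obs.
pose c := H - h + d.
have pw (y : T) : (quad n v eps (obs eps eta y) <= H)%R%:R <=
    (chi2_stat n (wt n v) y <= c)%R%:R + d ^- 2 * D y ^+ 2 :> R.
  rewrite quad_obs// -/(D y) -/h.
  have p0 : 0 <= d ^- 2 * D y ^+ 2 by rewrite mulr_ge0 ?sqr_ge0// invr_ge0 sqr_ge0.
  have [t1|t1] := leP (chi2_stat n (wt n v) y) c => /=.
    by case: (_ <= H) => /=; rewrite ?lerDl// addr_ge0.
  rewrite add0r; have [t2|t2] := leP (chi2_stat n (wt n v) y + D y + h) H => //=.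
  have Dd : D y <= - d by move: t1 t2; rewrite /c; lra.
  rewrite mulrC ler_pdivlMr ?exprn_gt0// mul1r -[leRHS]sqrrN ler_pXn2r ?nnegrE ?(ltW d0)//; last by lra.
  by lra.
have ile (f : T -> R) a : measurable_fun setT f -> measurable_fun setT (fun y : T => (f y <= a)%R%:R : R).
  by move=> mf; exact: (measurableT_comp (measurable_leind a) mf).
have i1 := integrable_01 mu (ile _ H mq) (fun y => leind01 H _).
have i2 := integrable_01 mu (ile _ c mX) (fun y => leind01 c _).
have key : \int[mu]_y ((quad n v eps (obs eps eta y) <= H)%R%:R) <=
    \int[mu]_y ((chi2_stat n (wt n v) y <= c)%R%:R) + d ^- 2 * \sum_(k < n) (2 * wt n v k * eta k / eps) ^+ 2.
  rewrite -lee_fin EFinD -RintegralE// -RintegralE//.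
  have mD2 : measurable_fun setT (fun y : T => (d ^- 2 * D y ^+ 2)%:E).
    by apply/measurable_EFinP; apply: measurable_funM => //; exact: measurable_funX.
  have D20 (y : T) : (0 <= (d ^- 2 * D y ^+ 2)%:E)%E.
    by rewrite lee_fin mulr_ge0 ?sqr_ge0// invr_ge0 sqr_ge0.
  apply: (@le_trans _ _ (\int[mu]_y (((chi2_stat n (wt n v) y <= c)%R%:R)%:E + (d ^- 2 * D y ^+ 2)%:E))%E).
    apply: ge0_le_integral => //.
    - by apply/measurable_EFinP; exact: ile.
    - by apply: emeasurable_funD => //; apply/measurable_EFinP; exact: ile.
    - by move=> y _; rewrite -EFinD lee_fin.
  rewrite ge0_integralD//; last by apply/measurable_EFinP; exact: ile.
  rewrite leeD2l//; under eq_integral do rewrite EFinM.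
  rewrite ge0_integralZl//.
  - by rewrite ED -EFinM mul1r.
  - by apply/measurable_EFinP; exact: measurable_funX.
  - by move=> y _; rewrite lee_fin sqr_ge0.
  - by rewrite lee_fin invr_ge0 sqr_ge0.
have tail : d ^- 2 * \sum_(k < n) (2 * wt n v k * eta k / eps) ^+ 2 <= e / 3.
  rewrite mulrC ler_pdivrMr ?exprn_gt0//; apply: (le_trans EDle).
  have -> : e * q ^+ 2 / 3 * h = e / 3 * q ^+ 2 * h by ring.
  have eq0 : 0 <= e / 3 * q ^+ 2 by rewrite mulr_ge0 ?(ltW e3) ?(ltW q2).
  rewrite /d exprMn [leRHS]mulrA ler_wpM2l//.
  by move: (h) h0 => h' h0'; nra.
(* For [q <= 1], [- h + q (1 + h)] is nonincreasing in [h], so [h >= u] may be replaced by [u]. *)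
have cle : c <= (H - u) + q * (1 + u).
  rewrite /c /d; have : (1 - q) * u <= (1 - q) * h by rewrite ler_wpM2l//; lra.
  lra.
have sh : Phi ((H - u) + q * (1 + u)) <= Phi (H - u) + e / 3.
  by apply: hq; [exact: ltW|lra].
have mono := Phi_nd cle.
have := cltw c; rewrite ler_distlC => /andP[c1 c2].
move: key tail sh mono c1 c2.
move: (\int[mu]_y ((quad n v eps (obs eps eta y) <= H)%R%:R)) => I1.
move: (\int[mu]_y ((chi2_stat n (wt n v) y <= c)%R%:R)) => I2.
move: (d ^- 2 * _) => I3.
lra.
Qed.

End upper.

(** * Minimax errors for a least favourable sequence *)

Section finite_support.
Context {R : realType}.
Local Notation T := (g_sigma_algebraType (@cylinders R)).
Variables (n : nat) (v : nat -> R).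
Hypothesis vn : forall k, (n <= k)%N -> v k = 0.

Lemma series_finite (f : nat -> R) : (forall k, (n <= k)%N -> f k = 0) ->
  limn (series f) = \sum_(k < n) f k.
Proof.
move=> fn; apply: lim_near_cst => //; exists n => // m /= nm.
rewrite /series/= (big_cat_nat (leq0n n) nm)//= big_mkord [X in _ + X]big1_seq ?addr0// => k.
by rewrite mem_index_iota => /andP[_ /andP[/fn]].
Qed.

Lemma eseries_finite (f : nat -> R) : (forall k, (n <= k)%N -> f k = 0) ->
  (\sum_(k <oo) (f k)%:E)%E = (\sum_(k < n) f k)%:E.
Proof.
move=> fn; apply: lim_near_cst => //; exists n => // m /= nm.
rewrite sumEFin (big_cat_nat (leq0n n) nm)//= big_mkord [X in _ + X]big1_seq ?addr0// => k.
by rewrite mem_index_iota => /andP[_ /andP[/fn]].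
Qed.

Lemma weightsE k : weights v k = wt n v k.
Proof.
rewrite /weights /wt eseries_finite//= => j /vn ->.
by rewrite expr0n.
Qed.

Lemma quad_statE eps y : quad_stat v eps y = quad n v eps y.
Proof.
rewrite /quad_stat series_finite.
  by apply: eq_bigr => k _; rewrite weightsE.
by move=> k /vn vk; rewrite /weights vk !mul0r.
Qed.

Lemma quad_testE eps H y : quad_test v eps H y = 1 - (quad n v eps y <= H)%R%:R.
Proof.
by rewrite /quad_test quad_statE; case: leP => h /=; rewrite ?subrr ?subr0.
Qed.

Lemma measurable_quad eps : measurable_fun setT (quad n v eps : T -> R).
Proof.
rewrite /quad; apply: (@measurable_coord_sum R n (fun j t => wt n v j * ((t / eps) ^+ 2 - 1)) id).
move=> j; apply: measurable_funM => //; apply: measurable_funB => //.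
by apply: measurable_funX; exact: measurable_funM.
Qed.

Lemma is_test_quad eps H : is_test (quad_test v eps H).
Proof.
split=> [|y]; last by rewrite /quad_test; case: (_ < _); rewrite /= ?lexx ler01.
rewrite (_ : quad_test v eps H = fun y : T => 1 - (quad n v eps y <= H)%R%:R).
  apply: measurable_funB => //.
  exact: (measurableT_comp (measurable_leind H) (measurable_quad eps)).
by apply/funext => y; rewrite quad_testE.
Qed.

End finite_support.

(** * Errors of tests as integrals over the space of sequences *)

Section interface.
Context {R : realType}.
Local Notation T := (g_sigma_algebraType (@cylinders R)).
Context d (Omega : measurableType d) (P : probability Omega R) (xi : nat -> {RV P >-> R}).

Definition same_law (mu : probability T R) :=
  forall F : T -> \bar R, measurable_fun setT F -> (forall y, 0 <= F y)%E ->
      (\int[mu]_y F y = \int[P]_w F (fun k => xi k w))%E.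

Variables (mu : probability T R) (muxi : same_law mu).
Variables (eps : R) (Theta : set (nat -> R)).

Lemma integrable_test_obs eta (psi : T -> R) : is_test psi ->
  mu.-integrable setT (EFin \o (fun y : T => psi (obs eps eta y))).
Proof.
move=> [mp p01]; apply: integrable_01 => //.
exact: (measurableT_comp mp (measurable_obs eps eta)).
Qed.

Lemma model_expectationE eta psi : is_test psi ->
  model_expectation xi eps eta psi = \int[mu]_y psi (obs eps eta y).
Proof.
move=> [mp p01]; rewrite /model_expectation /Rintegral; congr fine.
rewrite muxi.
- by rewrite unlock.
- by apply/measurable_EFinP; exact: (measurableT_comp mp (measurable_obs eps eta)).
- by move=> y; rewrite lee_fin; case/andP: (p01 (obs eps eta y)).
Qed.

Lemma is_test_compl psi : is_test psi -> is_test (fun y => 1 - psi y : R).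
Proof.
move=> [mp p01]; split; first exact: measurable_funB.
by move=> y; have := p01 y; lra.
Qed.

Lemma model_expectation01 eta psi : is_test psi -> 0 <= model_expectation xi eps eta psi <= 1.
Proof.
move=> tp; rewrite model_expectationE//; case: tp => mp p01; apply: Rintegral_01 => //.
exact: (measurableT_comp mp (measurable_obs eps eta)).
Qed.

Lemma err2_ge psi eta : is_test psi -> Theta eta ->
  model_expectation xi eps eta (fun y => 1 - psi y) <= err2 xi eps Theta psi.
Proof.
move=> tp Te; apply: ub_le_sup; last by exists eta.
exists 1 => _ [eta' _ <-].
by have /andP[] := model_expectation01 eta' (is_test_compl tp).
Qed.

(** The [sup] of an empty set is a default value, so [Theta] has to be inhabited before a bound on
    the elements is of use. *)
Lemma err2_le psi B : Theta !=set0 ->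
  (forall eta, Theta eta -> model_expectation xi eps eta (fun y => 1 - psi y) <= B) ->
  err2 xi eps Theta psi <= B.
Proof.
move=> [eta Te] h; apply: ge_sup; first by exists (model_expectation xi eps eta (fun y => 1 - psi y)); exists eta.
by move=> _ [eta' /h ? <-].
Qed.

Lemma err2_ge0 psi : is_test psi -> Theta !=set0 -> 0 <= err2 xi eps Theta psi.
Proof.
move=> tp [eta Te]; apply: le_trans (err2_ge tp Te).
by have /andP[] := model_expectation01 eta (is_test_compl tp).
Qed.

Lemma err1_ge0 psi : is_test psi -> 0 <= err1 xi eps psi.
Proof. by move=> tp; have /andP[] := model_expectation01 (fun=> 0) tp. Qed.

End interface.

Section minimax_bounds.
Context {R : realType}.
Local Notation T := (g_sigma_algebraType (@cylinders R)).
Context d (Omega : measurableType d) (P : probability Omega R) (xi : nat -> {RV P >-> R}).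
Hypothesis iid : iid_std_normal xi.

(* What the extreme sequence v = eta^2 has to satisfy: Theta contains all its
   sign changes, and it is the least favourable one for the statistic it
   defines. *)
Record least_favourable (Theta : set (nat -> R)) (n : nat) (v : nat -> R) : Prop :=
  LeastFavourable {
  lf_ge0 : forall k, 0 <= v k ;
  lf_supp : forall k, (n <= k)%N -> v k = 0 ;
  lf_gt0 : 0 < sumsq n v ;
  lf_signs : forall eta, (forall k, eta k ^+ 2 = v k) -> Theta eta ;
  lf_min : forall eta, Theta eta -> sumsq n v <= \sum_(k < n) v k * eta k ^+ 2 }.

Lemma least_favourable_neq0 Theta n v : least_favourable Theta n v -> Theta !=set0.
Proof.
case=> v0 vn _ h _; exists (fun k => Num.sqrt (v k)).
by apply: h => k; rewrite sqr_sqrtr.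
Qed.

Lemma snr_ge0 n (v : nat -> R) eps : 0 <= snr n v eps.
Proof. by rewrite divr_ge0// mulr_ge0// sqr_ge0. Qed.

Lemma quad_errors (K e : R) : 0 < e -> exists kap : R, 0 < kap /\
  forall n v eps Theta, 0 < eps -> least_favourable Theta n v ->
  (forall k, (k < n)%N -> wt n v k <= kap) ->
  (forall H, `|err1 xi eps (quad_test v eps H) - (1 - Phi H)| <= e) /\
  forall H, H <= K + snr n v eps / 2 ->
    err2 xi eps Theta (quad_test v eps H) <= Phi (H - snr n v eps) + e.
Proof.
move=> e0; have [mu [mug muxi]] := iid_std_normal_law iid.
have [kap [kap0 hq]] := quad_upper K e0.
exists kap; split => // n v eps Theta eps0 lf wk.
have [v0 vn Q0 _ lfm] := lf.
have [q1 q2] := hq mu mug n v eps eps0 v0 Q0 wk.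
have tq H := is_test_quad vn eps H.
have indI eta H : mu.-integrable setT (EFin \o (fun y : T => (quad n v eps (obs eps eta y) <= H)%R%:R : R)).
  apply: integrable_01 => [|y]; last exact: leind01.
  apply: (measurableT_comp (measurable_leind H)).
  exact: (measurableT_comp (measurable_quad n v eps) (measurable_obs eps eta)).
split=> H.
  rewrite /err1 (model_expectationE muxi)//.
  rewrite (_ : \int[mu]_y _ = 1 - \int[mu]_y ((quad n v eps (obs eps (fun=> 0) y) <= H)%R%:R)).
    by rewrite opprB addrC addrA subrK distrC; exact: q1.
  rewrite -[X in X - _](@Rintegral_cstR _ _ _ mu) -RintegralBR//; last exact: integrable_cstR.
  by apply: eq_Rintegral => y _; rewrite (quad_testE vn).
move=> HK; apply: (err2_le (least_favourable_neq0 lf)).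
move=> eta Te; rewrite (model_expectationE muxi); last exact: is_test_compl.
apply: le_trans (q2 eta (lfm _ Te) H HK).
rewrite le_eqVlt; apply/orP; left; apply/eqP; apply: eq_Rintegral => y _.
by rewrite (quad_testE vn) opprB addrC subrK.
Qed.

Lemma any_test_bayes (U K e : R) : 0 < e -> exists kap : R, 0 < kap /\
  forall n v eps Theta, 0 < eps -> least_favourable Theta n v ->
  (forall k, (k < n)%N -> wt n v k <= kap) -> snr n v eps <= U ->
  forall H, H <= K -> forall psi, is_test psi -> let u := snr n v eps in
  expR (u * H - u ^+ 2 / 2) * (1 - Phi H) + Phi (H - u) <=
  expR (u * H - u ^+ 2 / 2) * err1 xi eps psi + err2 xi eps Theta psi + e.
Proof.
move=> e0; have [mu [mug muxi]] := iid_std_normal_law iid.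
have [kap [kap0 hb]] := bayes_lower U K e0.
exists kap; split => // n v eps Theta eps0 lf wk uU H HK psi tp.
have [v0 vn Q0 lfs _] := lf.
rewrite /err1 (model_expectationE muxi)//.
case: (tp) => mp p01.
apply: (hb mu mug n v eps eps0 v0 Q0 wk uU H HK psi mp p01) => eta e1 e2.
have Te : Theta eta.
  apply: lfs => k; have [kn|kn] := ltnP k n; first exact: e1.
  by rewrite e2// vn// expr0n.
rewrite RintegralE; last exact: (integrable_test_obs mu eps eta (is_test_compl tp)).
rewrite lee_fin -(model_expectationE muxi eps eta (is_test_compl tp)).
exact: (err2_ge muxi).
Qed.

(** [rho] admits tests whose level is only approximately right; the excess of level is multiplied by
    [c <= exp (U K)], which gives [C]. For [u > U] the left-hand side is already at most [e]. *)
Lemma any_test_level (K e : R) : 0 < e -> exists kap C : R, [/\ 0 < kap, 0 <= C &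
  forall n v eps Theta, 0 < eps -> least_favourable Theta n v ->
  (forall k, (k < n)%N -> wt n v k <= kap) ->
  forall H, `|H| <= K -> forall psi, is_test psi -> forall rho, 0 <= rho ->
  err1 xi eps psi <= 1 - Phi H + rho ->
  Phi (H - snr n v eps) <= err2 xi eps Theta psi + C * rho + e].
Proof.
move=> e0; have [X hX] := Phi_small e0.
pose U := `|K| + `|X|.
have [kap [kap0 hb]] := any_test_bayes U K e0.
exists kap, (expR (U * K)); split => //.
move=> n v eps Theta eps0 lf wk H HK psi tp rho rho0 hrho.
have [mu [_ muxi]] := iid_std_normal_law iid.
have b0 := err2_ge0 muxi eps tp (least_favourable_neq0 lf).
have h1 := ler_norm H; have h2 := ler_norm K.
have u0 := snr_ge0 n v eps.
have C0 := expR_ge0 (U * K).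
have [uU|Uu] := leP (snr n v eps) U.
  have := hb n v eps Theta eps0 lf wk uU H (le_trans h1 HK) psi tp.
  set u := snr n v eps in uU u0 *; set c := expR (u * H - u ^+ 2 / 2) => /= hh.
  have c0 : 0 <= c by exact: expR_ge0.
  have cC : c <= expR (U * K).
    rewrite ler_expR; apply: (@le_trans _ _ (u * K)).
      have : u * H <= u * K by rewrite ler_wpM2l//; lra.
      by have := sqr_ge0 u; lra.
    by rewrite ler_wpM2r//; have := normr_ge0 H; lra.
  have p1 : c * err1 xi eps psi <= c * (1 - Phi H + rho) by rewrite ler_wpM2l.
  have p2 : c * rho <= expR (U * K) * rho by rewrite ler_wpM2r.
  by move: hh p1 p2; rewrite -/c; move: (c) => c' hh; rewrite mulrDr; lra.
have : Phi (H - snr n v eps) <= e.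
  by apply: hX; have h3 := ler_norm X; rewrite /U in Uu; lra.
by have := mulr_ge0 C0 rho0; lra.
Qed.

(** At [H = u / 2] the multiplier [c] is 1 and the weighted risk is the total error. *)
Lemma any_test_total (e : R) : 0 < e -> exists kap : R, 0 < kap /\
  forall n v eps Theta, 0 < eps -> least_favourable Theta n v ->
  (forall k, (k < n)%N -> wt n v k <= kap) -> forall psi, is_test psi ->
  2 * Phi (- (snr n v eps / 2)) <= total_err xi eps Theta psi + e.
Proof.
move=> e0; have e20 : 0 < e / 2 by lra.
have [X hX] := Phi_small e20.
pose U := 2 * `|X|.
have [kap [kap0 hb]] := any_test_bayes U (U / 2) e0.
exists kap; split => // n v eps Theta eps0 lf wk psi tp.
have [mu [_ muxi]] := iid_std_normal_law iid.
have b0 := err2_ge0 muxi eps tp (least_favourable_neq0 lf).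
have a0 := err1_ge0 muxi eps tp.
rewrite /total_err.
have [uU|Uu] := leP (snr n v eps) U.
  have uU2 : snr n v eps / 2 <= U / 2 by lra.
  have := hb n v eps Theta eps0 lf wk uU _ uU2 psi tp.
  set u := snr n v eps => /=.
  have -> : u * (u / 2) - u ^+ 2 / 2 = 0 by field.
  rewrite expR0 !mul1r -Phi_opp.
  have -> : u / 2 - u = - (u / 2) by field.
  lra.
have : Phi (- (snr n v eps / 2)) <= e / 2.
  by apply: hX; have h3 := ler_norm X; rewrite /U in Uu; lra.
lra.
Qed.

(** The threshold [H] gives level [theta] only up to an error, so its test need not compete in the
    infimum over tests of level [theta]. The threshold [H + e / 2] does: the level drops by
    [Phi (H + e / 2) - Phi H > 0], while the limiting second error grows by at most [e / 2]. *)
Lemma level_bounds (theta H e : R) : Phi H = 1 - theta -> 0 < e ->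
  exists kap : R, 0 < kap /\
  forall n v eps Theta, 0 < eps -> least_favourable Theta n v ->
  (forall k, (k < n)%N -> wt n v k <= kap) ->
  [/\ `|minimax_err2 xi eps Theta theta - Phi (H - snr n v eps)| <= e,
      err1 xi eps (quad_test v eps H) <= theta + e
    & `|err2 xi eps Theta (quad_test v eps H) - Phi (H - snr n v eps)| <= e].
Proof.
move=> PH e0; have e2 : 0 < e / 2 by lra.
have [kap1 [C [kap10 C0 h1]]] := any_test_level `|H| e2.
have He : H < H + e / 2 by lra.
have He' := Phi_lt He.
(* The first bound lets the drop of the level absorb the error [e']; the second gives
   [C * e' + e' <= e / 2]. *)
pose e' := Num.min (Phi (H + e / 2) - Phi H) (e / (2 * (1 + C))).
have C1 : 0 < 2 * (1 + C) by lra.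
have e'0 : 0 < e' by rewrite lt_min subr_gt0 He'/= divr_gt0.
have e'1 : e' <= Phi (H + e / 2) - Phi H by rewrite ge_min lexx.
have e'2 : e' * (2 * (1 + C)) <= e by rewrite -ler_pdivlMr// ge_min lexx orbT.
have Ce' : 0 <= C * e' by rewrite mulr_ge0// ltW.
have [kap2 [kap20 h2]] := quad_errors (`|H| + e / 2) e'0.
exists (Num.min kap1 kap2); split; first by rewrite lt_min kap10.
move=> n v eps Theta eps0 lf wk.
have wk1 k : (k < n)%N -> wt n v k <= kap1.
  by move=> kn; apply: (le_trans (wk k kn)); rewrite ge_min lexx.
have wk2 k : (k < n)%N -> wt n v k <= kap2.
  by move=> kn; apply: (le_trans (wk k kn)); rewrite ge_min lexx orbT.
have {h1} h1 := h1 n v eps Theta eps0 lf wk1 H (lexx _).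
have [h2a h2b] := h2 n v eps Theta eps0 lf wk2.
have [mu [_ muxi]] := iid_std_normal_law iid.
have tq H' := is_test_quad (lf_supp lf) eps H'.
have u0 := snr_ge0 n v eps; have nH := ler_norm H.
set u := snr n v eps in u0 h1 h2b *.
have a1 H' := h2a H'; have b1 := h2b H; have b2 := h2b (H + e / 2).
have aH : err1 xi eps (quad_test v eps H) <= theta + e'.
  by have := a1 H; rewrite ler_distlC PH; lra.
have aH2 : err1 xi eps (quad_test v eps (H + e / 2)) <= theta.
  by have := a1 (H + e / 2); rewrite ler_distlC; lra.
have lb psi : is_test psi -> err1 xi eps psi <= theta -> Phi (H - u) - e / 2 <= err2 xi eps Theta psi.
  move=> tp ap; have := h1 psi tp 0 (lexx 0); rewrite mulr0 !addr0 PH; lra.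
split.
- rewrite ler_distl; apply/andP; split.
    apply: lb_le_inf.
      exists (err2 xi eps Theta (quad_test v eps (H + e / 2))).
      by exists (quad_test v eps (H + e / 2)).
    by move=> _ [psi [tp ap] <-]; have := lb psi tp ap; lra.
  apply: (@le_trans _ _ (err2 xi eps Theta (quad_test v eps (H + e / 2)))).
    apply: ge_inf; last by exists (quad_test v eps (H + e / 2)).
    exists (Phi (H - u) - e / 2) => _ [psi [tp ap] <-]; exact: lb.
  have lip : Phi (H + e / 2 - u) - Phi (H - u) <= (H + e / 2 - u) - (H - u).
    by apply: Phi_lipschitz; lra.
  have /b2 : H + e / 2 <= `|H| + e / 2 + u / 2 by lra.
  lra.
- lra.
- rewrite ler_distl; apply/andP; split; last first.
    have /b1 : H <= `|H| + e / 2 + u / 2 by lra.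
    lra.
  have aH' : err1 xi eps (quad_test v eps H) <= 1 - Phi H + e' by rewrite PH; lra.
  by have := h1 _ (tq H) e' (ltW e'0) aH'; lra.
Qed.

Lemma total_bounds (e : R) : 0 < e -> exists kap : R, 0 < kap /\
  forall n v eps Theta, 0 < eps -> least_favourable Theta n v ->
  (forall k, (k < n)%N -> wt n v k <= kap) ->
  `|minimax_total_err xi eps Theta - 2 * Phi (- (snr n v eps / 2))| <= e /\
  `|total_err xi eps Theta (quad_test v eps (snr n v eps / 2)) -
    2 * Phi (- (snr n v eps / 2))| <= e.
Proof.
move=> e0; have e2 : 0 < e / 2 by lra.
have [kap1 [kap10 h1]] := any_test_total e0.
have [kap2 [kap20 h2]] := quad_errors 0 e2.
exists (Num.min kap1 kap2); split; first by rewrite lt_min kap10.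
move=> n v eps Theta eps0 lf wk.
have wk1 k : (k < n)%N -> wt n v k <= kap1.
  by move=> kn; apply: (le_trans (wk k kn)); rewrite ge_min lexx.
have wk2 k : (k < n)%N -> wt n v k <= kap2.
  by move=> kn; apply: (le_trans (wk k kn)); rewrite ge_min lexx orbT.
have {h1} h1 := h1 n v eps Theta eps0 lf wk1.
have [h2a h2b] := h2 n v eps Theta eps0 lf wk2.
set u := snr n v eps in h1 h2b *.
have tq := is_test_quad (lf_supp lf) eps (u / 2).
have up : total_err xi eps Theta (quad_test v eps (u / 2)) <= 2 * Phi (- (u / 2)) + e.
  have := h2a (u / 2); rewrite -Phi_opp ler_distl => /andP[_].
  have : u / 2 <= 0 + u / 2 by lra.
  move/h2b; have -> : u / 2 - u = - (u / 2) by field.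
  rewrite /total_err; lra.
have lo psi : is_test psi -> 2 * Phi (- (u / 2)) - e <= total_err xi eps Theta psi.
  by move/h1; lra.
split; rewrite ler_distl; apply/andP; split.
- apply: lb_le_inf.
    by exists (total_err xi eps Theta (quad_test v eps (u / 2))); exists (quad_test v eps (u / 2)).
  by move=> _ [psi tp <-]; exact: lo.
- apply: le_trans up; apply: ge_inf; last by exists (quad_test v eps (u / 2)).
  by exists (2 * Phi (- (u / 2)) - e) => _ [psi tp <-]; exact: lo.
- exact: lo.
- exact: up.
Qed.

End minimax_bounds.

(** * The extreme problem *)

Section nonneg_series.
Context {R : realType}.
Implicit Types f : nat -> R.

Lemma sum_widen (n N : nat) f : (n <= N)%N -> (forall k, (n <= k)%N -> f k = 0) ->
  \sum_(k < N) f k = \sum_(k < n) f k.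
Proof.
move=> nN fn; rewrite -!(big_mkord xpredT) (big_cat_nat (leq0n n) nN)/=.
rewrite [X in _ + X]big1_seq ?addr0// => k.
by rewrite mem_index_iota => /andP[_ /andP[/fn]].
Qed.

Lemma sum_le_widen (n N : nat) f : (n <= N)%N -> (forall k, 0 <= f k) ->
  \sum_(k < n) f k <= \sum_(k < N) f k.
Proof.
move=> nN f0; rewrite -!(big_mkord xpredT) (big_cat_nat (leq0n n) nN)/= lerDl.
exact: sumr_ge0.
Qed.

Lemma sum_le_supp (n N : nat) f : (forall k, 0 <= f k) ->
  (forall k, (n <= k)%N -> f k = 0) -> \sum_(k < N) f k <= \sum_(k < n) f k.
Proof.
move=> f0 fn; have [nN|/ltnW Nn] := leqP n N; last exact: sum_le_widen.
by rewrite (sum_widen nN fn).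
Qed.

Lemma eseries_leP f (B : R) : (forall k, 0 <= f k) ->
  (\sum_(k <oo) (f k)%:E <= B%:E)%E <-> forall n, \sum_(k < n) f k <= B.
Proof.
move=> f0; split=> [h n|h].
  rewrite -lee_fin -sumEFin; apply: le_trans h.
  by rewrite -(big_mkord xpredT (fun k => (f k)%:E)); apply: nneseries_lim_ge => k _; rewrite lee_fin.
apply: lime_le; first by apply: is_cvg_nneseries => k _ _; rewrite lee_fin.
by apply: nearW => n; rewrite big_mkord sumEFin lee_fin.
Qed.

Lemma eseries_ge f (B e : R) : (forall k, 0 <= f k) -> 0 < e ->
  (B%:E <= \sum_(k <oo) (f k)%:E)%E ->
  exists n, forall N, (n <= N)%N -> B - e <= \sum_(k < N) f k.
Proof.
move=> f0 e0 h; apply: contrapT => /forallNP hn.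
suff : (\sum_(k <oo) (f k)%:E <= (B - e)%:E)%E.
  by move/(le_trans h); rewrite lee_fin; lra.
apply/eseries_leP => // n; rewrite leNgt; apply/negP => nB.
apply: (hn n) => N nN; apply/ltW/(lt_le_trans nB).
exact: sum_le_widen.
Qed.

End nonneg_series.

(** * Kuhn-Tucker conditions *)

Section kkt.
Context {R : realType}.
Variables (s E : nat -> R) (r2 Z A : R) (n : nat).
Hypotheses (s0 : forall k, 0 < s k) (E0 : forall k, 0 < E k) (Z0 : 0 < Z) (A0 : 0 < A).

(* The extreme sequence: [Z = z0^2], [A = exp (- 2 alpha m)], with [s k] and [E k]
   the squares of [sigma_k] and [a_k]. *)
Definition profile k : R := Z * s k * Num.max 0 (1 - A * E k).

Hypothesis wn : forall k, (n <= k)%N -> profile k = 0.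
Hypothesis sum_s : \sum_(k < n) s k * profile k = r2.
Hypothesis sum_E : \sum_(k < n) E k * s k * profile k = 1.

(** In the squares [x = eta^2] the constraints of the alternative are linear. They are put on
    partial sums, the lower one up to an arbitrary [e], so that finite sums suffice in what
    follows. *)
Definition admissible (x : nat -> R) :=
  [/\ forall k, 0 <= x k, forall N, \sum_(k < N) E k * s k * x k <= 1 &
   forall e, 0 < e -> exists n, forall N, (n <= N)%N -> r2 - e <= \sum_(k < N) s k * x k].

Lemma profile_ge0 k : 0 <= profile k.
Proof. by rewrite mulr_ge0 ?le_max ?lexx// mulr_ge0// ltW. Qed.

Lemma profile_admissible : admissible profile.
Proof.
split=> [|N|e e0]; first exact: profile_ge0.
  rewrite -sum_E; apply: (@sum_le_supp _ n N (fun k => E k * s k * profile k)) => k.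
    by rewrite mulr_ge0 ?profile_ge0// mulr_ge0// ltW.
  by move=> /wn ->; rewrite mulr0.
exists n => N nN; rewrite (sum_widen (f := fun k => s k * profile k) nN) ?sum_s ?gerBl ?ltW//.
by move=> k /wn ->; rewrite mulr0.
Qed.

(** On its support [profile k] equals [Z s (1 - A E)], and both constraints are active. *)
Lemma sumsq_profile : \sum_(k < n) profile k ^+ 2 = Z * (r2 - A).
Proof.
have -> : Z * (r2 - A) = \sum_(k < n) (Z * (s k * profile k) - Z * A * (E k * s k * profile k)).
  by rewrite sumrB -!mulr_sumr sum_s sum_E; ring.
apply: eq_bigr => k _; rewrite /profile.
by case: (leP (1 - A * E k) 0) => _; ring.
Qed.

(** Since [Z s (1 - A E) <= profile] and [x >= 0], the sum is at least [Z] times the lower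
    constraint minus [Z A] times the upper one: [Z] and [Z A] act as Lagrange multipliers. *)
Lemma kkt x : admissible x -> Z * (r2 - A) <= \sum_(k < n) profile k * x k.
Proof.
move=> [x0 xE xs]; apply/ler_addgt0Pr => e e0.
have eZ : 0 < e / Z by rewrite divr_gt0.
have [n1 hn1] := xs _ eZ; pose N := maxn n n1.
have nN : (n <= N)%N by rewrite leq_maxl.
rewrite -(sum_widen (f := fun k => profile k * x k) nN); last by move=> k /wn ->; rewrite mul0r.
have h1 := hn1 N (leq_maxr _ _); have h2 := xE N.
have h3 : \sum_(k < N) (Z * (s k * x k) - Z * A * (E k * s k * x k)) <= \sum_(k < N) profile k * x k.
  apply: ler_sum => k _; rewrite /profile.
  have -> : Z * (s k * x k) - Z * A * (E k * s k * x k) = Z * s k * (1 - A * E k) * x k by ring.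
  rewrite ler_wpM2r// ler_wpM2l ?mulr_ge0 ?(ltW (s0 _)) ?(ltW Z0)//.
  by rewrite le_max lexx orbT.
rewrite sumrB -!mulr_sumr in h3.
have h4 : Z * (r2 - e / Z) <= Z * \sum_(k < N) s k * x k by rewrite ler_pM2l.
have h5 : Z * A * \sum_(k < N) E k * s k * x k <= Z * A * 1 by rewrite ler_pM2l// mulr_gt0.
have h6 : Z * (r2 - e / Z) = Z * r2 - e by field; rewrite gt_eqF.
lra.
Qed.

(** The projection inequality: [profile] is the point of least norm of a convex set. It gives
    minimality and, through the first sum, uniqueness. *)
Lemma kkt_sq x : admissible x -> forall N, (n <= N)%N ->
  \sum_(k < N) (x k - profile k) ^+ 2 + \sum_(k < n) profile k ^+ 2 <= \sum_(k < N) x k ^+ 2.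
Proof.
move=> ax N nN; have h := kkt ax; have h2 := sumsq_profile.
have -> : \sum_(k < N) (x k - profile k) ^+ 2 =
  \sum_(k < N) x k ^+ 2 - 2 * \sum_(k < N) profile k * x k + \sum_(k < N) profile k ^+ 2.
  by rewrite mulr_sumr -sumrB -big_split/=; apply: eq_bigr => k _; ring.
rewrite (sum_widen (f := fun k => profile k ^+ 2) nN); last by move=> k /wn ->; rewrite expr0n.
rewrite (sum_widen (f := fun k => profile k * x k) nN); last by move=> k /wn ->; rewrite mul0r.
lra.
Qed.

Lemma kkt_uniq x : admissible x ->
  (forall N, \sum_(k < N) x k ^+ 2 <= \sum_(k < n) profile k ^+ 2) -> x =1 profile.
Proof.
move=> ax h k; pose N := maxn n k.+1.
have nN : (n <= N)%N by rewrite leq_maxl.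
have kN : (k < N)%N by rewrite leq_maxr.
have := kkt_sq ax nN; have := h N => h1 h2.
have h3 : \sum_(k < N) (x k - profile k) ^+ 2 <= 0 by lra.
have h4 : (x k - profile k) ^+ 2 <= 0.
  apply: le_trans h3; rewrite (bigD1 (Ordinal kN))//= lerDl.
  by apply: sumr_ge0 => i _; exact: sqr_ge0.
have : (x k - profile k) ^+ 2 == 0 by rewrite eq_le h4 sqr_ge0.
by rewrite sqrf_eq0 subr_eq0 => /eqP.
Qed.

End kkt.

(** * Existence and uniqueness of the multipliers *)

Section kkt_params.
Context {R : realType}.
Variables (s E : nat -> R) (r2 : R).
Hypotheses (s0 : forall k, 0 < s k) (s1 : forall k, 1 <= s k).
Hypotheses (E0 : forall k, 0 < E k) (E_inc : forall k, E k < E k.+1).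
Hypothesis E_unb : forall B, exists k, B < E k.
Hypotheses (r20 : 0 < r2) (r2E : r2 * E 0%N < 1).

Lemma E_nd (i j : nat) : (i <= j)%N -> E i <= E j.
Proof.
move=> /subnKC <-; elim: (j - i)%N => [|m IH]; first by rewrite addn0.
by rewrite addnS; exact: le_trans IH (ltW (E_inc _)).
Qed.

Lemma profile_supp Z A : 0 < A -> exists n, forall k, (n <= k)%N -> profile s E Z A k = 0.
Proof.
move=> A0; have [n hn] := E_unb A^-1; exists n => k nk.
rewrite /profile; have -> : Num.max 0 (1 - A * E k) = 0; last by rewrite mulr0.
apply/max_idPl; rewrite subr_le0 -ler_pdivrMl// mulr1.
exact: le_trans (ltW hn) (E_nd nk).
Qed.

(* Eliminating [Z], the two constraints become one equation [F A = 0]. *)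
Lemma params_exist : exists Z A n, [/\ 0 < Z, 0 < A,
  forall k, (n <= k)%N -> profile s E Z A k = 0,
  \sum_(k < n) s k * profile s E Z A k = r2 & \sum_(k < n) E k * s k * profile s E Z A k = 1].
Proof.
(* A term of [F] below is negative only if [r2 * E k < 1], hence [k < k0]; so the negative terms sum
   to at least [- B]. *)
have [k0 hk0] := E_unb r2^-1.
pose B := \sum_(k < k0) s k ^+ 2.
have B0 : 0 <= B by apply: sumr_ge0 => k _; exact: sqr_ge0.
have [k1 hk1] := E_unb (Num.max (E 1%N) (Num.max r2^-1 ((2 * B + 2) / r2))).
have k1E : E 1%N < E k1 by apply: le_lt_trans hk1; rewrite le_max lexx.
have k1r : r2^-1 < E k1 by apply: le_lt_trans hk1; rewrite !le_max lexx orbT.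
have k1B : (2 * B + 2) / r2 < E k1 by apply: le_lt_trans hk1; rewrite !le_max lexx !orbT.
(* At [A2] only the index 0 survives, with the negative factor [r2 * E 0 - 1]. At [A1] the index
   [k1] has [b = 1 / 2], and [E k1] is large enough for its term to be at least [B]. *)
pose A1 := (2 * E k1)^-1; pose A2 := (E 1%N)^-1.
have A10 : 0 < A1 by rewrite invr_gt0 mulr_gt0.
have A12 : A1 <= A2 by rewrite lef_pV2 ?posrE ?mulr_gt0//; have := E0 k1; lra.
have [n' hn'] := profile_supp 1 A10; pose n := maxn n' (maxn k0 k1.+1).
pose b A k := Num.max 0 (1 - A * E k).
have b0 A k : 0 <= b A k by rewrite le_max lexx.
have bn A k : A1 <= A -> (n <= k)%N -> b A k = 0.
  move=> AA nk; have /hn' : (n' <= k)%N by apply: leq_trans nk; rewrite leq_maxl.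
  move/eqP; rewrite /profile mulf_eq0 mul1r gt_eqF//= => /eqP/max_idPl h.
  apply/max_idPl; apply: le_trans h; rewrite lerD2l lerN2 ler_pM2r//.
pose F A := \sum_(k < n) s k ^+ 2 * (r2 * E k - 1) * b A k.
have Fc : {within `[A1, A2], continuous F}.
  apply: continuous_subspaceT => A; rewrite /F.
  elim: (n) => [|j IH].
    by rewrite (_ : (fun A => _) = cst 0); [exact: cvg_cst|apply/funext => ?; rewrite big_ord0].
  rewrite (_ : (fun A => _) = fun A => \sum_(k < j) s k ^+ 2 * (r2 * E k - 1) * b A k + s j ^+ 2 * (r2 * E j - 1) * b A j).
    have hb : continuous_at A (fun A => b A j).
      have h0 : {for A, continuous (cst 0 : R -> R^o)} by exact: cst_continuous.
      suff h1 : {for A, continuous (fun A : R => 1 - A * E j : R^o)} by exact: (continuous_max h0 h1).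
      by apply: (@cvgB _ R^o); [exact: cvg_cst|apply: cvgM; [exact: cvg_id|exact: cvg_cst]].
    exact: (@cvgD _ R^o _ _ _ _ _ _ _ IH (@cvgM R _ _ _ (cst (s j ^+ 2 * (r2 * E j - 1))) _ _ _ (cvg_cst _) hb)).
  by apply/funext => ?; rewrite big_ord_recr.
have n0 : (0 < n)%N by rewrite !leq_max !orbT.
have F1 : 0 <= F A1.
  have k1n : (k1 < n)%N by rewrite !leq_max ltnSn !orbT.
  have k0n : (k0 <= n)%N by rewrite !leq_max leqnn !orbT.
  have E1 : b A1 k1 = 1 / 2.
    have -> : 1 / 2 = 1 - A1 * E k1 by rewrite /A1; field; rewrite gt_eqF.
    by apply/max_idPr; rewrite /A1 invfM -mulrA mulVf ?gt_eqF//; lra.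
  pose g (k : nat) : R := if (k < k0)%N then s k ^+ 2 else 0.
  have g0 k : 0 <= g k by rewrite /g; case: ifP => // _; exact: sqr_ge0.
  have BE : \sum_(k < n) g k = B.
    rewrite (sum_widen (f := g) k0n); last by move=> k kk; rewrite /g ltnNge kk.
    by apply: eq_bigr => k _; rewrite /g ltn_ord.
  have tg k : - g k <= s k ^+ 2 * (r2 * E k - 1) * b A1 k.
    have b1 : b A1 k <= 1 by rewrite ge_max ler01 gerBl mulr_ge0// ltW.
    have rE : 0 <= r2 * E k by rewrite mulr_ge0 ?(ltW r20)// ltW.
    rewrite /g -mulrA; case: ltnP => kk.
      have : -1 <= (r2 * E k - 1) * b A1 k.
        have : 0 <= r2 * E k * b A1 k by rewrite mulr_ge0.
        lra.
      by move/(ler_wpM2l (sqr_ge0 (s k))); rewrite mulrN1.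
    rewrite oppr0; apply: mulr_ge0; first exact: sqr_ge0.
    apply: mulr_ge0 => //; rewrite subr_ge0 -ler_pdivrMl// mulr1.
    exact: le_trans (ltW hk0) (E_nd kk).
  have t1 : B <= s k1 ^+ 2 * (r2 * E k1 - 1) * b A1 k1.
    rewrite E1; have : 2 * B + 2 < r2 * E k1 by rewrite -ltr_pdivrMl// mulrC.
    have s21 : 1 <= s k1 ^+ 2 by rewrite expr_ge1// ltW.
    move=> h; have : 1 * (2 * B + 1) <= s k1 ^+ 2 * (r2 * E k1 - 1) by apply: ler_pM; lra.
    lra.
  rewrite /F (bigD1 (Ordinal k1n))//=.
  have : - B <= \sum_(i < n | i != Ordinal k1n) s i ^+ 2 * (r2 * E i - 1) * b A1 i.
    rewrite -BE (bigD1 (Ordinal k1n))//= opprD -sumrN.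
    rewrite -[leRHS]add0r lerD ?oppr_le0//; exact: ler_sum.
  lra.
have F2 : F A2 <= 0.
  rewrite /F -oppr_ge0 -sumrN; apply: sumr_ge0 => k _; rewrite oppr_ge0.
  case: (nat_of_ord k) => [|j].
    rewrite -mulrA; apply: mulr_ge0_le0; first exact: sqr_ge0.
    by apply: mulr_le0_ge0 => //; rewrite subr_le0 ltW.
  have -> : b A2 j.+1 = 0; last by rewrite mulr0.
  by apply/max_idPl; rewrite subr_le0 mulrC ler_pdivlMr// mul1r E_nd.
have [|A] := @IVT R F A1 A2 0 A12 Fc.
  by rewrite ge_min le_max F1 F2 !orbT.
rewrite in_itv/= => /andP[AA1 AA2] FA.
have A0 : 0 < A by exact: lt_le_trans AA1.
(* [Z = 1 / D] normalises the constraint with [E]; the other constraint is then [F A = 0]. *)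
pose D := \sum_(k < n) E k * s k * (s k * b A k).
have bA0 : 0 < b A 0%N.
  rewrite lt_max; apply/orP; right; rewrite subr_gt0.
  apply: (@le_lt_trans _ _ (A2 * E 0%N)); first by rewrite ler_pM2r.
  by rewrite mulrC ltr_pdivrMr// mul1r.
have D0 : 0 < D.
  rewrite /D (bigD1 (Ordinal n0))//= ltr_wpDr//; last by rewrite !mulr_gt0.
  by apply: sumr_ge0 => k _; rewrite !mulr_ge0// ltW.
exists D^-1, A, n; split => //.
- by rewrite invr_gt0.
- by move=> k nk; rewrite /profile -/(b A k) (bn _ _ AA1 nk) mulr0.
- transitivity (D^-1 * \sum_(k < n) s k * (s k * b A k)).
    by rewrite mulr_sumr; apply: eq_bigr => k _; rewrite /profile -/(b A k); ring.
  have : F A = r2 * D - \sum_(k < n) s k * (s k * b A k).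
    by rewrite /F /D mulr_sumr -sumrB; apply: eq_bigr => k _; ring.
  rewrite FA => /eqP; rewrite eq_sym subr_eq0 => /eqP <-.
  by rewrite mulrCA mulVf ?mulr1// gt_eqF.
- transitivity (D^-1 * D); last by rewrite mulVf// gt_eqF.
  by rewrite mulr_sumr; apply: eq_bigr => k _; rewrite /profile -/(b A k); ring.
Qed.

(** Otherwise only the index 0 survives and the constraints give [r2 * E 0 = 1]. Two active indices
    are what allows [Z] and [A] to be read off the sequence. *)
Lemma params_pos1 Z A n : 0 < Z -> 0 < A ->
  (forall k, (n <= k)%N -> profile s E Z A k = 0) ->
  \sum_(k < n) s k * profile s E Z A k = r2 -> \sum_(k < n) E k * s k * profile s E Z A k = 1 ->
  A * E 1%N < 1.
Proof.
move=> Z0 A0 wn ss sE; rewrite ltNge; apply/negP => AE.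
have w0 k : profile s E Z A k.+1 = 0.
  rewrite /profile; have -> : Num.max 0 (1 - A * E k.+1) = 0; last by rewrite mulr0.
  apply/max_idPl; rewrite subr_le0; apply: (le_trans AE).
  by rewrite ler_pM2l// E_nd.
move: ss sE wn; case: n => [|n] ss sE wn.
  by move: sE; rewrite big_ord0 => /eqP; rewrite eq_sym oner_eq0.
move: ss sE; rewrite !big_ord_recl/= !big1; last 2 first.
- by move=> i _; rewrite w0 mulr0.
- by move=> i _; rewrite w0 mulr0.
rewrite !addr0 => h1; rewrite -mulrA h1 mulrC => h2.
by move: r2E; rewrite h2 ltxx.
Qed.

(** Both profiles solve the same extreme problem, hence coincide. Divided by [s k], they are affine
    in [E k] at the indices 0 and 1, which determines [Z] and [Z A]. *)
Lemma params_uniq Z A Z' A' n n' : 0 < Z -> 0 < A -> 0 < Z' -> 0 < A' ->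
  (forall k, (n <= k)%N -> profile s E Z A k = 0) ->
  \sum_(k < n) s k * profile s E Z A k = r2 -> \sum_(k < n) E k * s k * profile s E Z A k = 1 ->
  (forall k, (n' <= k)%N -> profile s E Z' A' k = 0) ->
  \sum_(k < n') s k * profile s E Z' A' k = r2 -> \sum_(k < n') E k * s k * profile s E Z' A' k = 1 ->
  Z = Z' /\ A = A'.
Proof.
move=> Z0 A0 Z0' A0' wn ss sE wn' ss' sE'.
have a1 := params_pos1 Z0 A0 wn ss sE.
have a1' := params_pos1 Z0' A0' wn' ss' sE'.
have ad := profile_admissible s0 E0 Z0 wn ss sE.
have ad' := profile_admissible s0 E0 Z0' wn' ss' sE'.
have le1 : \sum_(k < n) profile s E Z A k ^+ 2 <= \sum_(k < n') profile s E Z' A' k ^+ 2.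
  have := kkt_sq s0 Z0 A0 wn ss sE ad' (leq_maxl n n').
  rewrite (sum_widen (f := fun k => profile s E Z' A' k ^+ 2) (leq_maxr n n')); last first.
    by move=> k /wn' ->; rewrite expr0n.
  by apply: le_trans; rewrite lerDr; apply: sumr_ge0 => k _; exact: sqr_ge0.
have weq : profile s E Z A =1 profile s E Z' A'.
  apply: (kkt_uniq s0 Z0' A0' wn' ss' sE' ad) => N; apply: le_trans le1.
  apply: (@sum_le_supp _ n N (fun k => profile s E Z A k ^+ 2)) => k; first exact: sqr_ge0.
  by move=> /wn ->; rewrite expr0n.
have e01 := E_inc 0%N.
have mx (a : R) (k : nat) : 0 < a -> (k <= 1)%N -> a * E 1%N < 1 -> Num.max 0 (1 - a * E k) = 1 - a * E k.
  move=> a0 kk aE; apply/max_idPr; rewrite subr_ge0; apply: le_trans (ltW aE).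
  by rewrite ler_pM2l// E_nd.
have red k : (k <= 1)%N -> Z * (1 - A * E k) = Z' * (1 - A' * E k).
  move=> k1; have := weq k; rewrite /profile !mx// => h.
  by apply: (mulfI (lt0r_neq0 (s0 k))); rewrite !mulrA [s k * Z]mulrC [s k * Z']mulrC.
have r0 := red 0%N isT; have r1 := red 1%N isT.
have p1 : (Z * A - Z' * A') * (E 1%N - E 0%N) = 0.
  have -> : (Z * A - Z' * A') * (E 1%N - E 0%N) = (Z * (1 - A * E 0%N) - Z' * (1 - A' * E 0%N)) - (Z * (1 - A * E 1%N) - Z' * (1 - A' * E 1%N)) by ring.
  by rewrite r0 r1 !subrr.
have ZA : Z * A = Z' * A'.
  apply/eqP; rewrite -subr_eq0; move/eqP: p1; rewrite mulf_eq0 => /orP[//|].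
  by rewrite [E 1%N - _ == 0]subr_eq0 gt_eqF.
have ZZ : Z = Z'.
  have -> : Z = Z * (1 - A * E 0%N) + Z * A * E 0%N by ring.
  by rewrite r0 ZA; ring.
by split => //; apply: (mulfI (lt0r_neq0 Z0)); rewrite ZA -ZZ.
Qed.

End kkt_params.

(** * The extreme problem for exponential and power coefficients *)

Section extreme_problem.
Context {R : realType}.
Variables alpha beta : R.
Hypotheses (alpha0 : 0 < alpha) (beta0 : 0 < beta).

Let s (k : nat) : R := k.+1%:R `^ (2 * beta).
Let E (k : nat) : R := expR (2 * alpha * k.+1%:R).
Local Notation Theta := (Theta2r (exp_coef alpha) (pow_coef beta)).

Lemma pow_coef_sqr k : pow_coef beta k ^+ 2 = k.+1%:R `^ (2 * beta).
Proof. by rewrite /pow_coef -powR_mulrn ?powR_ge0// -powRrM [beta * 2]mulrC. Qed.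

Lemma exp_coef_sqr k : exp_coef alpha k ^+ 2 = expR (2 * alpha * k.+1%:R).
Proof. by rewrite /exp_coef -expRM_natl; congr expR; ring. Qed.

Lemma powk_ge1 k : 1 <= (k.+1%:R : R) `^ (2 * beta).
Proof.
have h : (1 : R) `^ (2 * beta) = 1 by rewrite powR1.
rewrite -[leLHS]h; apply: ge0_ler_powR; rewrite ?nnegrE ?ler1n//.
by rewrite mulr_ge0// ltW.
Qed.

Lemma powk_gt0 k : 0 < (k.+1%:R : R) `^ (2 * beta).
Proof. exact: lt_le_trans (powk_ge1 k). Qed.

Lemma expk_gt0 k : 0 < expR (2 * alpha * k.+1%:R).
Proof. exact: expR_gt0. Qed.

Lemma expk_inc k : expR (2 * alpha * k.+1%:R) < expR (2 * alpha * k.+2%:R).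
Proof. by rewrite ltr_expR ltr_pM2l ?mulr_gt0// ltr_nat. Qed.

Lemma expk_unb B : exists k : nat, B < expR (2 * alpha * k.+1%:R).
Proof.
have a0 : 0 < 2 * alpha by rewrite mulr_gt0.
have [k hk] : exists k : nat, B / (2 * alpha) < k%:R.
  by exists (Num.truncn `|B / (2 * alpha)|).+1; apply: le_lt_trans (ler_norm _) (truncnS_gt _).
exists k; rewrite ltr_pdivrMr// in hk.
apply: (lt_le_trans hk); apply: le_trans (expR_ge1Dx _).
have : k%:R * (2 * alpha) <= k.+1%:R * (2 * alpha) by rewrite ler_pM2r// ler_nat.
lra.
Qed.

Lemma extreme_sqE z0 m k : extreme_sq alpha beta z0 m k =
  profile (fun k => k.+1%:R `^ (2 * beta)) (fun k => expR (2 * alpha * k.+1%:R))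
     (z0 ^+ 2) (expR (- (2 * alpha * m))) k.
Proof.
rewrite /extreme_sq /profile -expRD.
by have -> : - (2 * alpha * m) + 2 * alpha * k.+1%:R = 2 * alpha * (k.+1%:R - m) by ring.
Qed.

Lemma extreme_sq_ge0 z0 m k : 0 <= extreme_sq alpha beta z0 m k.
Proof. by rewrite /extreme_sq mulr_ge0 ?le_max ?lexx// mulr_ge0 ?sqr_ge0 ?powR_ge0. Qed.

Lemma extreme_sq_eq0 z0 m k : m <= k.+1%:R -> extreme_sq alpha beta z0 m k = 0.
Proof.
move=> mk; rewrite /extreme_sq; have -> : Num.max 0 (1 - expR (2 * alpha * (k.+1%:R - m))) = 0.
  by apply/max_idPl; rewrite subr_le0 -[leLHS]expR0 ler_expR mulr_ge0 ?subr_ge0// mulr_ge0// ltW.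
by rewrite mulr0.
Qed.

Lemma extreme_paramsP r z0 m n : (forall k, (n <= k)%N -> extreme_sq alpha beta z0 m k = 0) ->
  extreme_params alpha beta r z0 m <->
  [/\ 0 < z0, \sum_(k < n) s k * extreme_sq alpha beta z0 m k = r ^+ 2 &
     \sum_(k < n) E k * s k * extreme_sq alpha beta z0 m k = 1].
Proof.
move=> vn; rewrite /extreme_params.
rewrite (@eseries_finite _ n (fun k => k.+1%:R `^ (2 * beta) * extreme_sq alpha beta z0 m k)); last first.
  by move=> k /vn ->; rewrite mulr0.
rewrite (@eseries_finite _ n (fun k => expR (2 * alpha * k.+1%:R) * k.+1%:R `^ (2 * beta) * extreme_sq alpha beta z0 m k)); last first.
  by move=> k /vn ->; rewrite mulr0.
by split=> -[z00 h1 h2]; split=> //; [case: h1|case: h2|congr EFin|congr EFin].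
Qed.

Lemma Theta2r_admissible r eta : Theta r eta <-> admissible s E (r ^+ 2) (fun k => eta k ^+ 2).
Proof.
have sq0 k : 0 <= E k * s k * eta k ^+ 2.
  by rewrite mulr_ge0 ?sqr_ge0// mulr_ge0 ?powR_ge0// expR_ge0.
have sq1 k : 0 <= s k * eta k ^+ 2 by rewrite mulr_ge0 ?sqr_ge0// powR_ge0.
have e1 k : `|exp_coef alpha k * pow_coef beta k * eta k| ^+ 2 = E k * s k * eta k ^+ 2.
  by rewrite real_normK ?num_real// !exprMn exp_coef_sqr pow_coef_sqr.
have e2 k : pow_coef beta k ^+ 2 * eta k ^+ 2 = s k * eta k ^+ 2 by rewrite pow_coef_sqr.
rewrite /Theta2r /Theta2 /ell2 /=.
rewrite (eq_eseriesr (fun k _ => congr1 EFin (e1 k))) (eq_eseriesr (fun k _ => congr1 EFin (e2 k))).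
split=> [[[_ h1] h2]|[_ h1 h2]].
  split=> [k|N|e e0]; first exact: sqr_ge0.
    exact: (@eseries_leP R (fun k => E k * s k * eta k ^+ 2) 1 sq0).1 h1 N.
  exact: (eseries_ge sq1 e0 h2).
have h1' : (\sum_(k <oo) (E k * s k * eta k ^+ 2)%:E <= 1%:E)%E by apply/eseries_leP.
split; first split=> //.
  (* Membership in [ell2] follows from the ellipsoid constraint because [E k * s k >= 1]. *)
  apply: le_lt_trans (ltry 1); apply: le_trans h1'; apply: lee_nneseries => k _.
    by rewrite lee_fin sqr_ge0.
  rewrite lee_fin ler_peMl ?sqr_ge0//.
  rewrite mulr_ege1 ?powk_ge1// -[leLHS]expR0 ler_expR.
  by rewrite !mulr_ge0// ltW.
apply/lee_subgt0Pr => e e0.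
have [N hN] := h2 e e0; rewrite -EFinB; apply: le_trans (_ : (\sum_(k < N) s k * eta k ^+ 2)%:E <= _)%E.
  by rewrite lee_fin hN.
rewrite -sumEFin -(big_mkord xpredT (fun k => (s k * eta k ^+ 2)%:E)).
by apply: nneseries_lim_ge => k _; rewrite lee_fin.
Qed.

Lemma quartic_sumE (eta : nat -> R) : quartic_sum eta = (\sum_(k <oo) ((eta k ^+ 2) ^+ 2)%:E)%E.
Proof. by apply: eq_eseriesr => k _; rewrite -exprM. Qed.

Section solution.
Variables (r z0 m : R) (n : nat).
Hypothesis zm : extreme_params alpha beta r z0 m.
Local Notation v := (extreme_sq alpha beta z0 m).
Hypothesis vn : forall k, (n <= k)%N -> v k = 0.

Let z00 : 0 < z0. Proof. by case: zm. Qed.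
Let Z0 : 0 < z0 ^+ 2. Proof. by rewrite exprn_gt0. Qed.
Let A0 : 0 < expR (- (2 * alpha * m)). Proof. exact: expR_gt0. Qed.
Let vE : v = profile s E (z0 ^+ 2) (expR (- (2 * alpha * m))).
Proof. by apply/funext => k; rewrite extreme_sqE. Qed.
Let wn k : (n <= k)%N -> profile s E (z0 ^+ 2) (expR (- (2 * alpha * m))) k = 0.
Proof. by rewrite -vE; exact: vn. Qed.
Let sum_s : \sum_(k < n) s k * profile s E (z0 ^+ 2) (expR (- (2 * alpha * m))) k = r ^+ 2.
Proof. by rewrite -vE; case/(extreme_paramsP r vn) : zm. Qed.
Let sum_E : \sum_(k < n) E k * s k * profile s E (z0 ^+ 2) (expR (- (2 * alpha * m))) k = 1.
Proof. by rewrite -vE; case/(extreme_paramsP r vn) : zm. Qed.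

Lemma extreme_sumsq : sumsq n v = z0 ^+ 2 * (r ^+ 2 - expR (- (2 * alpha * m))).
Proof. by rewrite /sumsq vE; exact: sumsq_profile. Qed.

Lemma extreme_sumsq_gt0 : 0 < sumsq n v.
Proof.
rewrite lt_neqAle sumr_ge0 ?andbT; last by move=> k _; exact: sqr_ge0.
apply/negP => /eqP h; move: sum_E; rewrite big1 => [/eqP|k _].
  by rewrite eq_sym oner_eq0.
have : v k ^+ 2 = 0.
  apply/eqP; rewrite eq_le sqr_ge0 andbT h /sumsq (bigD1 k)//= lerDl.
  by apply: sumr_ge0 => i _; exact: sqr_ge0.
by move/eqP; rewrite sqrf_eq0 vE => /eqP ->; rewrite mulr0.
Qed.

Lemma sqr_extreme_Theta eta : (forall k, eta k ^+ 2 = v k) -> Theta r eta.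
Proof.
move=> h; apply/Theta2r_admissible; rewrite (_ : (fun k => _) = v); last exact/funext.
by rewrite vE; apply: (profile_admissible powk_gt0 expk_gt0 Z0 wn sum_s sum_E).
Qed.

Lemma extreme_least_favourable : least_favourable (Theta r) n v.
Proof.
split=> //; first by move=> k; exact: extreme_sq_ge0.
- exact: extreme_sumsq_gt0.
- exact: sqr_extreme_Theta.
- move=> eta /Theta2r_admissible ad; rewrite extreme_sumsq vE.
  exact: (kkt powk_gt0 Z0 A0 wn ad).
Qed.

Lemma quartic_extreme eta : (forall k, eta k ^+ 2 = v k) -> quartic_sum eta = (sumsq n v)%:E.
Proof.
move=> h; rewrite quartic_sumE (eq_eseriesr (fun k _ => congr1 (fun x => (x ^+ 2)%:E) (h k))).
by rewrite (@eseries_finite _ n (fun k => v k ^+ 2))// => k /vn ->; rewrite expr0n.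
Qed.

Lemma extreme_inf :
  ereal_inf [set quartic_sum eta | eta in Theta r] = (sumsq n v)%:E.
Proof.
have sqv k : Num.sqrt (v k) ^+ 2 = v k by rewrite sqr_sqrtr// extreme_sq_ge0.
apply/eqP; rewrite eq_le; apply/andP; split.
  apply: ereal_inf_lbound; exists (fun k => Num.sqrt (v k)); first exact: sqr_extreme_Theta.
  exact: quartic_extreme.
apply: le_ereal_inf_tmp => _ [eta /Theta2r_admissible ad <-].
rewrite quartic_sumE; have := kkt_sq powk_gt0 Z0 A0 wn sum_s sum_E ad (leqnn n).
rewrite -vE => h; apply: le_trans (_ : (\sum_(k < n) (eta k ^+ 2) ^+ 2)%:E <= _)%E.
  rewrite lee_fin; apply: le_trans h; rewrite lerDr; apply: sumr_ge0 => k _; exact: sqr_ge0.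
rewrite -sumEFin -(big_mkord xpredT (fun k => ((eta k ^+ 2) ^+ 2)%:E)).
by apply: nneseries_lim_ge => k _; rewrite lee_fin sqr_ge0.
Qed.

Lemma extreme_valueE eps : 0 < eps ->
  extreme_value (exp_coef alpha) (pow_coef beta) eps r = snr n v eps.
Proof.
move=> e0; rewrite /extreme_value extreme_inf /= /snr.
have S0 := ltW extreme_sumsq_gt0; have e4 : 0 < 2 * eps ^+ 2 by rewrite mulr_gt0// exprn_gt0.
rewrite -[in RHS](ger0_norm (ltW e4)) -sqrtr_sqr -sqrtrV ?sqr_ge0// -sqrtrM ?mulr_ge0//.
by congr Num.sqrt; field; rewrite gt_eqF.
Qed.

Lemma extreme_sequenceP eta :
  extreme_sequence (exp_coef alpha) (pow_coef beta) r eta <-> forall k, eta k ^+ 2 = v k.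
Proof.
rewrite /extreme_sequence extreme_inf; split=> [[/Theta2r_admissible ad q] k|h]; last first.
  by split; [exact: sqr_extreme_Theta|exact: quartic_extreme].
rewrite vE; apply: (kkt_uniq powk_gt0 Z0 A0 wn sum_s sum_E ad) => N.
apply: (@eseries_leP R (fun k => (eta k ^+ 2) ^+ 2) _ (fun k => sqr_ge0 _)).1 N.
by rewrite -quartic_sumE q /sumsq vE.
Qed.

End solution.

(** As [E k >= E 0], the two constraints force [r^2 * E 0 <= 1]; the hypothesis is the strict form.
    The parameters correspond by [Z = z0^2] and [A = exp (- 2 alpha m)], one-to-one for [z0 > 0]. *)
Lemma extreme_params_exists_uniq r : 0 < r -> r ^+ 2 * expR (2 * alpha) < 1 ->
  exists! zm : R * R, extreme_params alpha beta r zm.1 zm.2.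
Proof.
move=> r0 rE.
have r20 : 0 < r ^+ 2 by rewrite exprn_gt0.
have rE0 : r ^+ 2 * E 0%N < 1 by rewrite /E mulr1.
have a0 : 0 < 2 * alpha by rewrite mulr_gt0.
have [Z [A [n [Z0 A0 wn ss sE]]]] :=
  params_exist powk_gt0 powk_ge1 expk_gt0 expk_inc expk_unb r20 rE0.
pose z0 := Num.sqrt Z; pose m := - ln A / (2 * alpha).
have zZ : z0 ^+ 2 = Z by rewrite sqr_sqrtr// ltW.
have mA : expR (- (2 * alpha * m)) = A.
  by rewrite (_ : - _ = ln A) ?lnK ?posrE// /m; field; rewrite gt_eqF.
have vE : extreme_sq alpha beta z0 m = profile s E Z A.
  by apply/funext => k; rewrite extreme_sqE zZ mA.
have vn k : (n <= k)%N -> extreme_sq alpha beta z0 m k = 0 by rewrite vE; exact: wn.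
exists (z0, m); split=> [|[z1 m1] /= h].
  by apply/(extreme_paramsP r vn); split; rewrite ?vE// sqrtr_gt0.
have z10 : 0 < z1 by case: h.
have z120 : 0 < z1 ^+ 2 by rewrite exprn_gt0.
have A10 : 0 < expR (- (2 * alpha * m1)) by exact: expR_gt0.
have [n1 wn1] := profile_supp s expk_inc expk_unb (z1 ^+ 2) A10.
have v1E : extreme_sq alpha beta z1 m1 = profile s E (z1 ^+ 2) (expR (- (2 * alpha * m1))).
  by apply/funext => k; rewrite extreme_sqE.
have vn1 k : (n1 <= k)%N -> extreme_sq alpha beta z1 m1 k = 0 by rewrite v1E; exact: wn1.
have [_ ss1 sE1] := (extreme_paramsP r vn1).1 h.
rewrite v1E in ss1 sE1.
have [zz AA] := params_uniq powk_gt0 expk_gt0 expk_inc rE0 Z0 A0 z120 A10 wn ss sE wn1 ss1 sE1.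
congr pair.
  by rewrite /z0 zz sqrtr_sqr ger0_norm// ltW.
by rewrite /m AA expRK; field; rewrite gt_eqF.
Qed.

End extreme_problem.

(** * Asymptotics of the extreme problem *)

Section powR_sums.
Context {R : realType}.

Lemma cvg_powR1 (X : Type) (F : set_system X) {FF : Filter F} (f : X -> R) (c : R) :
  f x @[x --> F] --> (1 : R) -> (f x `^ c) @[x --> F] --> (1 : R).
Proof.
move=> f1; have d : derivable (@powR R ^~ c) 1 1.
  by have [] := is_derive1_powR c (@ltr01 R).
have /differentiable_continuous h : differentiable (@powR R ^~ c) (1 : R) by apply/derivable1_diffP.
have -> : (1 : R) = 1 `^ c by rewrite powR1.
exact: (cvg_comp _ _ f1 h).
Qed.

Lemma cvg_invr_pinfty : (m : R)^-1 @[m --> +oo] --> (0 : R).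
Proof.
apply/(@cvgrPdist_le _ R^o) => e e0; near=> m.
have m1 : e^-1 <= m by near: m; apply: nbhs_pinfty_ge; rewrite num_real.
have e1 : 0 < e^-1 by rewrite invr_gt0.
have m0 : 0 < m by exact: lt_le_trans m1.
rewrite sub0r normrN ger0_norm ?invr_ge0 ?(ltW m0)//.
by rewrite -[leRHS]invrK lef_pV2// posrE.
Unshelve. all: by end_near. Qed.

Lemma powR_tangent (x p : R) : 0 < x -> 0 < p ->
  (p + 1) * x `^ p <= (x + 1) `^ (p + 1) - x `^ (p + 1) <= (p + 1) * (x + 1) `^ p.
Proof.
move=> x0 p0; have x1 : x <= x + 1 by lra.
have der (y : R) : 0 < y -> is_derive y 1 (@powR R ^~ (p + 1)) ((p + 1) * y `^ p).
  by move=> y0; have := is_derive1_powR (p + 1) y0; rewrite addrK.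
have [|y|c] := @MVT_segment _ (@powR R ^~ (p + 1)) (fun y => (p + 1) * y `^ p) x (x + 1) x1.
- by move=> y; rewrite in_itv/= => /andP[xy _]; apply: der; exact: lt_trans xy.
- apply: continuous_in_subspaceT => z; rewrite inE/= in_itv/= => /andP[xz _].
  have z0 : 0 < z by exact: lt_le_trans xz.
  have [d _] := der z z0.
  by apply/differentiable_continuous/derivable1_diffP.
rewrite in_itv/= => /andP[xc cx] ->; rewrite addrAC subrr add0r mulr1.
have c0 : 0 <= c by exact: le_trans (ltW x0) xc.
by apply/andP; split; (apply: ler_wpM2l; first by lra); apply: ge0_ler_powR => //;
  rewrite ?nnegrE ?(ltW p0) ?(ltW x0) ?c0//; lra.
Qed.

(** The tangent bounds telescope: a discrete comparison of the sum with an integral. *)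
Lemma powR_sum_bounds (p : R) (n : nat) : 0 < p ->
  n%:R `^ (p + 1) <= (p + 1) * \sum_(k < n) k.+1%:R `^ p <= n.+1%:R `^ (p + 1).
Proof.
move=> p0; have p1 : p + 1 != 0 by rewrite gt_eqF//; lra.
elim: n => [|n /andP[IH1 IH2]].
  by rewrite big_ord0 mulr0 powR0// lexx powR_ge0.
rewrite big_ord_recr/= mulrDr.
have nat1 j : (j.+1%:R : R) = j%:R + 1 by rewrite -natr1.
apply/andP; split.
  (* The tangent bound needs a positive base point, so the first term is checked directly. *)
  case: n IH1 IH2 => [|n] IH1 IH2.
    by rewrite big_ord0 mulr0 add0r !powR1; lra.
  have /andP[_] := @powR_tangent n.+1%:R p (ltr0Sn _ _) p0; rewrite -nat1; lra.
have /andP[] := @powR_tangent n.+1%:R p (ltr0Sn _ _) p0; rewrite -nat1; lra.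
Qed.

End powR_sums.

(** * Sums up to the efficient dimension *)

Section sums.
Context {R : realType}.
Variables (alpha p : R).
Hypotheses (alpha0 : 0 < alpha) (p0 : 0 < p).

Local Notation n m := (Num.truncn m).

(** [1 - edecay m k] is the cut-off factor of the extreme sequence for indices below [m]. Up to
    explicit factors, with [p = 4 beta], [sum1] and [sumE] are the two constraints and [sum2] is the
    objective. *)
Definition edecay (m : R) (k : nat) : R := expR (2 * alpha * (k.+1%:R - m)).
Definition sumP (m : R) := \sum_(k < n m) (k.+1%:R : R) `^ p.
Definition sum1 (m : R) := \sum_(k < n m) (k.+1%:R : R) `^ p * (1 - edecay m k).
Definition sum2 (m : R) := \sum_(k < n m) (k.+1%:R : R) `^ p * (1 - edecay m k) ^+ 2.
Definition sumE (m : R) := \sum_(k < n m) (k.+1%:R : R) `^ p * (edecay m k * (1 - edecay m k)).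

Let q : R := expR (- (2 * alpha)).
Let q0 : 0 < q. Proof. exact: expR_gt0. Qed.
Let q1 : q < 1.
Proof. by rewrite -expR0 ltr_expR oppr_lt0 mulr_gt0. Qed.

Lemma edecay_ge0 m k : 0 <= edecay m k. Proof. exact: expR_ge0. Qed.

Lemma truncn_bounds (m : R) : 0 <= m -> (n m)%:R <= m < (n m)%:R + 1.
Proof. by move=> m0; have := truncn_itv m0; rewrite -natr1. Qed.

Lemma edecay_le1 m k : 0 <= m -> (k < n m)%N -> edecay m k <= 1.
Proof.
move=> /truncn_bounds/andP[nm _] kn; rewrite -expR0 ler_expR.
apply: mulr_ge0_le0; first by rewrite mulr_ge0// ltW.
rewrite subr_le0; apply: le_trans nm; by rewrite ler_nat.
Qed.

(** Read from the last index downwards, the terms are dominated by a geometric series of ratio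
    [q]. *)
Lemma edecay_sum m : 0 <= m -> \sum_(k < n m) edecay m k <= (1 - q)^-1.
Proof.
move=> /truncn_bounds/andP[nm _].
have : \sum_(k < n m) edecay m k <= \sum_(k < n m) edecay (n m)%:R k.
  apply: ler_sum => k _; rewrite ler_expR ler_wpM2l ?mulr_ge0 ?(ltW alpha0)//; lra.
move/le_trans; apply; elim: (n m) => [|j IH].
  by rewrite big_ord0 invr_ge0 subr_ge0 ltW.
rewrite big_ord_recr/= {2}/edecay subrr mulr0 expR0.
have -> : \sum_(i < j) edecay j.+1%:R i = q * \sum_(i < j) edecay j%:R i.
  rewrite mulr_sumr; apply: eq_bigr => i _; rewrite /edecay /q -expRD; congr expR.
  by rewrite -[j.+1%:R]natr1; ring.
have : q * \sum_(i < j) edecay j%:R i <= q * (1 - q)^-1 by rewrite ler_pM2l.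
move/(lerD (lexx 1)); rewrite addrC => /le_trans; apply.
rewrite le_eqVlt; apply/orP; left; apply/eqP; field.
by rewrite subr_eq0 gt_eqF.
Qed.

(** The cut-off factor thus costs [O(m^p)], one order below the main term [m^(p + 1)]. *)
Lemma weighted_decay m : 0 <= m ->
  \sum_(k < n m) (k.+1%:R : R) `^ p * edecay m k <= m `^ p * (1 - q)^-1.
Proof.
move=> m0; apply: le_trans (_ : m `^ p * \sum_(k < n m) edecay m k <= _); last first.
  by rewrite ler_wpM2l ?powR_ge0// edecay_sum.
rewrite mulr_sumr; apply: ler_sum => k _; rewrite ler_wpM2r ?edecay_ge0//.
apply: ge0_ler_powR; rewrite ?nnegrE ?(ltW p0)//.
have /andP[nm _] := truncn_bounds m0; apply: le_trans nm; by rewrite ler_nat.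
Qed.

Lemma sum1_le m : 0 <= m -> sumP m - m `^ p * (1 - q)^-1 <= sum1 m <= sumP m.
Proof.
move=> m0; have := weighted_decay m0.
have -> : sum1 m = sumP m - \sum_(k < n m) (k.+1%:R : R) `^ p * edecay m k.
  by rewrite -sumrB; apply: eq_bigr => k _; ring.
have : 0 <= \sum_(k < n m) (k.+1%:R : R) `^ p * edecay m k.
  by apply: sumr_ge0 => k _; rewrite mulr_ge0 ?powR_ge0 ?edecay_ge0.
lra.
Qed.

Lemma sum2_le m : 0 <= m -> sumP m - 2 * (m `^ p * (1 - q)^-1) <= sum2 m <= sumP m.
Proof.
move=> m0; have h := weighted_decay m0; apply/andP; split.
  have : sumP m - 2 * \sum_(k < n m) (k.+1%:R : R) `^ p * edecay m k <= sum2 m.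
    rewrite mulr_sumr -sumrB; apply: ler_sum => k _.
    have : 0 <= (k.+1%:R : R) `^ p * edecay m k ^+ 2 by rewrite mulr_ge0 ?powR_ge0 ?sqr_ge0.
    lra.
  lra.
apply: ler_sum => k _; rewrite -[leRHS]mulr1 ler_wpM2l ?powR_ge0//.
have e0 := edecay_ge0 m k; have e1 := edecay_le1 m0 (ltn_ord k).
by rewrite expr_le1//; lra.
Qed.

Lemma sumP_bounds m : 1 <= m -> (m - 1) `^ (p + 1) <= (p + 1) * sumP m <= (m + 1) `^ (p + 1).
Proof.
move=> m1; have m0 : 0 <= m by lra.
have /andP[nm mn] := truncn_bounds m0.
have /andP[h1 h2] := powR_sum_bounds (n m) p0.
have pp : 0 <= p + 1 by rewrite addr_ge0// ltW.
apply/andP; split.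
  apply: le_trans h1; apply: ge0_ler_powR; rewrite ?nnegrE//; lra.
apply: (le_trans h2); apply: ge0_ler_powR; rewrite ?nnegrE -?natr1//; lra.
Qed.

(** The last term may vanish when [m] is close to an integer, so the one before is kept: its
    frequency is between 1 and 2 below [m], which puts [edecay] between [q^2] and [q]. *)
Lemma sumE_ge m : 2 <= m -> q ^+ 2 * (1 - q) <= sumE m.
Proof.
move=> m2; have m0 : 0 <= m by lra.
have /andP[nm mn] := truncn_bounds m0.
have n2 : (1 < n m)%N by rewrite truncn_ge_nat.
have kn : ((n m).-2 < n m)%N by case: (n m) n2 => [//|[//|j]] _.
have kE : ((n m).-2.+1%:R : R) = (n m)%:R - 1.
  by case: (n m) n2 => [//|[//|j]] _; rewrite -[j.+2%:R]natr1 addrK.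
rewrite /sumE (bigD1 (Ordinal kn))//= -[leLHS]addr0; apply: lerD; last first.
  apply: sumr_ge0 => k _; rewrite mulr_ge0 ?powR_ge0// mulr_ge0 ?edecay_ge0//.
  by rewrite subr_ge0 edecay_le1.
have p1 : 1 <= ((n m).-2.+1%:R : R) `^ p.
  have h : (1 : R) `^ p = 1 by rewrite powR1.
  by rewrite -[leLHS]h; apply: ge0_ler_powR; rewrite ?nnegrE ?ler1n// ltW.
have e1 : q ^+ 2 <= edecay m (n m).-2.
  rewrite /q -expRM_natl ler_expR kE.
  have : 2 * alpha * (-2) <= 2 * alpha * ((n m)%:R - 1 - m) by rewrite ler_wpM2l ?mulr_ge0 ?(ltW alpha0)//; lra.
  lra.
have e2 : edecay m (n m).-2 <= q.
  rewrite /q ler_expR kE.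
  have : 2 * alpha * ((n m)%:R - 1 - m) <= 2 * alpha * (-1) by rewrite ler_wpM2l ?mulr_ge0 ?(ltW alpha0)//; lra.
  lra.
rewrite -[leLHS]mul1r; apply: ler_pM => //.
  by rewrite mulr_ge0 ?sqr_ge0// subr_ge0 ltW.
by apply: ler_pM; rewrite ?sqr_ge0// ?subr_ge0 ?(ltW q1)//; lra.
Qed.

Let c1 : R := (1 - q)^-1.

Lemma cvg_ratioP (K : R) (f : R -> R) :
  (forall m, 1 <= m -> sumP m - K * m `^ p <= f m <= sumP m) ->
  (f m * (p + 1) / m `^ (p + 1)) @[m --> +oo] --> (1 : R).
Proof.
move=> hf.
have pp : 0 < p + 1 by rewrite addr_gt0.
have lo : (((1 - m^-1) `^ (p + 1)) - K * (p + 1) * m^-1) @[m --> +oo] --> (1 : R).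
  rewrite -[X in _ --> X]subr0; apply: (@cvgB _ R^o).
    apply: cvg_powR1; rewrite -[X in _ --> X]subr0; apply: (@cvgB _ R^o); [exact: cvg_cst|exact: cvg_invr_pinfty].
  by rewrite -[X in _ --> X](mulr0 (K * (p + 1))); apply: cvgM; [exact: cvg_cst|exact: cvg_invr_pinfty].
have hi : ((1 + m^-1) `^ (p + 1)) @[m --> +oo] --> (1 : R).
  apply: cvg_powR1; rewrite -[X in _ --> X]addr0; apply: (@cvgD _ R^o); [exact: cvg_cst|exact: cvg_invr_pinfty].
apply: (squeeze_cvgr _ lo hi); near=> m.
have m1 : 1 <= m by near: m; apply: nbhs_pinfty_ge; rewrite num_real.
have m0 : 0 < m by lra.
have D0 : 0 < m `^ (p + 1) by rewrite powR_gt0.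
have Dm : m `^ (p + 1) = m `^ p * m by rewrite powRD ?powRr1 ?(ltW m0)// (gt_eqF m0)// implybT.
have /andP[f1 f2] := hf m m1; have /andP[s1 s2] := sumP_bounds m1.
have eD (a : R) : 0 <= 1 + a / m -> (1 + a / m) `^ (p + 1) * m `^ (p + 1) = (m + a) `^ (p + 1).
  move=> a0; rewrite -powRM ?(ltW m0)//.
  by congr (_ `^ _); field; rewrite gt_eqF.
apply/andP; split.
  rewrite ler_pdivlMr// mulrBl.
  have -> : (1 - m^-1) `^ (p + 1) * m `^ (p + 1) = (m - 1) `^ (p + 1).
    by have := eD (-1); rewrite mulN1r => ->//; rewrite subr_ge0 invf_le1.
  have -> : K * (p + 1) * m^-1 * m `^ (p + 1) = K * (p + 1) * m `^ p.
    by rewrite Dm; field; rewrite gt_eqF.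
  have := ler_wpM2r (ltW pp) f1; lra.
rewrite ler_pdivrMr// -[m^-1]mul1r eD ?addr_ge0 ?divr_ge0 ?(ltW m0)//.
by have := ler_wpM2r (ltW pp) f2; lra.
Unshelve. all: by end_near. Qed.

Lemma cvg_sum1 : (sum1 m * (p + 1) / m `^ (p + 1)) @[m --> +oo] --> (1 : R).
Proof.
apply: (@cvg_ratioP c1) => m m1; rewrite [c1 * _]mulrC; apply: sum1_le; lra.
Qed.

Lemma cvg_sum2 : (sum2 m * (p + 1) / m `^ (p + 1)) @[m --> +oo] --> (1 : R).
Proof.
apply: (@cvg_ratioP (2 * c1)) => m m1; rewrite -mulrA [c1 * _]mulrC; apply: sum2_le; lra.
Qed.

Lemma sumE_le_sum1 m : 0 <= m -> sumE m <= sum1 m.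
Proof.
move=> m0; apply: ler_sum => k _; rewrite ler_wpM2l ?powR_ge0//.
have e0 := edecay_ge0 m k; have e1 := edecay_le1 m0 (ltn_ord k).
by rewrite ler_piMl// subr_ge0.
Qed.

(** This is [ln (1 + y) <= y] at [y = d x - 1]; the slope [d] may be as small as desired. *)
Lemma ln_linear (d : R) : 0 < d -> exists K : R, forall x, 0 < x -> ln x <= d * x + K.
Proof.
move=> d0; exists (- ln d) => x x0; move: (x) x0 => {}x x0.
have -> : ln x = ln (1 + (d * x - 1)) - ln d.
  have -> : 1 + (d * x - 1) = d * x by ring.
  by rewrite lnM ?posrE//; ring.
have dx : 0 < d * x by rewrite mulr_gt0.
have := @le_ln1Dx R (d * x - 1); have : -1 < d * x - 1 by lra.
by move=> h /(_ h); lra.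
Qed.

(** [sum1 / sumE] lies between 1 and a constant times [(m + 1)^(p + 1)], so its logarithm is [o(m)].
    Combined with [params_ln] this is [ln (1 / r) ~ alpha m]. *)
Lemma cvg_ell : (1 - ln (sum1 m / sumE m) / (2 * alpha * m)) @[m --> +oo] --> (1 : R).
Proof.
have pp : 0 < p + 1 by rewrite addr_gt0.
rewrite -[X in _ --> X]subr0; apply: (@cvgB _ R^o); first exact: cvg_cst.
apply/(@cvgrPdist_le _ R^o) => e e0.
pose c0 := q ^+ 2 * (1 - q).
have c00 : 0 < c0 by rewrite mulr_gt0 ?exprn_gt0// subr_gt0.
pose d := e * alpha / (2 * (p + 1)).
have d0 : 0 < d by rewrite divr_gt0 ?mulr_gt0.
have [K hK] := ln_linear d0.
pose K2 := (p + 1) * (d + K) - ln ((p + 1) * c0).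
near=> m.
have m2 : 2 <= m by near: m; apply: nbhs_pinfty_ge; rewrite num_real.
have mK : K2 / (e * alpha) <= m by near: m; apply: nbhs_pinfty_ge; rewrite num_real.
have m0 : 0 < m by lra.
have T0 := sumE_ge m2; rewrite -/c0 in T0.
have T1 : 0 < sumE m by exact: lt_le_trans T0.
have ST := sumE_le_sum1 (ltW m0).
have S1 : 0 < sum1 m by exact: lt_le_trans ST.
have R1 : 1 <= sum1 m / sumE m by rewrite ler_pdivlMr// mul1r.
have am : 0 < 2 * alpha * m by rewrite !mulr_gt0.
rewrite sub0r normrN ger0_norm; last by rewrite divr_ge0 ?(ltW am)// ln_ge0.
rewrite ler_pdivrMr//.
have pc0 : 0 < (p + 1) * c0 by rewrite mulr_gt0.
have m10 : 0 < (m + 1) `^ (p + 1) by rewrite powR_gt0; lra.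
have Rle : sum1 m / sumE m <= (m + 1) `^ (p + 1) / ((p + 1) * c0).
  have [m1 m0'] : 1 <= m /\ 0 <= m by split; lra.
  have /andP[_ s1] := sum1_le m0'; have /andP[_ s2] := sumP_bounds m1.
  rewrite ler_pdivrMr// mulrAC ler_pdivlMr//.
  have h1 : sum1 m * (p + 1) <= (m + 1) `^ (p + 1) by apply: le_trans s2; rewrite mulrC ler_pM2l.
  by rewrite mulrA; apply: ler_pM => //; [rewrite mulr_ge0 ?(ltW S1) ?(ltW pp)|exact: ltW].
have : ln (sum1 m / sumE m) <= (p + 1) * ln (m + 1) - ln ((p + 1) * c0).
  have R0 : 0 < sum1 m / sumE m by exact: lt_le_trans R1.
  rewrite -ln_powR -ln_div ?posrE// ler_ln ?posrE//; last exact: divr_gt0.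
have : (p + 1) * ln (m + 1) <= (p + 1) * (d * (m + 1) + K) by rewrite ler_pM2l// hK; lra.
have : (p + 1) * (d * m) = e * alpha * m / 2 by rewrite /d; field; rewrite gt_eqF.
have : K2 <= e * alpha * m by rewrite mulrC -ler_pdivrMr// mulr_gt0.
have : 0 < e * alpha * m by rewrite !mulr_gt0.
by rewrite /K2; lra.
Unshelve. all: by end_near. Qed.

End sums.

(** * Signal-to-noise ratio and weights for a large efficient dimension *)

Section asymptotics.
Context {R : realType}.
Variables alpha beta : R.
Hypotheses (alpha0 : 0 < alpha) (beta0 : 0 < beta).

Local Notation p := (4 * beta).
Local Notation v z0 m := (extreme_sq alpha beta z0 m).
Local Notation S1 m := (sum1 alpha p m).
Local Notation S2 m := (sum2 alpha p m).
Local Notation SE m := (sumE alpha p m).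
Local Notation n m := (Num.truncn m).

Let p0 : 0 < p. Proof. by rewrite mulr_gt0. Qed.

Lemma extreme_supp z0 (m : R) k : (n m <= k)%N -> v z0 m k = 0.
Proof.
move=> mk; apply: extreme_sq_eq0 => //; apply: le_trans (ltW (truncnS_gt m)) _.
by rewrite ler_nat.
Qed.

Lemma extreme_sq_trunc z0 m k : 0 <= m -> (k < n m)%N ->
  v z0 m k = z0 ^+ 2 * k.+1%:R `^ (2 * beta) * (1 - edecay alpha m k).
Proof.
move=> m0 km; congr (_ * _); apply/max_idPr; rewrite subr_ge0.
exact: edecay_le1.
Qed.

Lemma powk_sqr k : (k.+1%:R `^ (2 * beta)) ^+ 2 = k.+1%:R `^ p :> R.
Proof. by rewrite -powR_mulrn ?powR_ge0// -powRrM; congr (_ `^ _); ring. Qed.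

Section params.
Variables r z0 m : R.
Hypotheses (r0 : 0 < r) (zm : extreme_params alpha beta r z0 m).

(** The objective equals [z0^2 (r^2 - exp (- 2 alpha m))] and is positive. This drives [m] to
    infinity as [r] tends to 0. *)
Lemma params_decay : expR (- (2 * alpha * m)) < r ^+ 2.
Proof.
have vn := @extreme_supp z0 m.
have := extreme_sumsq_gt0 zm vn; rewrite (extreme_sumsq zm vn).
have z00 : 0 < z0 by case: zm.
by rewrite pmulr_rgt0 ?exprn_gt0// subr_gt0.
Qed.

Lemma params_large M : r ^+ 2 <= expR (- (2 * alpha * M)) -> M < m.
Proof.
move=> h; have := lt_le_trans params_decay h.
by rewrite ltr_expR ltrN2 ltr_pM2l// mulr_gt0.
Qed.

Hypothesis m0 : 0 <= m.

Lemma params_sum1 : r ^+ 2 = z0 ^+ 2 * S1 m.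
Proof.
have [_ <- _] := (extreme_paramsP r (@extreme_supp z0 m)).1 zm.
rewrite mulr_sumr; apply: eq_bigr => k _; rewrite extreme_sq_trunc// -powk_sqr; ring.
Qed.

Lemma params_sumE : expR (- (2 * alpha * m)) = z0 ^+ 2 * SE m.
Proof.
have [_ _ h] := (extreme_paramsP r (@extreme_supp z0 m)).1 zm.
rewrite -[LHS]mulr1 -[X in _ * X = _]h !mulr_sumr; apply: eq_bigr => k _.
rewrite extreme_sq_trunc// -powk_sqr.
have -> : edecay alpha m k = expR (- (2 * alpha * m)) * expR (2 * alpha * k.+1%:R).
  by rewrite /edecay -expRD; congr expR; ring.
by ring.
Qed.

Lemma params_sum2 : sumsq (n m) (v z0 m) = (z0 ^+ 2) ^+ 2 * S2 m.
Proof.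
rewrite mulr_sumr; apply: eq_bigr => k _; rewrite extreme_sq_trunc// -powk_sqr; ring.
Qed.

(** Dividing the two equations eliminates [z0]: [r^2 exp (2 alpha m) = sum1 / sumE]. *)
Lemma params_ln : 0 < m -> 0 < SE m ->
  ln r^-1 = alpha * m * (1 - ln (S1 m / SE m) / (2 * alpha * m)).
Proof.
move=> m1 se; have z00 : 0 < z0 by case: zm.
have Z0 : 0 < z0 ^+ 2 by rewrite exprn_gt0.
have s1 : 0 < S1 m by exact: lt_le_trans (sumE_le_sum1 p alpha0 m0).
have -> : ln (S1 m / SE m) = ln (r ^+ 2 / expR (- (2 * alpha * m))).
  by rewrite params_sum1 params_sumE; congr ln; field; rewrite !gt_eqF.
rewrite ln_div ?posrE ?expR_gt0 ?exprn_gt0// expRK lnV ?posrE// lnXn//.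
by field; rewrite !gt_eqF.
Qed.

(** Origin of the constant: [u = r^2 sqrt (sum2) / (sqrt 2 eps^2 sum1)], where both sums are
    asymptotic to [m^(p + 1) / (p + 1)] with [p = 4 beta], and [m ~ ln (1 / r) / alpha]. *)
Definition rate_const : R := Num.sqrt ((4 * beta + 1) / 2) * alpha `^ (2 * beta + 1 / 2).

(** The exact quotient of [u] by its claimed rate, by [snr_asymp]: [z0], [r] and [eps] cancel and
    only [m] remains, which makes the asymptotics uniform in [eps]. *)
Definition snr_ratio (m : R) : R :=
  (S2 m * (p + 1) / m `^ (p + 1)) `^ 2^-1 / (S1 m * (p + 1) / m `^ (p + 1)) *
  (1 - ln (S1 m / SE m) / (2 * alpha * m)) `^ (2 * beta + 1 / 2).

Lemma snr_asymp eps : 0 < eps -> 0 < m -> 0 < S2 m -> 0 < SE m ->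
  0 < 1 - ln (S1 m / SE m) / (2 * alpha * m) ->
  snr (n m) (v z0 m) eps /
    (rate_const * eps ^- 2 * r ^+ 2 * (ln r^-1) `^ (- (2 * beta) - 1 / 2)) = snr_ratio m.
Proof.
move=> eps0 m1 s2 se ell0; have z00 : 0 < z0 by case: zm.
have Z0 : 0 < z0 ^+ 2 by rewrite exprn_gt0.
have s1 : 0 < S1 m by exact: lt_le_trans (sumE_le_sum1 p alpha0 m0).
rewrite /snr_ratio /rate_const /snr params_sum2 (params_ln m1 se) params_sum1.
move: (1 - _) ell0 => ell ell0.
have am : 0 <= alpha * m by rewrite mulr_ge0 ?ltW.
have -> : - (2 * beta) - 1 / 2 = - (2 * beta + 1 / 2) by ring.
rewrite powRN powRM ?(ltW ell0)// powRM ?(ltW alpha0) ?(ltW m1)//.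
have c0 : 0 < 2 * beta + 1 / 2 by rewrite addr_gt0// ?divr_gt0// mulr_gt0.
have -> : 4 * beta + 1 = (2 * beta + 1 / 2) * 2 by field.
move: (2 * beta + 1 / 2) c0 => c c0.
have D0 : 0 < m `^ c by rewrite powR_gt0.
have el0 : 0 < ell `^ c by rewrite powR_gt0.
have ac0 : 0 < alpha `^ c by rewrite powR_gt0.
rewrite (powRrM m c 2) powR_mulrn ?powR_ge0//.
rewrite powR12_sqrt; last by rewrite divr_ge0 ?sqr_ge0// mulr_ge0 ?(ltW s2)// mulr_ge0// ltW.
have P0 : 0 < c * 2 by rewrite mulr_gt0.
have q1 : Num.sqrt (2 * ((z0 ^+ 2) ^+ 2 * S2 m)) = Num.sqrt 2 * (z0 ^+ 2 * Num.sqrt (S2 m)).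
  by rewrite sqrtrM// sqrtrM ?sqr_ge0// sqrtr_sqr (ger0_norm (ltW Z0)).
have q2 : Num.sqrt (c * 2 / 2) = Num.sqrt (c * 2) / Num.sqrt 2.
  by rewrite sqrtrM ?(ltW P0)// sqrtrV.
have q3 : Num.sqrt (S2 m * (c * 2) / (m `^ c) ^+ 2) = Num.sqrt (S2 m) * Num.sqrt (c * 2) / m `^ c.
  rewrite sqrtrM; last by rewrite mulr_ge0 ?(ltW s2) ?(ltW P0).
  by rewrite sqrtrM ?(ltW s2)// sqrtrV ?sqr_ge0// sqrtr_sqr (ger0_norm (ltW D0)).
rewrite q1 q2 q3.
have b2 : c * 2 = Num.sqrt (c * 2) ^+ 2 by rewrite sqr_sqrtr// ltW.
have t2 : Num.sqrt 2 ^+ 2 = 2 :> R by rewrite sqr_sqrtr.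
have b0 : 0 < Num.sqrt (c * 2) by rewrite sqrtr_gt0.
have t0 : 0 < Num.sqrt 2 :> R by rewrite sqrtr_gt0.
rewrite [X in S1 m * X]b2.
move: (Num.sqrt (c * 2)) b0 (Num.sqrt 2) t0 t2 (Num.sqrt (S2 m)) => b b0 t t0 t2 a {b2}.
move: (m `^ c) D0 (ell `^ c) el0 (alpha `^ c) ac0 (S1 m) s1 (z0 ^+ 2) Z0 => D D0 el el0 ac ac0 s s0 Z Z0.
transitivity (t ^+ 2 / 2 * (a * D * el / (b * s))).
  by field; rewrite !gt_eqF.
by rewrite t2; field; rewrite !gt_eqF.
Qed.

(** A squared weight is at most [m^p / (2 sum2)], which the lower bound on [sum2] turns into
    [(p + 1) / m <= d^2]. *)
Lemma wt_le (d : R) : 0 < d -> 0 < m -> 1 / 2 <= S2 m * (p + 1) / m `^ (p + 1) ->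
  (p + 1) / d ^+ 2 <= m -> forall k, (k < n m)%N -> wt (n m) (v z0 m) k <= d.
Proof.
move=> d0 m1 h2 md k kn; have z00 : 0 < z0 by case: zm.
have Z0 : 0 < z0 ^+ 2 by rewrite exprn_gt0.
have pp : 0 < p + 1 by rewrite addr_gt0.
have D0 : 0 < m `^ p by rewrite powR_gt0.
have d20 : 0 < d ^+ 2 by rewrite exprn_gt0.
have Dm : m `^ (p + 1) = m `^ p * m by rewrite powRD ?powRr1 ?(ltW m1)// (gt_eqF m1)// implybT.
have S2p : m `^ p * m <= 2 * (S2 m * (p + 1)).
  by move: h2; rewrite Dm ler_pdivlMr ?mulr_gt0//; lra.
have S2d : m `^ p <= d ^+ 2 * (2 * S2 m).
  have h : p + 1 <= d ^+ 2 * m by rewrite [d ^+ 2 * m]mulrC -ler_pdivrMr.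
  have : m `^ p * (p + 1) <= m `^ p * (d ^+ 2 * m) by rewrite ler_pM2l.
  have := ler_wpM2l (ltW d20) S2p; move=> h1 h3.
  rewrite -(ler_pM2r pp); lra.
have s2 : 0 < S2 m.
  by rewrite -(pmulr_rgt0 _ (mulr_gt0 d20 (@ltr0n R 2))) -mulrA; exact: lt_le_trans S2d.
rewrite /wt params_sum2 ler_pdivrMr; last by rewrite sqrtr_gt0 !mulr_gt0.
rewrite (_ : 2 * ((z0 ^+ 2) ^+ 2 * S2 m) = (z0 ^+ 2) ^+ 2 * (2 * S2 m)); last by ring.
rewrite sqrtrM ?sqr_ge0// sqrtr_sqr (ger0_norm (ltW Z0)) extreme_sq_trunc//.
rewrite mulrCA -mulrA ler_pM2l//.
have e0 := edecay_ge0 alpha m k; have e1 := edecay_le1 alpha0 m0 kn.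
apply: (@le_trans _ _ (k.+1%:R `^ (2 * beta))).
  by rewrite ler_piMr ?powR_ge0//; lra.
have d2 : 0 <= d * Num.sqrt (2 * S2 m) by rewrite mulr_ge0// ltW.
rewrite -(@ler_pXn2r _ 2%N) ?nnegrE ?powR_ge0// exprMn sqr_sqrtr; last by rewrite mulr_ge0// ltW.
rewrite powk_sqr; apply: le_trans S2d; apply: ge0_ler_powR; rewrite ?nnegrE ?(ltW p0)//.
have /andP[nm _] := truncn_bounds m0; apply: le_trans nm; by rewrite ler_nat.
Qed.

End params.

Lemma cvg_snr_ratio : snr_ratio m @[m --> +oo] --> (1 : R).
Proof.
have -> : (1 : R) = 1 / 1 * 1 by rewrite divr1 mulr1.
apply: cvgM; last by apply: cvg_powR1; exact: cvg_ell.
apply: cvgM; first by apply: cvg_powR1; exact: cvg_sum2.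
by apply: cvgV; [exact: oner_neq0|exact: cvg_sum1].
Qed.

Lemma extreme_asymptotics (d : R) : 0 < d -> exists M : R, forall r z0 m eps,
  0 < r -> 0 < eps -> extreme_params alpha beta r z0 m -> M <= m ->
  (forall k, (k < n m)%N -> wt (n m) (v z0 m) k <= d) /\
  `|snr (n m) (v z0 m) eps /
    (rate_const * eps ^- 2 * r ^+ 2 * (ln r^-1) `^ (- (2 * beta) - 1 / 2)) - 1| <= d.
Proof.
move=> d0.
have half0 : 0 < 1 / 2 :> R by rewrite divr_gt0.
have /cvgrPdist_le/(_ _ d0)[M1 [_ h1]] := cvg_snr_ratio.
have /cvgrPdist_le/(_ _ half0)[M2 [_ h2]] := cvg_sum2 alpha0 p0.
have /cvgrPdist_le/(_ _ half0)[M3 [_ h3]] := cvg_ell alpha0 p0.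
exists (Num.max 2 ((p + 1) / d ^+ 2) + `|M1| + `|M2| + `|M3| + 1) => r z0 m eps r0 eps0 zm hm.
have [a1 a2 a3] : [/\ M1 < m, M2 < m & M3 < m].
  have := ler_norm M1; have := ler_norm M2; have := ler_norm M3.
  have := normr_ge0 M1; have := normr_ge0 M2; have := normr_ge0 M3.
  have : 2 <= Num.max 2 ((p + 1) / d ^+ 2) by rewrite le_max lexx.
  by move: (Num.max _ _) hm => x hm; split; lra.
have [m2 mp] : 2 <= m /\ (p + 1) / d ^+ 2 <= m.
  have : 2 <= Num.max 2 ((p + 1) / d ^+ 2) by rewrite le_max lexx.
  have : (p + 1) / d ^+ 2 <= Num.max 2 ((p + 1) / d ^+ 2) by rewrite le_max lexx orbT.
  have := normr_ge0 M1; have := normr_ge0 M2; have := normr_ge0 M3.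
  by move: (Num.max _ _) hm => x hm; split; lra.
have {h1} h1 := h1 _ a1; have {h2} h2 := h2 _ a2; have {h3} h3 := h3 _ a3.
have m1 : 0 < m by lra.
have m0 := ltW m1.
move: h2; rewrite /= ler_distlC => /andP[h2 _].
move: h3; rewrite /= ler_distlC => /andP[h3 _].
have h2' : 1 / 2 <= S2 m * (p + 1) / m `^ (p + 1) by lra.
have q1 : expR (- (2 * alpha)) < 1 by rewrite -expR0 ltr_expR oppr_lt0 mulr_gt0.
have se : 0 < SE m.
  by apply: lt_le_trans (sumE_ge alpha0 p0 m2); rewrite mulr_gt0 ?exprn_gt0 ?expR_gt0// subr_gt0.
have s2 : 0 < S2 m.
  have pp : 0 < p + 1 by rewrite addr_gt0.
  rewrite -(pmulr_lgt0 _ pp) -[ltRHS](divfK (lt0r_neq0 (powR_gt0 (p + 1) m1))).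
  by rewrite mulr_gt0 ?powR_gt0//; lra.
split; first exact: (wt_le zm m0 d0).
rewrite (snr_asymp r0 zm m0)//; last by lra.
by rewrite distrC.
Qed.

End asymptotics.

(** * Sharp asymptotics and separation rates *)

Section uniform.
Context {R : realType}.
Variables alpha beta : R.
Hypotheses (alpha0 : 0 < alpha) (beta0 : 0 < beta).

Local Notation Theta := (Theta2r (exp_coef alpha) (pow_coef beta)).
Local Notation ev := (extreme_value (exp_coef alpha) (pow_coef beta)).
Local Notation c2 := (rate_const alpha beta).

Definition rate (eps r : R) : R :=
  c2 * eps ^- 2 * r ^+ 2 * (ln r^-1) `^ (- (2 * beta) - 1 / 2).

Lemma rate_const_gt0 : 0 < c2.
Proof.
rewrite mulr_gt0 ?powR_gt0// sqrtr_gt0 divr_gt0// addr_gt0// mulr_gt0//.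
Qed.

Lemma small_radius (M : R) : exists rho : R, 0 < rho /\ forall r, 0 < r < rho ->
  [/\ r < 1, exists! zm : R * R, extreme_params alpha beta r zm.1 zm.2 &
   forall z0 m, extreme_params alpha beta r z0 m -> M <= m].
Proof.
(* In turn: [ln r^-1 > 0], solvability of the equations, and [m >= M]. The last two conditions
   concern [r^2], which is at most [r]. *)
pose rho := Num.min 1 (Num.min (expR (- (2 * alpha))) (expR (- (2 * alpha * M)))).
exists rho; split; first by rewrite !lt_min ltr01 !expR_gt0.
move=> r /andP[r0]; rewrite !lt_min => /and3P[r1 h1 h2].
have rr : r ^+ 2 <= r by rewrite expr2 ler_piMl// ltW.
have a0 := expR_gt0 (2 * alpha).
split=> // [|z0 m zm].
  apply: extreme_params_exists_uniq => //.
  by rewrite -ltr_pdivlMr// mul1r -expRN; exact: le_lt_trans h1.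
by apply/ltW/(params_large alpha0 zm)/ltW; exact: le_lt_trans h2.
Qed.

Lemma asymp_bounds (e : R) : 0 < e -> exists rho : R, 0 < rho /\ forall r eps, 0 < r < rho ->
  0 < eps -> `|ev eps r / rate eps r - 1| <= e.
Proof.
move=> e0; have [M hM] := extreme_asymptotics alpha0 beta0 e0.
have [rho [rho0 h]] := small_radius M.
exists rho; split => // r eps rr eps0; have [_ [[z0 m] [/= zm _]] mM] := h r rr.
have r0 : 0 < r by case/andP: rr.
have [_] := hM r z0 m eps r0 eps0 zm (mM _ _ zm).
by rewrite -(extreme_valueE alpha0 beta0 zm (extreme_supp beta alpha0 z0 (m := m))).
Qed.

Lemma extreme_regime (kap : R) : 0 < kap -> exists rho : R, 0 < rho /\
  forall r eps, 0 < r < rho -> 0 < eps ->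
  (exists z0 m, extreme_params alpha beta r z0 m) /\
  forall z0 m, extreme_params alpha beta r z0 m -> exists n,
    [/\ least_favourable (Theta r) n (extreme_sq alpha beta z0 m),
        forall k, (k < n)%N -> wt n (extreme_sq alpha beta z0 m) k <= kap &
        ev eps r = snr n (extreme_sq alpha beta z0 m) eps].
Proof.
move=> kap0; have [M hM] := extreme_asymptotics alpha0 beta0 kap0.
have [rho [rho0 h]] := small_radius M.
exists rho; split => // r eps rr eps0; have [_ [[z1 m1] [/= zm1 _]] mM] := h r rr.
have r0 : 0 < r by case/andP: rr.
split=> [|z0 m zm]; first by exists z1, m1.
exists (Num.truncn m); have vn := extreme_supp beta alpha0 z0 (m := m); split.
- exact: (extreme_least_favourable alpha0 beta0 zm vn).
- exact: (hM r z0 m eps r0 eps0 zm (mM _ _ zm)).1.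
- exact: (extreme_valueE alpha0 beta0 zm vn).
Qed.

Context d (Omega : measurableType d) (P : probability Omega R) (xi : nat -> {RV P >-> R}).
Hypothesis iid : iid_std_normal xi.

Lemma minimax_level (theta H e : R) : Phi H = 1 - theta -> 0 < e ->
  exists rho : R, 0 < rho /\ forall r eps, 0 < r < rho -> 0 < eps ->
  `|minimax_err2 xi eps (Theta r) theta - Phi (H - ev eps r)| <= e /\
  forall z0 m, extreme_params alpha beta r z0 m ->
    err1 xi eps (quad_test (extreme_sq alpha beta z0 m) eps H) <= theta + e /\
    `|err2 xi eps (Theta r) (quad_test (extreme_sq alpha beta z0 m) eps H) -
      Phi (H - ev eps r)| <= e.
Proof.
move=> PH e0; have [kap [kap0 hk]] := level_bounds iid PH e0.
have [rho [rho0 h]] := extreme_regime kap0.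
exists rho; split => // r eps rr eps0; have [[z1 [m1 zm1]] lf] := h r eps rr eps0.
split=> [|z0 m zm].
  by have [n [lfn wn ->]] := lf _ _ zm1; case: (hk _ _ eps (Theta r) eps0 lfn wn).
by have [n [lfn wn ->]] := lf _ _ zm; case: (hk _ _ eps (Theta r) eps0 lfn wn).
Qed.

Lemma minimax_total (e : R) : 0 < e ->
  exists rho : R, 0 < rho /\ forall r eps, 0 < r < rho -> 0 < eps ->
  `|minimax_total_err xi eps (Theta r) - 2 * Phi (- (ev eps r / 2))| <= e /\
  forall z0 m, extreme_params alpha beta r z0 m ->
    `|total_err xi eps (Theta r) (quad_test (extreme_sq alpha beta z0 m) eps (ev eps r / 2)) -
      2 * Phi (- (ev eps r / 2))| <= e.
Proof.
move=> e0; have [kap [kap0 hk]] := total_bounds iid e0.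
have [rho [rho0 h]] := extreme_regime kap0.
exists rho; split => // r eps rr eps0; have [[z1 [m1 zm1]] lf] := h r eps rr eps0.
split=> [|z0 m zm].
  by have [n [lfn wn ->]] := lf _ _ zm1; case: (hk _ _ eps (Theta r) eps0 lfn wn).
by have [n [lfn wn ->]] := lf _ _ zm; case: (hk _ _ eps (Theta r) eps0 lfn wn).
Qed.

Lemma near_vanishing (r : R -> R) (rho : R) : vanishing_family r -> 0 < rho ->
  \forall eps \near 0^'+, 0 < r eps < rho.
Proof.
move=> [rp rc] rho0; near=> eps; apply/andP; split; first by near: eps.
by near: eps; apply: (cvgr_lt 0 rc).
Unshelve. all: by end_near. Qed.

Lemma uniform_near (r : R -> R) (Q : R -> R -> Prop) : vanishing_family r ->
  (exists rho : R, 0 < rho /\ forall s eps, 0 < s < rho -> 0 < eps -> Q s eps) ->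
  \forall eps \near 0^'+, Q (r eps) eps.
Proof.
move=> rv [rho [rho0 h]]; near=> eps; apply: h; last by near: eps; exact: nbhs_right_gt.
by near: eps; exact: near_vanishing.
Unshelve. all: by end_near. Qed.

Lemma cvgr0P (F : set_system R) (FF : Filter F) (f : R -> R) :
  (forall e, 0 < e -> \forall x \near F, `|f x| <= e) -> f x @[x --> F] --> (0 : R).
Proof.
move=> h; apply/(@cvgrPdist_le _ R^o) => e e0.
by apply: filterS (h e e0) => x; rewrite sub0r normrN.
Qed.

Section family.
Variables (r : R -> R) (rv : vanishing_family r).

Lemma sharp_level (theta H : R) : Phi H = 1 - theta ->
  (minimax_err2 xi eps (Theta (r eps)) theta - Phi (H - ev eps (r eps)))
    @[eps --> 0^'+] --> 0.
Proof.
move=> PH; apply: cvgr0P => e e0.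
apply: (uniform_near (Q := fun s eps => `|minimax_err2 xi eps (Theta s) theta - Phi (H - ev eps s)| <= e)) => //.
have [rho [rho0 h]] := minimax_level PH e0.
by exists rho; split => // s eps sr eps0; case: (h s eps sr eps0).
Qed.

Lemma sharp_total :
  (minimax_total_err xi eps (Theta (r eps)) - 2 * Phi (- (ev eps (r eps) / 2)))
    @[eps --> 0^'+] --> 0.
Proof.
apply: cvgr0P => e e0.
apply: (uniform_near (Q := fun s eps => `|minimax_total_err xi eps (Theta s) - 2 * Phi (- (ev eps s / 2))| <= e)) => //.
have [rho [rho0 h]] := minimax_total e0.
by exists rho; split => // s eps sr eps0; case: (h s eps sr eps0).
Qed.

Lemma extreme_value_asymp : asymp_equiv (fun eps => ev eps (r eps)) (fun eps => rate eps (r eps)).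
Proof.
apply/(@cvgrPdist_le _ R^o) => e e0.
apply: (uniform_near (Q := fun s eps => `|1 - ev eps s / rate eps s| <= e)) => //.
have [rho [rho0 h]] := asymp_bounds e0.
by exists rho; split => // s eps sr eps0; rewrite distrC; exact: h.
Qed.

Lemma near_params : \forall eps \near 0^'+,
  exists! zm : R * R, extreme_params alpha beta (r eps) zm.1 zm.2.
Proof.
apply: (uniform_near (Q := fun s eps => exists! zm : R * R, extreme_params alpha beta s zm.1 zm.2)) => //.
have [rho [rho0 h]] := small_radius 0.
by exists rho; split => // s eps sr _; case: (h s sr).
Qed.

Variables z0 m : R -> R.
Hypothesis zm : \forall eps \near 0^'+, extreme_params alpha beta (r eps) (z0 eps) (m eps).
Local Notation v eps := (extreme_sq alpha beta (z0 eps) (m eps)).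

Lemma quad_minimax_level (theta H : R) : Phi H = 1 - theta ->
  asymp_minimax_level xi (fun eps => Theta (r eps)) theta (fun eps => quad_test (v eps) eps H).
Proof.
move=> PH.
have key e : 0 < e -> \forall eps \near 0^'+,
    `|minimax_err2 xi eps (Theta (r eps)) theta - Phi (H - ev eps (r eps))| <= e /\
    err1 xi eps (quad_test (v eps) eps H) <= theta + e /\
    `|err2 xi eps (Theta (r eps)) (quad_test (v eps) eps H) - Phi (H - ev eps (r eps))| <= e.
  move=> e0; have h := uniform_near rv (minimax_level PH e0).
  by move: h zm; apply: filterS2 => eps [h1 h2] /h2.
split.
- by apply: nearW => eps; exact: (is_test_quad (extreme_supp beta alpha0 (z0 eps) (m := m eps))).
(* The positive part of the excess of level; [key] shows that it vanishes in the limit. *)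
- exists (fun eps => Num.max 0 (err1 xi eps (quad_test (v eps) eps H) - theta)); split.
    apply: cvgr0P => e e0; apply: filterS (key e e0) => eps [_ [h _]].
    by rewrite ger0_norm ?le_max ?lexx// ge_max (ltW e0)/=; lra.
  apply: nearW => eps; rewrite -lerBlDl le_max lexx orbT//.
- apply: cvgr0P => e e0; have e20 : 0 < e / 2 by rewrite divr_gt0.
  apply: filterS (key _ e20) => eps [h1 [_ h2]].
  rewrite distrC in h1; apply: le_trans (ler_distD (Phi (H - ev eps (r eps))) _ _) _.
  by rewrite [e]splitr; exact: lerD.
Qed.

Lemma quad_minimax_total :
  asymp_minimax_total xi (fun eps => Theta (r eps))
    (fun eps => quad_test (v eps) eps (ev eps (r eps) / 2)).
Proof.
split.
  by apply: nearW => eps; exact: (is_test_quad (extreme_supp beta alpha0 (z0 eps) (m := m eps))).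
apply: cvgr0P => e e0; have e20 : 0 < e / 2 by rewrite divr_gt0.
have h := uniform_near rv (minimax_total e20).
move: h zm; apply: filterS2 => eps [h1 h2] /h2 {}h2.
rewrite distrC in h1; apply: le_trans (ler_distD (2 * Phi (- (ev eps (r eps) / 2))) _ _) _.
by rewrite [e]splitr; exact: lerD.
Qed.

End family.

(** * Separation rates *)

Local Notation c := (beta + 1 / 4).
Local Notation rstar := (fun eps : R => eps * (ln eps^-1) `^ c).

Let c0 : 0 < c. Proof. by rewrite addr_gt0// divr_gt0. Qed.

Lemma rstar_gt0 eps : 0 < eps < 1 -> 0 < rstar eps.
Proof.
move=> /andP[e0 e1]; rewrite mulr_gt0// powR_gt0// ln_gt0//.
by rewrite invf_gt1.
Qed.

(** The exponential is the square root of [eps]. With [L = ln (1 / eps)], the slope [1 / (2 c)] in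
    [ln_linear] gives [L^c <= exp (c K) exp (L / 2)]. Hence [r <= rstar] makes [ln (1 / r)] at least
    of the order of [L]. *)
Lemma rstar_le : exists C : R, 0 < C /\ forall eps, 0 < eps < 1 ->
  rstar eps <= C * expR (ln eps / 2).
Proof.
have d0 : 0 < (2 * c)^-1 by rewrite invr_gt0 mulr_gt0.
have [K hK] := ln_linear d0.
exists (expR (c * K)); split; first exact: expR_gt0.
move=> eps /andP[e0 e1].
have L0 : 0 < ln eps^-1 by rewrite ln_gt0// invf_gt1.
rewrite -{1}[eps]lnK ?posrE// /powR (gt_eqF L0) -!expRD ler_expR.
have := hK _ L0; rewrite -(ler_pM2l c0) mulrDr mulrA.
have -> : c * (2 * c)^-1 = 1 / 2 by rewrite invfM mulrCA divff ?gt_eqF// mulr1 mul1r.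
have -> : ln eps = - ln eps^-1 by rewrite lnV ?posrE// opprK.
lra.
Qed.

Lemma near_small (x : R) : 0 < x -> \forall eps \near 0^'+, 0 < (eps : R) < x.
Proof.
move=> x0; near=> eps; apply/andP; split; first by near: eps; exact: nbhs_right_gt.
by near: eps; apply: nbhs_right_lt.
Unshelve. all: by end_near. Qed.

Lemma rstar_vanishing : vanishing_family rstar.
Proof.
split; first by apply: filterS (near_small ltr01) => eps /rstar_gt0.
have [C [C0 hC]] := rstar_le.
apply: cvgr0P => e e0; near=> eps.
have eu : 0 < eps < 1 by near: eps; exact: (near_small ltr01).
rewrite ger0_norm ?(ltW (rstar_gt0 eu))//; apply: (le_trans (hC _ eu)).
have eC : 0 < e / C by rewrite divr_gt0.
have es : 0 < eps < expR (2 * ln (e / C)) by near: eps; apply: near_small; exact: expR_gt0.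
rewrite -ler_pdivlMl// [_^-1 * e]mulrC -[leRHS]lnK ?posrE// ler_expR.
have /andP[e1 e2] := es.
have : ln eps <= 2 * ln (e / C) by rewrite -[leRHS]expRK ler_ln ?posrE ?expR_gt0// ltW.
lra.
Unshelve. all: by end_near. Qed.

(** Apart from the square of [r / rstar], only the ratio of the two logarithms remains to be
    controlled in each regime. *)
Lemma rate_split eps r : 0 < eps < 1 -> 0 < r < 1 ->
  rate eps r = c2 * (r / rstar eps) ^+ 2 * (ln eps^-1 / ln r^-1) `^ (2 * beta + 1 / 2).
Proof.
move=> eu ru; have st0 := rstar_gt0 eu.
case/andP: eu => e0 e1; case/andP: ru => r0 r1.
have L0 : 0 < ln eps^-1 by rewrite ln_gt0// invf_gt1.
have l0 : 0 < ln r^-1 by rewrite ln_gt0// invf_gt1.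
rewrite /rate; have -> : - (2 * beta) - 1 / 2 = - (2 * beta + 1 / 2) by ring.
rewrite powRN powRM ?(ltW L0) ?invr_ge0 ?(ltW l0)//.
have -> : (ln r^-1)^-1 `^ (2 * beta + 1 / 2) = (ln r^-1 `^ (2 * beta + 1 / 2))^-1.
  by rewrite -powR_inv1 ?(ltW l0)// -powRrM mulN1r powRN.
have -> : 2 * beta + 1 / 2 = c * 2 by field.
rewrite !(powRrM _ c 2) !powR_mulrn ?powR_ge0//.
have : 0 < ln eps^-1 `^ c by rewrite powR_gt0.
have : 0 < ln r^-1 `^ c by rewrite powR_gt0.
move: (ln r^-1 `^ c) (ln eps^-1 `^ c) => x y x0 y0.
by field; rewrite !gt_eqF.
Qed.

Lemma rate_gt0 eps r : 0 < eps < 1 -> 0 < r < 1 -> 0 < rate eps r.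
Proof.
move=> /andP[e0 e1] /andP[r0 r1].
apply: mulr_gt0; last by rewrite powR_gt0// ln_gt0// invf_gt1.
apply: mulr_gt0; last exact: exprn_gt0.
by apply: mulr_gt0; [exact: rate_const_gt0|rewrite invr_gt0 exprn_gt0].
Qed.

Lemma extreme_value_rate (r : R -> R) : vanishing_family r ->
  \forall eps \near 0^'+, [/\ 0 < eps < 1, 0 < r eps < 1,
    ev eps (r eps) <= 2 * rate eps (r eps) & rate eps (r eps) / 2 <= ev eps (r eps)].
Proof.
move=> rv; have h0 : 0 < 1 / 2 :> R by rewrite divr_gt0.
near=> eps.
have eu : 0 < eps < 1 by near: eps; exact: (near_small ltr01).
have ru : 0 < r eps < 1 by near: eps; exact: near_vanishing.
have : `|ev eps (r eps) / rate eps (r eps) - 1| <= 1 / 2.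
  by near: eps; apply: (uniform_near (Q := fun s eps => `|ev eps s / rate eps s - 1| <= 1 / 2) rv (asymp_bounds h0)).
have d0 := rate_gt0 eu ru.
rewrite ler_distl ler_pdivrMr// ler_pdivlMr// => /andP[h1 h2].
split=> //; lra.
Unshelve. all: by end_near. Qed.

Section regimes.
Variables (r : R -> R) (rv : vanishing_family r).

(** Here [r <= rstar <= C sqrt eps], which bounds the ratio of logarithms by 4. *)
Lemma extreme_value_small : (r eps / rstar eps) @[eps --> 0^'+] --> 0 ->
  ev eps (r eps) @[eps --> 0^'+] --> 0.
Proof.
move=> rr; have [C [C0 hC]] := rstar_le.
have K0 : 0 < 2 * (c2 * 4 `^ (2 * beta + 1 / 2)).
  by apply: mulr_gt0 => //; apply: mulr_gt0; [exact: rate_const_gt0|exact: powR_gt0].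
apply: cvgr0P => e e0; near=> eps.
have [eu ru ub _] : [/\ 0 < eps < 1, 0 < r eps < 1,
    ev eps (r eps) <= 2 * rate eps (r eps) & rate eps (r eps) / 2 <= ev eps (r eps)].
  by near: eps; exact: extreme_value_rate.
rewrite ger0_norm ?sqrtr_ge0//; apply: (le_trans ub); rewrite rate_split//.
have st0 := rstar_gt0 eu.
have q0 : 0 < r eps / rstar eps by rewrite divr_gt0//; case/andP: ru.
have q1 : r eps / rstar eps < 1 by near: eps; apply: (cvgr_lt 0 rr).
have q2 : r eps / rstar eps < e / (2 * (c2 * 4 `^ (2 * beta + 1 / 2))).
  by near: eps; apply: (cvgr_lt 0 rr); rewrite divr_gt0.
(* Below this value, [ln (1 / r) >= ln (1 / eps) / 2 - ln C] is at least [ln (1 / eps) / 4]. *)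
have es : 0 < eps < expR (- (4 * ln C)) by near: eps; apply: near_small; exact: expR_gt0.
case/andP: (eu) => e1 e2; case/andP: (ru) => r0 r1.
have L0 : 0 < ln eps^-1 by rewrite ln_gt0// invf_gt1.
have l0 : 0 < ln (r eps)^-1 by rewrite ln_gt0// invf_gt1.
have rle : r eps <= C * expR (ln eps / 2).
  by apply: le_trans (hC _ eu); rewrite -[leRHS]mul1r -ler_pdivrMr// ltW.
have Ll : ln eps^-1 / ln (r eps)^-1 <= 4.
  rewrite ler_pdivrMr// !lnV ?posrE//.
  have h1 : ln (r eps) <= ln C + ln eps / 2.
    rewrite -[X in _ <= _ + X]expRK -lnM ?posrE ?expR_gt0//.
    by rewrite ler_ln ?posrE// mulr_gt0// expR_gt0.
  have h2 : ln eps <= - (4 * ln C).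
    by rewrite -[leRHS]expRK ler_ln ?posrE ?expR_gt0// ltW//; case/andP: es.
  lra.
have pw : (ln eps^-1 / ln (r eps)^-1) `^ (2 * beta + 1 / 2) <= 4 `^ (2 * beta + 1 / 2).
  apply: ge0_ler_powR; rewrite ?nnegrE ?divr_ge0 ?(ltW L0) ?(ltW l0)//.
  by rewrite addr_ge0 ?divr_ge0// mulr_ge0// ltW.
have p0 : 0 <= (ln eps^-1 / ln (r eps)^-1) `^ (2 * beta + 1 / 2) by exact: powR_ge0.
move: q0 q1 q2; set q := r eps / rstar eps => q0 q1 q2.
have qq : q ^+ 2 <= q by rewrite expr2 ler_piMl// ltW.
have cc := rate_const_gt0.
have h1 : c2 * q ^+ 2 <= c2 * q by rewrite ler_pM2l.
have h2 : c2 * q ^+ 2 * (ln eps^-1 / ln (r eps)^-1) `^ (2 * beta + 1 / 2) <= c2 * q * 4 `^ (2 * beta + 1 / 2).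
  by apply: ler_pM => //; rewrite mulr_ge0 ?sqr_ge0// ltW.
have h3 : q * (2 * (c2 * 4 `^ (2 * beta + 1 / 2))) <= e by rewrite -ler_pdivlMr// ltW.
lra.
Unshelve. all: by end_near. Qed.

(** Here [r >= rstar >= eps] once [ln (1 / eps) >= 1], so the ratio of logarithms is at least 1 and
    the square of [r / rstar] alone forces divergence. *)
Lemma extreme_value_large : (r eps / rstar eps) @[eps --> 0^'+] --> +oo ->
  forall X : R, \forall eps \near 0^'+, X <= ev eps (r eps).
Proof.
move=> rr X; have cc := rate_const_gt0.
near=> eps.
have [eu ru _ lb] : [/\ 0 < eps < 1, 0 < r eps < 1,
    ev eps (r eps) <= 2 * rate eps (r eps) & rate eps (r eps) / 2 <= ev eps (r eps)].
  by near: eps; exact: extreme_value_rate.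
apply: le_trans lb; rewrite rate_split//.
have st0 := rstar_gt0 eu.
case/andP: (eu) => e1 e2; case/andP: (ru) => r0 r1.
have q1 : 1 <= r eps / rstar eps by near: eps; exact: (cvgry_ge rr).
have q2 : `|X| * 2 / c2 <= r eps / rstar eps by near: eps; exact: (cvgry_ge rr).
have es : 0 < eps < expR (- 1) by near: eps; apply: near_small; exact: expR_gt0.
have L1 : 1 <= ln eps^-1.
  rewrite lnV ?posrE//; have : ln eps <= -1.
    by rewrite -[leRHS]expRK ler_ln ?posrE ?expR_gt0// ltW//; case/andP: es.
  lra.
have re : eps <= r eps.
  have : 1 * rstar eps <= r eps by rewrite -ler_pdivlMr.
  rewrite mul1r; apply: le_trans; rewrite ler_peMr ?(ltW e1)//.
  have h : (1 : R) `^ c = 1 by rewrite powR1.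
  by rewrite -[leLHS]h; apply: ge0_ler_powR; rewrite ?nnegrE ?(ltW c0)//; lra.
have l0 : 0 < ln (r eps)^-1 by rewrite ln_gt0// invf_gt1.
have Ll : 1 <= ln eps^-1 / ln (r eps)^-1.
  by rewrite ler_pdivlMr// mul1r !lnV ?posrE// lerN2 ler_ln ?posrE.
have pw : 1 <= (ln eps^-1 / ln (r eps)^-1) `^ (2 * beta + 1 / 2).
  have h : (1 : R) `^ (2 * beta + 1 / 2) = 1 by rewrite powR1.
  rewrite -[leLHS]h; apply: ge0_ler_powR; rewrite ?nnegrE//; last by lra.
  by rewrite addr_ge0 ?divr_ge0// mulr_ge0// ltW.
move: q1 q2; set q := r eps / rstar eps => q1 q2.
have qq : q <= q ^+ 2 by rewrite expr2 ler_peMl//; lra.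
have h1 : `|X| * 2 <= c2 * q by rewrite [c2 * q]mulrC -ler_pdivrMr.
have h2 : c2 * q <= c2 * q ^+ 2 by rewrite ler_pM2l.
have h3 : c2 * q ^+ 2 * 1 <= c2 * q ^+ 2 * (ln eps^-1 / ln (r eps)^-1) `^ (2 * beta + 1 / 2).
  by rewrite ler_wpM2l// mulr_ge0 ?sqr_ge0// ltW.
have := ler_norm X.
lra.
Unshelve. all: by end_near. Qed.

Lemma Phi0 : 2 * Phi (0 : R) = 1.
Proof. by have := Phi_opp (0 : R); rewrite oppr0; lra. Qed.

(** As [u] tends to 0 the sharp asymptotics tend to [2 Phi 0 = 1] and [Phi H = 1 - theta]. *)
Lemma not_separated : (r eps / rstar eps) @[eps --> 0^'+] --> 0 ->
  minimax_total_err xi eps (Theta (r eps)) @[eps --> 0^'+] --> (1 : R) /\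
  forall theta : R, 0 < theta < 1 ->
    minimax_err2 xi eps (Theta (r eps)) theta @[eps --> 0^'+] --> 1 - theta.
Proof.
move=> /extreme_value_small u0; split=> [|theta /andP[t0 t1]].
  apply/(@cvgrPdist_le _ R^o) => e e0; have e20 : 0 < e / 2 by rewrite divr_gt0.
  have /cvgrPdist_le/(_ _ e20) h1 := u0.
  have /cvgrPdist_le/(_ _ e20) h2 := sharp_total rv.
  move: h1 h2; apply: filterS2 => eps; rewrite !sub0r !normrN => h1.
  rewrite ler_norml => h2.
  have h3 : `|2 * Phi (- (ev eps (r eps) / 2)) - 2 * Phi 0| <= e / 2.
    rewrite -mulrBr normrM ger0_norm//.
    have := Phi_dist (- (ev eps (r eps) / 2)) 0.
    rewrite subr0 normrN normrM (ger0_norm (_ : 0 <= 2^-1)) ?invr_ge0//; lra.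
  move: h3; rewrite Phi0 ler_distl => h3; rewrite ler_distl; lra.
have [H PH] : exists H : R, Phi H = 1 - theta by apply: Phi_quantile; lra.
apply/(@cvgrPdist_le _ R^o) => e e0; have e20 : 0 < e / 2 by rewrite divr_gt0.
have /cvgrPdist_le/(_ _ e20) h1 := u0.
have /cvgrPdist_le/(_ _ e20) h2 := sharp_level rv PH.
move: h1 h2; apply: filterS2 => eps; rewrite !sub0r !normrN => h1.
rewrite ler_norml => h2.
have h3 : `|Phi (H - ev eps (r eps)) - Phi H| <= e / 2.
  apply: le_trans (Phi_dist _ _) _.
  by rewrite (_ : H - ev eps (r eps) - H = - ev eps (r eps)) ?normrN//; ring.
by move: h3; rewrite PH ler_distl => h3; rewrite ler_distl; lra.
Qed.

Lemma separated : (r eps / rstar eps) @[eps --> 0^'+] --> +oo ->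
  minimax_total_err xi eps (Theta (r eps)) @[eps --> 0^'+] --> 0 /\
  forall theta : R, 0 < theta < 1 ->
    minimax_err2 xi eps (Theta (r eps)) theta @[eps --> 0^'+] --> 0.
Proof.
move=> /extreme_value_large uoo; split=> [|theta /andP[t0 t1]].
  apply: cvgr0P => e e0; have e20 : 0 < e / 4 by rewrite divr_gt0.
  have [X hX] := Phi_small e20.
  have /cvgrPdist_le/(_ _ e20) h2 := sharp_total rv.
  move: (uoo (2 * X)) h2; apply: filterS2 => eps h1; rewrite sub0r normrN ler_norml => h2.
  have h3 : Phi (- (ev eps (r eps) / 2)) <= e / 4 by apply: hX; lra.
  have := Phi_ge0 (- (ev eps (r eps) / 2)).
  rewrite ler_norml; lra.
have [H PH] : exists H : R, Phi H = 1 - theta by apply: Phi_quantile; lra.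
apply: cvgr0P => e e0; have e20 : 0 < e / 2 by rewrite divr_gt0.
have [X hX] := Phi_small e20.
have /cvgrPdist_le/(_ _ e20) h2 := sharp_level rv PH.
move: (uoo (H + X)) h2; apply: filterS2 => eps h1; rewrite sub0r normrN ler_norml => h2.
have h3 : Phi (H - ev eps (r eps)) <= e / 2 by apply: hX; lra.
have := Phi_ge0 (H - ev eps (r eps)).
rewrite ler_norml; lra.
Qed.

End regimes.

End uniform.

Theorem theorem4p5 (R : realType) (alpha beta : R)
    (halpha : 0 < alpha) (hbeta : 0 < beta) :
  exists c2 : R, 0 < c2 /\
  forall (d : measure_display) (Omega : measurableType d)
    (P : probability Omega R) (xi : nat -> {RV P >-> R}),
  iid_std_normal xi ->
  (forall r : R -> R, vanishing_family r ->
    (* (a) *)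
    [/\ forall theta H : R, 0 < theta < 1 -> Phi H = 1 - theta ->
          (minimax_err2 xi eps
             (Theta2r (exp_coef alpha) (pow_coef beta) (r eps)) theta -
           Phi (H - extreme_value (exp_coef alpha) (pow_coef beta) eps (r eps)))
            @[eps --> 0^'+] --> 0,
        (minimax_total_err xi eps
           (Theta2r (exp_coef alpha) (pow_coef beta) (r eps)) -
         2 * Phi (- (extreme_value (exp_coef alpha) (pow_coef beta)
                       eps (r eps) / 2)))
          @[eps --> 0^'+] --> 0
      & asymp_equiv
          (fun eps =>
             extreme_value (exp_coef alpha) (pow_coef beta) eps (r eps))
          (fun eps => c2 * eps ^- 2 * r eps ^+ 2 *
             (ln (r eps)^-1) `^ (- (2 * beta) - 1 / 2))] /\
    (* (b) *)
    (\forall eps \near 0^'+,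
       exists! zm : R * R, extreme_params alpha beta (r eps) zm.1 zm.2) /\
    (forall z0 m : R -> R,
      (\forall eps \near 0^'+,
         extreme_params alpha beta (r eps) (z0 eps) (m eps)) ->
      [/\ \forall eps \near 0^'+, forall eta : nat -> R,
            extreme_sequence (exp_coef alpha) (pow_coef beta) (r eps) eta <->
            forall k, eta k ^+ 2 = extreme_sq alpha beta (z0 eps) (m eps) k,
          forall theta H : R, 0 < theta < 1 -> Phi H = 1 - theta ->
            asymp_minimax_level xi
              (fun eps => Theta2r (exp_coef alpha) (pow_coef beta) (r eps))
              theta
              (fun eps =>
                 quad_test (extreme_sq alpha beta (z0 eps) (m eps)) eps H)
        & asymp_minimax_total xi
            (fun eps => Theta2r (exp_coef alpha) (pow_coef beta) (r eps))
            (fun eps =>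
               quad_test (extreme_sq alpha beta (z0 eps) (m eps)) eps
                 (extreme_value (exp_coef alpha) (pow_coef beta)
                    eps (r eps) / 2))])) /\
  (* (c) *)
  separation_rate xi (Theta2r (exp_coef alpha) (pow_coef beta))
    (fun eps => eps * (ln eps^-1) `^ (beta + 1 / 4)).
Proof.
exists (rate_const alpha beta); split; first exact: rate_const_gt0.
move=> d Omega P xi iid; split=> [r rv|].
  split; first split.
  - by move=> theta H _ PH; exact: sharp_level.
  - exact: sharp_total.
  - exact: extreme_value_asymp.
  split; first exact: near_params.
  move=> z0 m zm; split.
  - apply: filterS zm => eps zm eta.
    exact: (extreme_sequenceP halpha hbeta zm (extreme_supp beta halpha (z0 eps) (m := m eps))).
  - by move=> theta H _ PH; exact: (quad_minimax_level halpha hbeta iid rv zm PH).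
  - exact: (quad_minimax_total halpha hbeta iid rv zm).
split; first exact: (rstar_vanishing hbeta).
move=> r rv; split=> h; first exact: (not_separated halpha hbeta iid rv).
exact: (separated halpha hbeta iid rv).
Qed.
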